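(* Let $G=(X,E)$ be a bounded degree connected graph. The action $W(X)\curvearrowright X$ is diffuse-extensively amenable if and only if $X$ is recurrent. (In particular, for $d\ge3$, the action $W(\mathbb{Z}^d)\curvearrowright\mathbb{Z}^d$ is not diffuse-extensively amenable.)
   Context: Let $d_G$ be the graph distance of $G=(X,E)$, and let $\mathfrak{S}(X)$ be the group of all permutations of $X$, with the topology of pointwise convergence. For $\sigma\in\mathfrak{S}(X)$, $\mathrm{range}(\sigma)=\sup_{x\in X}d_G(x,\sigma(x))$. The wobbling group is $W(X)=\{\sigma\in\mathfrak{S}(X):\mathrm{range}(\sigma)<\infty\}$, and for $r\in\mathbb{N}$, $r\ge1$, $W_r(X)=\{\sigma\in W(X):\mathrm{range}(\sigma)\le r\}$, a compact subset. A Borel probability measure $\mu$ is symmetric if $\mu(A)=\mu(A^{-1})$ for every Borel set $A$, where $A^{-1}=\{\sigma:\sigma^{-1}\in A\}$. The random walk induced by $\mu$ is $\tau_0=\mathrm{Id}$, $\tau_n=s_n\circ\cdots\circ s_1$ with $(s_i)_{i\ge1}$ i.i.d. of law $\mu$. The inverted orbit of $x\in X$ is $O_n(x)=\bigcup_{0\le j\le n}\tau_j^{-1}(\{x\})$. Definition (diffuse-extensive amenability): the action $W(X)\curvearrowright X$ is diffuse-extensively amenable iff for every integer $r\ge1$, every $x\in X$ and every (possibly diffuse) symmetric Borel probability measure $\mu$ supported on $W_r(X)$, the inverted orbits $(O_n(x))_{n\ge0}$ of the random walk induced by $\mu$ satisfy one of the following two equivalent conditions: (i) for any $\varepsilon>0$,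 $\mathbb{P}[|O_n(x)|\le\varepsilon n]\ge e^{-\varepsilon n}$ for $n$ large enough; (ii) $\lim_{n\to\infty}\frac1n\log\mathbb{E}[(\frac12)^{|O_n(x)|}]=0$. $X$ is recurrent if simple random walk on the graph $G$ is recurrent. $\mathbb{Z}^d$ carries its nearest-neighbour graph structure. *)

(* Defs.v *)
From HB Require Import structures.
From mathcomp Require Import all_boot all_order all_algebra finmap.
From mathcomp Require Import all_classical all_reals all_analysis.

Set Implicit Arguments.
Unset Strict Implicit.
Unset Printing Implicit Defensive.

Import Order.TTheory GRing.Theory Num.Theory.
Import numFieldNormedType.Exports.

Local Open Scope classical_set_scope.
Local Open Scope ring_scope.

(* A graph on the (possibly infinite) vertex type X is its adjacency relation
   E : rel X. *)

Definition simple_graph (X : choiceType) (E : rel X) : Prop :=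
  symmetric E /\ irreflexive E.

Definition connected_graph (X : choiceType) (E : rel X) : Prop :=
  forall x y : X, exists2 p : seq X, path E x p & last x p = y.

Definition neighbors (X : choiceType) (E : rel X) (x : X) : set X :=
  [set y | E x y].

(* [fset_set] is empty on infinite sets, so the value is the degree only when
   [neighbors E x] is finite. *)
Definition degree (X : choiceType) (E : rel X) (x : X) : nat :=
  #|` fset_set (neighbors E x)|%fset.

Definition bounded_degree (X : choiceType) (E : rel X) : Prop :=
  exists D : nat, forall x : X,
    finite_set (neighbors E x) /\ (degree E x <= D)%N.

Definition gdist (R : realType) (X : choiceType) (E : rel X) (x y : X) : \bar R :=
  ereal_inf [set (size p)%:R%:E | p in [set p | path E x p /\ last x p = y]].

(* The permutations of X, as the subspace of bijections in X -> X with the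
   product topology, X being discrete. *)
Definition bijections (X : choiceType) : set {ptws X -> discrete_topology X} :=
  [set f | bijective f].

Definition symgroup (X : choiceType) : Type := set_type (@bijections X).

Lemma id_bijective (X : choiceType) : (id : X -> X) \in @bijections X.
Proof. by apply/mem_set; exists id. Qed.

HB.instance Definition _ (X : choiceType) :=
  Topological.copy (symgroup X) (set_type (@bijections X)).
HB.instance Definition _ (X : choiceType) :=
  isPointed.Build (symgroup X) (SigSub (id_bijective X)).

Definition perm_fun (X : choiceType) (s : symgroup X) : X -> X := \val s.

Definition borel_symgroup (X : choiceType) :=
  g_sigma_algebraType (@open (symgroup X)).

Definition set_inv (X : choiceType) (A : set (symgroup X)) : set (symgroup X) :=
  [set s | exists2 t, A t &
     cancel (perm_fun s) (perm_fun t) /\ cancel (perm_fun t) (perm_fun s)].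

Definition perm_range (R : realType) (X : choiceType) (E : rel X)
    (s : symgroup X) : \bar R :=
  ereal_sup [set gdist R E x (perm_fun s x) | x in [set: X]].

Definition wobbling (R : realType) (X : choiceType) (E : rel X) :
    set (symgroup X) :=
  [set s | (perm_range R E s < +oo)%E].

Definition wobbling_le (R : realType) (X : choiceType) (E : rel X) (r : nat) :
    set (symgroup X) :=
  [set s | wobbling R E s /\ (perm_range R E s <= r%:R%:E)%E].

Definition symmetric_measure (R : realType) (X : choiceType)
    (mu : probability (borel_symgroup X) R) : Prop :=
  forall A : set (borel_symgroup X), measurable A -> mu A = mu (set_inv A).

(* [wobbling_le R E r] is closed, so full mass means that it contains the
   support. *)
Definition supported_on (R : realType) (X : choiceType)
    (mu : probability (borel_symgroup X) R) (K : set (borel_symgroup X)) : Prop :=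
  mu K = 1%E.

Definition mutually_independent (R : realType) (d d' : measure_display)
    (Omega : measurableType d) (P : probability Omega R)
    (T : measurableType d') (s : nat -> {RV P >-> T}) : Prop :=
  forall (J : {fset nat}) (A : nat -> set T),
    (forall i, measurable (A i)) ->
    P (\bigcap_(i in [set` J]) (s i @^-1` A i)) =
      (\prod_(i <- J) P (s i @^-1` A i))%E.

Definition iid (R : realType) (d d' : measure_display)
    (Omega : measurableType d) (P : probability Omega R)
    (T : measurableType d') (mu : probability T R)
    (s : nat -> {RV P >-> T}) : Prop :=
  mutually_independent s /\
  forall (i : nat) (A : set T), measurable A -> distribution P (s i) A = mu A.

(* Increments are indexed from 0: [s i] is the (i+1)-st increment. *)
Fixpoint walk (X : choiceType) (Omega : Type)
    (s : nat -> Omega -> symgroup X) (n : nat) (w : Omega) : X -> X :=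
  if n is m.+1 then perm_fun (s m w) \o walk s m w else id.

Definition inverted_orbit (X : choiceType) (Omega : Type)
    (s : nat -> Omega -> symgroup X) (n : nat) (x : X) (w : Omega) : set X :=
  \bigcup_(j in `I_n.+1) (walk s j w @^-1` [set x]).

Definition inverted_orbit_size (X : choiceType) (Omega : Type)
    (s : nat -> Omega -> symgroup X) (n : nat) (x : X) (w : Omega) : nat :=
  #|` fset_set (inverted_orbit s n x w)|%fset.

Definition small_orbit_likely (R : realType) (X : choiceType)
    (d : measure_display) (Omega : measurableType d) (P : probability Omega R)
    (s : nat -> Omega -> symgroup X) (x : X) : Prop :=
  forall eps : R, 0 < eps ->
    \forall n \near \oo,
      ((expR (- (eps * n%:R)))%:E <=
       P [set w | ((inverted_orbit_size s n x w)%:R <= eps * n%:R :> R)%R])%E.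

Definition no_exponential_decay (R : realType) (X : choiceType)
    (d : measure_display) (Omega : measurableType d) (P : probability Omega R)
    (s : nat -> Omega -> symgroup X) (x : X) : Prop :=
  (fun n : nat => n%:R^-1 *
     ln (fine 'E_P[fun w => (2^-1 ^+ inverted_orbit_size s n x w)%R]%E))
    @ \oo --> (0 : R).

(* The two alternatives are equivalent for a given walk:
   2^(-eps n) P[|O_n| <= eps n] <= E[2^(-|O_n|)] <= P[|O_n| <= eps n] + 2^(-eps n). *)
Definition diffuse_extensively_amenable (R : realType) (X : choiceType)
    (E : rel X) : Prop :=
  forall (r : nat) (x : X) (mu : probability (borel_symgroup X) R),
    (1 <= r)%N -> symmetric_measure mu -> supported_on mu (wobbling_le R E r) ->
    forall (d : measure_display) (Omega : measurableType d)
      (P : probability Omega R) (s : nat -> {RV P >-> borel_symgroup X}),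
    iid mu s ->
    small_orbit_likely P s x \/ no_exponential_decay P s x.

(* The walk stays put at an isolated vertex (which a connected graph has only
   when it is a single vertex). *)
Definition srw_step (R : realType) (X : choiceType) (E : rel X) (x y : X) : R :=
  if degree E x == 0%N then (x == y)%:R else (E x y)%:R / (degree E x)%:R.

Definition simple_random_walk (R : realType) (X : choiceType) (E : rel X)
    (d : measure_display) (Omega : measurableType d) (P : probability Omega R)
    (x : X) (S : nat -> Omega -> X) : Prop :=
  (forall (n : nat) (y : X), measurable (S n @^-1` [set y])) /\
  forall (n : nat) (y : nat -> X),
    P (\bigcap_(i in `I_n.+1) (S i @^-1` [set y i])) =
      ((y 0%N == x)%:R * \prod_(i < n) srw_step R E (y i) (y i.+1))%:E.

Definition recurrent (R : realType) (X : choiceType) (E : rel X) : Prop :=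
  forall (x : X) (d : measure_display) (Omega : measurableType d)
    (P : probability Omega R) (S : nat -> Omega -> X),
    simple_random_walk E P x S ->
    P [set w | exists2 n : nat, (1 <= n)%N & S n w = x] = 1%E.

Definition Zd_graph (d : nat) : rel 'rV[int]_d :=
  fun u v => \sum_(i < d) `|u 0 i - v 0 i| == 1.

(* Main.v *)
(* Everything is reduced to the condition that a vertex x has zero capacity:
   there are finitely supported functions f with f x = 1 of arbitrarily small
   Dirichlet energy.  For a reversible chain this is equivalent to recurrence,
   and since Dirichlet energies of symmetric finite-range chains on a graph of
   bounded degree are dominated by that of the simple random walk, recurrence of
   the graph makes the chain with kernel p(y, z) = mu(s z = y) recurrent.  The
   expected number of points added to the inverted orbit at time k is the
   probability that this chain avoids x during k steps, so E|O_n| = o(n), and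
   Markov's inequality gives alternative (i).

   Conversely, split the edges into finitely many matchings, and let mu be the
   law of a composition of layers, where a layer swaps the endpoints of each edge
   of one matching independently with probability 1/2, and the sequence of
   matchings is a palindrome (so that mu is symmetric).  Read backwards in time,
   the inverted orbit alternates between independent random swaps and the
   insertion of x.  If A is the current set and rho(v) = P(v in A), both
   operations preserve the inequality
     E prod_(v in A) h(v) <= prod_v (1 - rho(v) (1 - h(v)))   for 0 <= h <= 1,
   hence E 2^(-|O_n|) <= exp(- E|O_n| / 2).  If x has positive capacity then E|O_n|
   grows linearly, which contradicts (i) and (ii).

   For Z^d with d >= 3, positive capacity follows from the explicit flow of
   finite energy given by the transition probabilities of Polya's urn with three
   colours. *)
From HB Require Import structures.
From mathcomp Require Import all_boot all_order all_algebra finmap.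
From mathcomp Require Import all_classical all_reals all_analysis.
Require Import Defs.
From mathcomp Require Import measurable_realfun lra zify.

Set Implicit Arguments.
Unset Strict Implicit.
Unset Printing Implicit Defensive.

Import Order.TTheory GRing.Theory Num.Theory.
Import numFieldNormedType.Exports.

Local Open Scope classical_set_scope.
Local Open Scope ring_scope.

(** * Capacity and escape probability of reversible chains *)

(** Capacity is the hub because Dirichlet energies compare term by term between kernels, whereas
    recurrence of one walk says nothing directly about another. The comparison runs both ways: a
    symmetric kernel of range r is bounded by the graph, and the random product of swaps crosses
    every edge with probability at least 2^-(2L), so the graph is bounded by its kernel. These swaps
    act at infinitely many places at once, but n steps seen from x involve finitely many coins.
    Expectations thus become iterated averages over finite lists of coins, on which the correlation
    inequality is an induction over single swaps and insertions. Both [recurrent] and amenability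
    quantify over all realisations of a process, so as hypotheses they yield something only once a
    realisation is at hand: the simple random walk and the coins are both read off the digits of a
    uniform variable. Connectedness makes X countable; the Borel sets are then generated by the
    countably many cylinders, and laws and independence need be checked only on these. *)

Section finite_sums.
Variables (R : realType) (X : choiceType).
Implicit Types (V W : seq X) (F : X -> R).

Lemma sum_supp V W F : uniq V -> uniq W ->
  (forall y, y \notin V -> F y = 0) -> {subset V <= W} ->
  \sum_(y <- W) F y = \sum_(y <- V) F y.
Proof.
move=> uV uW F0 VW.
rewrite (bigID (mem V)) /= [X in _ + X]big1 ?addr0; last by move=> i /F0.
rewrite -big_filter; apply: perm_big; apply: uniq_perm => //.
  exact: filter_uniq.
move=> y; rewrite mem_filter; apply/andP/idP => [[]//|yV].
by split=> //; exact: VW.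
Qed.

Lemma ler_sum_subset V W F : uniq V -> uniq W -> (forall y, 0 <= F y) ->
  {subset V <= W} -> \sum_(y <- V) F y <= \sum_(y <- W) F y.
Proof.
move=> uV uW F0 VW.
rewrite [leRHS](bigID (mem V)) /= -[leLHS]addr0 lerD //; last first.
  by apply: sumr_ge0.
rewrite -[leRHS]big_filter; rewrite le_eqVlt; apply/orP; left; apply/eqP.
apply: perm_big; apply: uniq_perm => //; first exact: filter_uniq.
move=> y; rewrite mem_filter; apply/idP/andP => [yV|[]//].
by split=> //; exact: VW.
Qed.

End finite_sums.

Section energy.
Variables (R : realType) (X : choiceType).
Implicit Types (c : X -> X -> R) (f : X -> R).

Definition energy c (W : seq X) f : R :=
  \sum_(y <- W) \sum_(z <- W) c y z * (f y - f z) ^+ 2.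

(** Bounding the energy on every finite window [W] replaces an infinite sum over [X]. Ordered pairs
    are summed, so each edge counts twice, which affects only constants. *)
Definition zero_capacity c (x : X) : Prop :=
  forall eps : R, 0 < eps -> exists f : X -> R, exists V : seq X,
    [/\ forall y, y \notin V -> f y = 0, f x = 1 &
        forall W, uniq W -> energy c W f <= eps].

(** The diagonal carries no energy, so kernels that differ in their holding probabilities can still
    be compared. *)
Lemma zero_capacity_le c c' (C : R) x : 0 < C ->
  (forall y z, y != z -> c y z <= C * c' y z) ->
  zero_capacity c' x -> zero_capacity c x.
Proof.
move=> C0 cc' zc eps eps0.
have [f [V [fV fx fW]]] := zc (eps / C) (divr_gt0 eps0 C0).
exists f, V; split=> // W uW.
have := fW W uW; rewrite ler_pdivlMr// => /(le_trans _); apply.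
rewrite mulrC mulr_sumr; apply: ler_sum => y _.
rewrite mulr_sumr; apply: ler_sum => z _.
have [->|yz] := eqVneq y z; first by rewrite subrr expr0n /= !mulr0.
rewrite [leRHS]mulrA. apply: ler_wpM2r; [exact: sqr_ge0|exact: cc'].
Qed.

End energy.

Section chain.
Variables (R : realType) (X : choiceType).
Variables (nb : X -> seq X) (p : X -> X -> R) (w : X -> R).

(** Probability of not being at [x] at the times 1, .., n. The starting point is not tested, so
    [avoid x n x] is the probability of no return within n steps. *)
Fixpoint avoid (x : X) (n : nat) (y : X) : R :=
  if n is m.+1 then \sum_(z <- nb y | z != x) p y z * avoid x m z else 1.

Definition mean_step (f : X -> R) (y : X) : R := \sum_(z <- nb y) p y z * f z.

Definition escape_null (x : X) : Prop :=
  forall eps : R, 0 < eps -> exists n, avoid x n x <= eps.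

Record reversible_chain : Prop := ReversibleChain {
  nb_uniq : forall y, uniq (nb y);
  step_ge0 : forall y z, 0 <= p y z;
  step_supp : forall y z, z \notin nb y -> p y z = 0;
  step_sum : forall y, \sum_(z <- nb y) p y z = 1;
  weight_gt0 : forall y, 0 < w y;
  balance : forall y z, w y * p y z = w z * p z y }.

Hypothesis rc : reversible_chain.
Let nb_uniq := nb_uniq rc.
Let p_ge0 := step_ge0 rc.
Let p_supp := step_supp rc.
Let p_sum := step_sum rc.
Let w_gt0 := weight_gt0 rc.
Let p_bal := balance rc.

Lemma avoidS x n y :
  avoid x n.+1 y = \sum_(z <- nb y | z != x) p y z * avoid x n z.
Proof. by []. Qed.

Lemma avoid_ge0 x n y : 0 <= avoid x n y.
Proof.
elim: n y => [|n IHn] y //=.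
by apply: sumr_ge0 => z _; rewrite mulr_ge0.
Qed.

Lemma avoid_anti x n y : avoid x n.+1 y <= avoid x n y.
Proof.
elim: n y => [|n IHn] y.
  rewrite [leRHS]/= -[leRHS](p_sum y) /= big_mkcond; apply: ler_sum => z _.
  by case: ifP => _; rewrite ?mulr1.
rewrite [leLHS]avoidS [leRHS]avoidS; apply: ler_sum => z _.
exact: ler_wpM2l.
Qed.

Lemma avoid_le x n m y : (n <= m)%N -> avoid x m y <= avoid x n y.
Proof.
move=> /subnKC <-; elim: (m - n)%N => [|k IHk]; first by rewrite addn0.
by rewrite addnS; apply: le_trans IHk; exact: avoid_anti.
Qed.

Lemma avoid_le1 x n y : avoid x n y <= 1.
Proof. exact: (@avoid_le x 0 n y). Qed.

Definition hit (x : X) (n : nat) (y : X) : R :=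
  if y == x then 1 else 1 - avoid x n y.

(** One-step analysis. It holds at [y = x] as well, where the right side is the probability of a
    return; this produces the escape probability in the energy of [hit]. *)
Lemma mean_step_hit x n y : mean_step (hit x n) y = 1 - avoid x n.+1 y.
Proof.
rewrite /= -{1}(p_sum y) [X in X - _](bigID (fun z => z != x)) /=.
rewrite /mean_step (bigID (fun z => z != x)) /=.
rewrite [X in _ = X + _ - _](eq_bigr (fun z => p y z * (1 - avoid x n z) + p y z *
  avoid x n z)); last first.
  by move=> z _; rewrite mulrBr mulr1 subrK.
rewrite big_split /= addrAC addrK; congr (_ + _).
  by apply: eq_bigr => z /negbTE zx; rewrite /hit zx.
by apply: eq_bigr => z /negPn zx; rewrite /hit zx mulr1.
Qed.

Fixpoint hit_supp (x : X) (n : nat) : seq X :=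
  if n is m.+1 then hit_supp x m ++ flatten [seq nb z | z <- hit_supp x m]
  else [:: x].

Lemma hit_supp_self x n : x \in hit_supp x n.
Proof.
by elim: n => [|n IHn] /=; rewrite ?mem_head // mem_cat IHn.
Qed.

(** [hit_supp] spreads forward from [x], while reaching [x] is a backward notion; [balance] with
    positive weights makes [p y z] and [p z y] vanish together. *)
Lemma hit_suppP x n y : y \notin hit_supp x n -> hit x n y = 0.
Proof.
elim: n y => [|n IHn] y.
  by rewrite /= inE /hit => /negbTE ->; rewrite subrr.
move=> yn; have yx : y != x.
  by apply: contraNneq yn => ->; exact: hit_supp_self.
rewrite /hit (negbTE yx) -mean_step_hit /mean_step big1_seq // => z /andP[_ zy].
have [zn|zn] := boolP (z \in hit_supp x n); last by rewrite IHn ?mulr0.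
suff -> : p y z = 0 by rewrite mul0r.
apply: (@mulfI _ (w y)); first by rewrite gt_eqF.
rewrite p_bal mulr0 p_supp ?mulr0 //.
apply: contra yn => ynz; rewrite /= mem_cat; apply/orP; right.
by apply/flattenP; exists (nb z) => //; apply/mapP; exists z.
Qed.

Definition gen_form (V : seq X) (f g : X -> R) : R :=
  \sum_(y <- V) w y * (f y * (g y - mean_step g y)).

(** Discrete integration by parts: detailed balance makes the two halves of the double sum equal,
    and [W] contains all neighbours of the support of [f], so the relevant rows of [p] sum to 1. *)
Lemma gen_formE V W f g : uniq V -> uniq W ->
  (forall y, y \notin V -> f y = 0) -> {subset V <= W} ->
  (forall y, y \in V -> {subset nb y <= W}) ->
  \sum_(y <- W) \sum_(z <- W) w y * p y z * ((f y - f z) * (g y - g z)) =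
  2 * gen_form V f g.
Proof.
move=> uV uW fV VW nVW.
pose S := \sum_(y <- W) \sum_(z <- W) w y * p y z * (f y * (g y - g z)).
have -> : \sum_(y <- W) \sum_(z <- W) w y * p y z * ((f y - f z) * (g y - g z))
    = S + S.
  rewrite {2}/S [X in _ = _ + X]exchange_big /= /S -big_split /=; apply: eq_bigr => y _.
  rewrite -big_split /=; apply: eq_bigr => z _.
  by rewrite (p_bal z y); lra.
have -> : S + S = 2 * S by lra.
congr (_ * _); rewrite /S /gen_form.
rewrite (@sum_supp _ _ V W) //; last first.
  by move=> y yV; rewrite big1 // => z _; rewrite fV // mul0r mulr0.
rewrite !(big_seq_cond xpredT) /=; apply: eq_bigr => y /andP[yV _].
rewrite (@sum_supp _ _ (nb y) W) //; last 2 first.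
  - by move=> z zy; rewrite p_supp // mulr0 mul0r.
  - exact: nVW.
rewrite -[X in _ * (X - _)]mulr1 -(p_sum y) /mean_step mulr_sumr -sumrB !mulr_sumr.
by apply: eq_bigr => z _; lra.
Qed.

Let nbhd (V : seq X) := undup (V ++ flatten [seq nb y | y <- V]).

Let nbhd_sub V : {subset V <= nbhd V}.
Proof. by move=> y yV; rewrite mem_undup mem_cat yV. Qed.

Let nbhd_nb V y : y \in V -> {subset nb y <= nbhd V}.
Proof.
move=> yV z zy; rewrite mem_undup mem_cat; apply/orP; right.
by apply/flattenP; exists (nb y) => //; apply/mapP; exists y.
Qed.

Let c y z := w y * p y z.
Let c_ge0 y z : 0 <= c y z. Proof. by rewrite mulr_ge0// ltW. Qed.

Lemma energy_gen V W f : uniq V -> uniq W ->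
  (forall y, y \notin V -> f y = 0) -> {subset V <= W} ->
  (forall y, y \in V -> {subset nb y <= W}) ->
  energy c W f = 2 * gen_form V f f.
Proof.
by move=> uV uW fV VW nVW; rewrite -(@gen_formE V W).
Qed.

Lemma energy_subset W W' f : uniq W -> uniq W' -> {subset W <= W'} ->
  energy c W f <= energy c W' f.
Proof.
move=> uW uW' WW'.
apply: (@le_trans _ _ (\sum_(y <- W) \sum_(z <- W') c y z * (f y - f z) ^+ 2)).
  apply: ler_sum => y _; apply: ler_sum_subset => // z.
  by rewrite mulr_ge0 // sqr_ge0.
apply: ler_sum_subset => // y; apply: sumr_ge0 => z _.
by rewrite mulr_ge0 // sqr_ge0.
Qed.

(** Off [x], a mean step turns [hit x n] into the larger [hit x n.+1], so these terms are
    nonpositive and only the term at [x] remains. *)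
Lemma gen_form_hit_le x n : gen_form (undup (hit_supp x n)) (hit x n) (hit x n) <= w x
  * avoid x n.+1 x.
Proof.
rewrite /gen_form (bigD1_seq x) /= ?undup_uniq ?mem_undup ?hit_supp_self //.
have hx : hit x n x = 1 by rewrite /hit eqxx.
rewrite hx mul1r mean_step_hit opprB addrCA subrr addr0 gerDl; apply: sumr_le0 => y yx.
rewrite mulr_ge0_le0 //; first by rewrite ltW.
rewrite mean_step_hit /hit (negbTE yx) mulr_ge0_le0 //.
  by rewrite subr_ge0 avoid_le1.
by have := avoid_anti x n y; lra.
Qed.

(* The test function is the probability [hit x n] of reaching x within n steps. *)
Theorem escape_null_capacity x : escape_null x -> zero_capacity c x.
Proof.
move=> en eps eps0.
have [|n un] := en (eps / (2 * w x)); first by rewrite divr_gt0 // mulr_gt0.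
exists (hit x n), (undup (hit_supp x n)); split.
- by move=> y; rewrite mem_undup; exact: hit_suppP.
- by rewrite /hit eqxx.
move=> W uW; set V := undup (hit_supp x n).
have V0 y : y \notin V -> hit x n y = 0 by rewrite mem_undup; exact: hit_suppP.
pose W' := undup (W ++ nbhd V).
have WW' : {subset nbhd V <= W'}.
  by move=> y yV; rewrite mem_undup mem_cat yV orbT.
apply: (@le_trans _ _ (energy c W' (hit x n))).
  apply: energy_subset; rewrite ?undup_uniq //.
  by move=> y yW; rewrite mem_undup mem_cat yW.
rewrite (@energy_gen V) ?undup_uniq //; last 2 first.
- by move=> y /nbhd_sub/WW'.
- by move=> y /nbhd_nb yV z /yV/WW'.
have := gen_form_hit_le x n; have := avoid_anti x n x; move: un.
rewrite ler_pdivlMr ?mulr_gt0 // => un un1 gf.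
apply: (@le_trans _ _ (2 * (w x * avoid x n.+1 x))).
  by rewrite ler_pM2l.
by apply: le_trans un; rewrite mulrA mulrC ler_pM2r // mulr_gt0.
Qed.

Lemma avoid_diff_small x y (eps : R) : 0 < eps ->
  \forall n \near \oo, avoid x n y - avoid x n.+1 y <= eps.
Proof.
move=> eps0.
have nu : nonincreasing_seq (fun n => avoid x n y).
  by apply/nonincreasing_seqP => n; exact: avoid_anti.
have lb : has_lbound (range (fun n => avoid x n y)).
  by exists 0 => _ [n _ <-]; exact: avoid_ge0.
have cv := nonincreasing_is_cvgn nu lb.
have cvS : (fun n => avoid x n.+1 y) @ \oo --> limn (fun n => avoid x n y).
  by rewrite -(cvg_shiftS (fun n => avoid x n y)) in cv *.
have : (fun n => avoid x n y - avoid x n.+1 y) @ \oo --> (0 : R).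
  by rewrite -[X in _ --> X](subrr (limn (fun n => avoid x n y))); exact: cvgB.
move=> /cvgrPdist_le /(_ _ eps0); apply: filterS => n.
by rewrite sub0r normrN => /(le_trans (ler_norm _)).
Qed.

Theorem capacity_escape_null x : zero_capacity c x -> escape_null x.
Proof.
move=> zc eps eps0; apply: contrapT => /forallNP uge.
have {}uge n : eps <= avoid x n x.
  by have /negP := uge n; rewrite -ltNge => /ltW.
(* With this energy bound and an error [e n] of at most [d / 4], the inequality [bound] below would
   give [w x * eps <= d], half of itself. *)
pose d := w x * eps / 2.
have d0 : 0 < d by rewrite divr_gt0 // mulr_gt0.
have [f [V0 [f0 fx fW]]] := zc d d0.
pose V := undup (x :: V0).
have uV : uniq V by rewrite undup_uniq.
have xV : x \in V by rewrite mem_undup mem_head.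
have fV y : y \notin V -> f y = 0.
  by rewrite mem_undup inE negb_or => /andP[_ /f0].
pose e n := \sum_(y <- V | y != x) w y * (f y * (avoid x n y - avoid x n.+1 y)).
(* Expand 0 <= energy (f - hit x n), where the mixed term tends to w x times the
   escape probability since f has finite support. *)
have bound n : w x * eps <= d / 2 + 2 * e n.
  pose h := hit x n; pose U := undup (hit_supp x n).
  have hU y : y \notin U -> h y = 0 by rewrite mem_undup; exact: hit_suppP.
  pose W := undup (nbhd V ++ nbhd U).
  have uW : uniq W by rewrite undup_uniq.
  have VW : {subset nbhd V <= W}.
    by move=> y yV; rewrite mem_undup mem_cat yV.
  have UW : {subset nbhd U <= W}.
    by move=> y yV; rewrite mem_undup mem_cat yV orbT.
  have Ef : energy c W f <= d by exact: fW.
  have Eh : energy c W h = 2 * gen_form U h h.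
    apply: energy_gen; rewrite ?undup_uniq //.
      by move=> y /nbhd_sub/UW.
    by move=> y /nbhd_nb yV z /yV/UW.
  have Efh : \sum_(y <- W) \sum_(z <- W) c y z * ((f y - f z) * (h y - h z))
      = 2 * gen_form V f h.
    apply: gen_formE => //.
      by move=> y /nbhd_sub/VW.
    by move=> y /nbhd_nb yV z /yV/VW.
  have pos : 0 <= energy c W f - 2 * (2 * gen_form V f h) + energy c W h.
    rewrite -Efh mulr_sumr /energy -sumrB -big_split /=; apply: sumr_ge0 => y _.
    rewrite mulr_sumr -sumrB -big_split /=; apply: sumr_ge0 => z _.
    have -> : c y z * (f y - f z) ^+ 2 - 2 * (c y z * ((f y - f z) * (h y - h z)))
      + c y z * (h y - h z) ^+ 2 = c y z * ((f y - f z) - (h y - h z)) ^+ 2 by lra.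
    by rewrite mulr_ge0 // sqr_ge0.
  have gfh : gen_form V f h = w x * avoid x n.+1 x - e n.
    rewrite /gen_form (bigD1_seq x) //= fx mul1r mean_step_hit /h.
    have -> : hit x n x = 1 by rewrite /hit eqxx.
    rewrite opprB addrCA subrr addr0; congr (_ + _).
    rewrite /e -sumrN; apply: eq_bigr => y yx.
    by rewrite mean_step_hit /hit (negbTE yx); lra.
  have gh := gen_form_hit_le x n.
  have : w x * eps <= w x * avoid x n.+1 x by rewrite ler_pM2l.
  rewrite Eh gfh in pos; move: pos gh Ef.
  rewrite -/h -/U; move: (w x * avoid _ _ _) (w x * eps) (gen_form U h h) (energy c W f) (e n).
  move=> a b g k l; lra.
have : \forall n \near \oo, e n <= d / 4.
  pose C := \sum_(y <- V | y != x) w y * `|f y|.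
  have C0 : 0 <= C.
    by apply: sumr_ge0 => y _; rewrite mulr_ge0 // ltW.
  pose k := d / 4 / (C + 1).
  have C1 : 0 < C + 1 by rewrite ltr_wpDl.
  have k0 : 0 < k by apply: divr_gt0 => //; exact: divr_gt0.
  have : \forall n \near \oo, all (fun y => avoid x n y - avoid x n.+1 y <= k) V.
    elim: (V) => [|y V' IH] /=; first by near=> n.
    near=> n; apply/andP; split; first by near: n; exact: avoid_diff_small.
    by near: n.
  apply: filterS => n /allP ak.
  apply: (@le_trans _ _ (C * k)).
    rewrite /e /C mulr_suml big_seq_cond [leRHS]big_seq_cond; apply: ler_sum => y /andP[yV _].
    rewrite -mulrA; apply: ler_wpM2l; first by rewrite ltW.
    apply: (@le_trans _ _ (`|f y| * (avoid x n y - avoid x n.+1 y))).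
      by apply: ler_wpM2r; [rewrite subr_ge0 avoid_anti|exact: ler_norm].
    by apply: ler_wpM2l => //; exact: ak.
  rewrite /k mulrCA ler_piMr //; first by rewrite ltW // divr_gt0.
  by rewrite ler_pdivrMr // mul1r lerDl.
move=> [n _ /(_ n (leqnn n))] en.
by have := bound n; rewrite /d in en *; have := mulr_gt0 (w_gt0 x) eps0; lra.
Unshelve. all: by end_near.
Qed.

End chain.

(** * Energy comparison for finite-range kernels *)

Section comparison.
Variables (R : realType) (X : choiceType) (E : rel X) (nb : X -> seq X) (D : nat).
Hypotheses (nb_uniq : forall y, uniq (nb y)) (nbE : forall y z, (z \in nb y) = E y z).
Hypotheses (E_sym : symmetric E) (nb_size : forall y, (size (nb y) <= D)%N).

(** Endpoints are listed with multiplicity; allowing [y] itself at each step absorbs the walks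
    shorter than [r]. *)
Fixpoint walk_ends (r : nat) (y : X) : seq X :=
  if r is r'.+1 then flatten [seq walk_ends r' v | v <- y :: nb y] else [:: y].

Let adj y z : R := (E y z)%:R.

Lemma size_walk_ends r y : (size (walk_ends r y) <= D.+1 ^ r)%N.
Proof.
elim: r y => [|r IHr] y //=.
rewrite size_cat size_flatten /shape -map_comp expnS mulSn leq_add //.
apply: (@leq_trans (size (nb y) * D.+1 ^ r)); last by rewrite leq_mul2r nb_size orbT.
by elim: (nb y) => [|z s IHs] //=; rewrite mulSn leq_add.
Qed.

Lemma path_walk_ends r y s : path E y s -> (size s <= r)%N ->
  last y s \in walk_ends r y.
Proof.
elim: r y s => [|r IHr] y [|z s] //=.
- by rewrite inE.
- by move=> _ _; rewrite mem_cat (IHr y [::]).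
move=> /andP[yz zs] sr; rewrite mem_cat; apply/orP; right.
apply/flattenP; exists (walk_ends r z); last exact: IHr.
by apply/mapP; exists z; rewrite // nbE.
Qed.

Let sum_seq_cst (s : seq X) (a : R) : \sum_(i <- s) a = (size s)%:R * a.
Proof.
elim: s => [|z s IHs]; first by rewrite big_nil mul0r.
by rewrite big_cons IHs /= -natr1 mulrDl mul1r addrC.
Qed.

Let var_sum r (W : seq X) (f : X -> R) :=
  \sum_(y <- W) \sum_(z <- walk_ends r y) (f y - f z) ^+ 2.

Let sq_ge0 (f : X -> R) y z : 0 <= (f y - f z) ^+ 2.
Proof. exact: sqr_ge0. Qed.

Let adj_energy_ge0 (f : X -> R) y z : 0 <= adj y z * (f y - f z) ^+ 2.
Proof. by rewrite mulr_ge0 // ler0n. Qed.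

Let adj_energy_sub (W W' : seq X) f : uniq W -> uniq W' -> {subset W <= W'} ->
  energy adj W f <= energy adj W' f.
Proof.
move=> uW uW' WW'.
apply: (@le_trans _ _ (\sum_(y <- W) \sum_(z <- W') adj y z * (f y - f z) ^+ 2)).
  by apply: ler_sum => y _; exact: ler_sum_subset.
by apply: ler_sum_subset => // y; apply: sumr_ge0.
Qed.

(** Induction on the length, splitting off the first step: [(f y - f z)^2 <= 2 (f y - f v)^2 + 2 (f
    v - f z)^2]. The window grows with [r], but [C] depends neither on the window nor on [f]. *)
Let var_sum_energy r : exists2 C : R, 0 <= C & forall W, uniq W ->
  exists2 W', uniq W' & forall f, var_sum r W f <= C * energy adj W' f.
Proof.
elim: r => [|r [C C0 IHr]].
  exists 0 => // W uW; exists W => // f.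
  by rewrite mul0r /var_sum big1 // => y _; rewrite big_seq1 subrr expr0n.
pose M : R := (D.+1 ^ r)%:R.
have M0 : 0 <= M by rewrite ler0n.
(* The first edge is repeated at most [M] times, once per continuation; a continuation from [v] is
   reached from [v] itself and from at most [D] neighbours. *)
exists (2 * M + 2 * (D.+1)%:R * C); first by rewrite addr_ge0 // !mulr_ge0.
move=> W uW.
pose W1 := undup (W ++ flatten [seq nb y | y <- W]).
have uW1 : uniq W1 by rewrite undup_uniq.
have WW1 : {subset W <= W1} by move=> y yW; rewrite mem_undup mem_cat yW.
have nW1 y : y \in W -> {subset nb y <= W1}.
  move=> yW z zy; rewrite mem_undup mem_cat; apply/orP; right.
  by apply/flattenP; exists (nb y) => //; apply/mapP; exists y.
have [W2 uW2 IH] := IHr W1 uW1.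
pose W' := undup (W1 ++ W2).
exists W'; first exact: undup_uniq.
move=> f.
have e1 : energy adj W1 f <= energy adj W' f.
  by apply: adj_energy_sub; rewrite ?undup_uniq // => y yW; rewrite mem_undup mem_cat yW.
have e2 : energy adj W2 f <= energy adj W' f.
  by apply: adj_energy_sub; rewrite ?undup_uniq // => y yW; rewrite mem_undup mem_cat yW orbT.
pose G v := \sum_(z <- walk_ends r v) (f v - f z) ^+ 2.
have G0 v : 0 <= G v by apply: sumr_ge0.
have step y v : \sum_(z <- walk_ends r v) (f y - f z) ^+ 2 <=
    2 * M * (f y - f v) ^+ 2 + 2 * G v.
  apply: (@le_trans _ _ (\sum_(z <- walk_ends r v) (2 * (f y - f v) ^+ 2 + 2 * (f v - f z) ^+ 2))).
    by apply: ler_sum => z _; have := sqr_ge0 ((f y - f v) - (f v - f z)); lra.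
  rewrite big_split /= -[X in _ + X <= _]mulr_sumr lerD2r sum_seq_cst mulrCA -[leRHS]mulrA.
  apply: ler_wpM2l => //; apply: ler_wpM2r => //.
  by rewrite ler_nat size_walk_ends.
have sumE y (F : X -> R) : y \in W ->
    \sum_(v <- nb y) F v = \sum_(v <- W1) adj y v * F v.
  move=> yW; rewrite (@sum_supp _ _ (nb y) W1) //; last exact: nW1.
    by rewrite !big_seq; apply: eq_bigr => v; rewrite nbE /adj => ->; rewrite mul1r.
  by move=> v; rewrite nbE /adj => /negbTE ->; rewrite mul0r.
have -> : var_sum r.+1 W f = \sum_(y <- W) \sum_(v <- y :: nb y)
    \sum_(z <- walk_ends r v) (f y - f z) ^+ 2.
  apply: eq_bigr => y _; rewrite [walk_ends _ _]/=.
  by rewrite -[_ ++ _]/(flatten [seq walk_ends r v | v <- y :: nb y]) big_flatten big_map.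
apply: (@le_trans _ _ (\sum_(y <- W) \sum_(v <- y :: nb y)
    (2 * M * (f y - f v) ^+ 2 + 2 * G v))).
  by apply: ler_sum => y _; apply: ler_sum => v _.
have -> : \sum_(y <- W) \sum_(v <- y :: nb y) (2 * M * (f y - f v) ^+ 2 + 2 * G v)
  = 2 * M * (\sum_(y <- W) \sum_(v <- W1) adj y v * (f y - f v) ^+ 2)
    + 2 * (\sum_(y <- W) G y + \sum_(y <- W) \sum_(v <- W1) adj y v * G v).
  rewrite -big_split /= !mulr_sumr -big_split /= big_seq [RHS]big_seq.
  apply: eq_bigr => y yW; rewrite big_cons subrr expr0n /= mulr0 add0r.
  rewrite big_split /= -!mulr_sumr !sumE //; lra.
have s1 : \sum_(y <- W) \sum_(v <- W1) adj y v * (f y - f v) ^+ 2 <= energy adj W1 f.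
  by apply: ler_sum_subset => // y; apply: sumr_ge0.
have s2 : \sum_(y <- W) G y <= \sum_(y <- W1) G y by exact: ler_sum_subset.
have s3 : \sum_(y <- W) \sum_(v <- W1) adj y v * G v <= D%:R * \sum_(v <- W1) G v.
  rewrite exchange_big /= mulr_sumr; apply: ler_sum => v _.
  rewrite -mulr_suml; apply: ler_wpM2r => //.
  apply: (@le_trans _ _ (size (nb v))%:R); last by rewrite ler_nat.
  rewrite /adj -natr_sum ler_nat.
  have -> : (\sum_(i <- W) E i v = count (E ^~ v) W)%N.
    by elim: (W) => [|a s IHs]; rewrite ?big_nil ?big_cons //= IHs.
  rewrite -size_filter; apply: uniq_leq_size; first exact: filter_uniq.
  by move=> z; rewrite mem_filter nbE E_sym => /andP[].
have s4 : \sum_(v <- W1) G v <= C * energy adj W2 f by exact: IH.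
have Ce2 : C * energy adj W2 f <= C * energy adj W' f by apply: ler_wpM2l.
have DN : (D.+1)%:R = D%:R + 1 :> R by rewrite -natr1.
have DC : D%:R * \sum_(v <- W1) G v <= D%:R * (C * energy adj W' f).
  by apply: ler_wpM2l => //; exact: le_trans Ce2.
have Me : M * \sum_(y <- W) \sum_(v <- W1) adj y v * (f y - f v) ^+ 2 <= M * energy adj W' f.
  by apply: ler_wpM2l => //; exact: le_trans e1.
rewrite DN; lra.
Qed.

Lemma zero_capacity_range (r : nat) (c : X -> X -> R) x :
  (forall y z, 0 <= c y z <= 1) -> (forall y z, z \notin walk_ends r y -> c y z = 0) ->
  zero_capacity adj x -> zero_capacity c x.
Proof.
move=> c01 cr zc eps eps0.
have [C C0 HC] := var_sum_energy r.
have C1 : 0 < C + 1 by rewrite ltr_wpDl.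
have [f [V [fV fx fW]]] := zc (eps / (C + 1)) (divr_gt0 eps0 C1).
exists f, V; split=> // W uW.
have [W' uW' HW'] := HC W uW.
have := fW W' uW'; rewrite ler_pdivlMr // => /(le_trans _); apply.
apply: (@le_trans _ _ (var_sum r W f)); last first.
  apply: (le_trans (HW' f)); rewrite mulrC ler_wpM2l //; last by rewrite lerDl.
  by apply: sumr_ge0 => y _; apply: sumr_ge0.
apply: ler_sum => y _.
apply: (@le_trans _ _ (\sum_(z <- W | z \in walk_ends r y) (f y - f z) ^+ 2)).
  rewrite [leRHS]big_mkcond; apply: ler_sum => z _; case: ifPn => zr.
    by have /andP[c0 c1] := c01 y z; rewrite ler_piMl.
  by rewrite cr // mul0r.
rewrite -big_filter.
apply: (@le_trans _ _ (\sum_(z <- undup (walk_ends r y)) (f y - f z) ^+ 2)).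
  apply: ler_sum_subset; rewrite ?filter_uniq ?undup_uniq //.
  by move=> z; rewrite mem_filter mem_undup => /andP[].
elim: (walk_ends r y) => [|z s IHs] //=; case: ifP => zs; rewrite !big_cons.
  by rewrite (le_trans IHs) // lerDr.
by rewrite lerD2l.
Qed.

End comparison.

(** * Hitting probabilities *)

Section real_probability.
Context d (Omega : measurableType d) (R : realType) (P : probability Omega R).
Implicit Types A B : set Omega.

Definition pr A : R := fine (P A).

Lemma prE A : measurable A -> (pr A)%:E = P A.
Proof. by move=> mA; rewrite /pr fineK // fin_num_measure. Qed.

Lemma pr_ge0 A : 0 <= pr A.
Proof. by rewrite /pr fine_ge0. Qed.

Lemma pr_le A B : measurable A -> measurable B -> A `<=` B -> pr A <= pr B.
Proof.
by move=> mA mB AB; rewrite -lee_fin !prE // le_measure // inE.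
Qed.

Lemma pr_le1 A : measurable A -> pr A <= 1.
Proof. by move=> mA; rewrite -lee_fin prE // probability_le1. Qed.

Lemma prT : pr setT = 1.
Proof. by rewrite /pr probability_setT. Qed.

Lemma pr0 : pr set0 = 0.
Proof. by rewrite /pr measure0. Qed.

Lemma prU A B : measurable A -> measurable B -> A `&` B = set0 ->
  pr (A `|` B) = pr A + pr B.
Proof.
move=> mA mB AB; apply: EFin_inj; rewrite EFinD !prE ?measureU //.
exact: measurableU.
Qed.

Lemma prC A : measurable A -> pr (~` A) = 1 - pr A.
Proof.
move=> mA; apply/eqP; rewrite eq_sym subr_eq -prT -(setvU A) prU ?setICl //.
exact: measurableC.
Qed.

Lemma pr_split A B : measurable A -> measurable B ->
  pr A = pr (A `&` B) + pr (A `&` ~` B).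
Proof.
move=> mA mB; rewrite -prU; first by rewrite -setIUr setUv setIT.
- exact: measurableI.
- by apply: measurableI => //; exact: measurableC.
- by rewrite setIACA setICr setI0.
Qed.

Lemma measurable_notin (T : eqType) (Y : Omega -> T) (s : seq T) :
  (forall z, measurable (Y @^-1` [set z])) ->
  measurable [set w | Y w \notin s].
Proof.
move=> mY; elim: s => [|z s IHs].
  by rewrite (_ : [set _ | _] = setT) //; apply/seteqP; split.
rewrite (_ : [set _ | _] = ~` (Y @^-1` [set z]) `&` [set w | Y w \notin s]).
  by apply: measurableI => //; exact: measurableC.
apply/seteqP; split=> w /=; rewrite inE negb_or => /=.
  by move=> /andP[/eqP].
by move=> [/eqP -> ->].
Qed.

Lemma pr_partition (T : eqType) (Y : Omega -> T) (s : seq T) A :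
  uniq s -> measurable A -> (forall z, measurable (Y @^-1` [set z])) ->
  pr A = \sum_(z <- s) pr (A `&` Y @^-1` [set z]) + pr (A `&` [set w | Y w \notin s]).
Proof.
move=> us mA mY; elim: s us => [_|z s IHs /= /andP[zs us]].
  rewrite big_nil add0r; congr pr; apply/seteqP; split=> w //.
  by case.
rewrite (IHs us) big_cons addrC [RHS]addrAC; congr (_ + _).
have mA' : measurable (A `&` [set w | Y w \notin s]).
  by apply: measurableI => //; exact: measurable_notin.
rewrite (pr_split mA' (mY z)); congr (pr _ + pr _).
  apply/seteqP; split=> w [].
    by move=> [Aw _] /= ->.
  by move=> Aw /= Yw; split=> //; split=> //=; rewrite Yw.
apply/seteqP; split=> w /=; rewrite inE negb_or.
  by move=> [[Aw ->] /eqP ->].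
by move=> [Aw /andP[/eqP ? ->]].
Qed.

End real_probability.

(** * Avoidance probabilities from the laws of finite trajectories *)

Section markov_avoid.
Context d (Omega : measurableType d) (R : realType) (P : probability Omega R).
Variables (X : choiceType) (nb : X -> seq X) (p : X -> X -> R) (Y : nat -> Omega -> X).
Hypotheses (nb_uniq : forall y, uniq (nb y)).
Hypotheses (p_sum : forall y, \sum_(z <- nb y) p y z = 1).
Hypotheses (mY : forall k y, measurable (Y k @^-1` [set y])).

Let cyl k (y : nat -> X) := \bigcap_(i in `I_k.+1) (Y i @^-1` [set y i]).

Definition avoids (x : X) (k m : nat) : set Omega :=
  [set w | forall i, (k < i <= k + m)%N -> Y i w <> x].

Let mcyl k y : measurable (cyl k y).
Proof. by apply: bigcap_measurableType => // i _; exact: mY. Qed.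

Lemma measurable_avoids x k m : measurable (avoids x k m).
Proof.
rewrite (_ : avoids x k m = \bigcap_(i in [set i | (k < i <= k + m)%N]) ~` (Y i @^-1` [set x])).
  apply: bigcap_measurableType => // i _; apply: measurableC; exact: mY.
by [].
Qed.

Variables (x : X) (n : nat).
(** Only the first n steps are prescribed, since the inverted walk read from time n is a Markov
    chain for n steps only. *)
Hypothesis law : forall k y, (k <= n)%N ->
  P (cyl k y) = ((y 0%N == x)%:R * \prod_(i < k) p (y i) (y i.+1))%:E.

Let law' k y : (k <= n)%N ->
  pr P (cyl k y) = (y 0%N == x)%:R * \prod_(i < k) p (y i) (y i.+1).
Proof. by move=> kn; rewrite /pr law. Qed.

Let ext (y : nat -> X) k z : nat -> X := fun i => if i == k.+1 then z else y i.

Let cyl_ext k y z : cyl k.+1 (ext y k z) = cyl k y `&` Y k.+1 @^-1` [set z].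
Proof.
apply/seteqP; split=> w.
  move=> H; split=> [i /= ik|].
    have := H i (leqW ik); rewrite /ext /= ltn_eqF //.
  by have := H k.+1 (leqnn _); rewrite /ext /= eqxx.
move=> [H1 H2] i /=; rewrite ltnS leq_eqVlt /ext => /orP[/eqP ->|ik].
  by rewrite eqxx.
by rewrite ltn_eqF //; exact: H1.
Qed.

Let law_ext k y z : (k < n)%N -> pr P (cyl k.+1 (ext y k z)) = pr P (cyl k y) * p (y k) z.
Proof.
move=> kn; rewrite !law' //; last exact: ltnW.
rewrite big_ord_recr /= mulrA; congr (_ * _ * _).
  by apply: eq_bigr => i _; rewrite /ext !ltn_eqF // ltnS // ltnW.
by rewrite /ext eqxx ltn_eqF.
Qed.

Let avoid_cyl m k y : (k + m <= n)%N ->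
  pr P (cyl k y `&` avoids x k m) = pr P (cyl k y) * avoid nb p x m (y k).
Proof.
elim: m k y => [|m IHm] k y kmn.
  rewrite mulr1; congr pr; apply/seteqP; split=> w; first by case.
  by move=> cw; split=> // i; rewrite addn0 => /andP[ki]; rewrite leqNgt ki.
have kn : (k < n)%N by apply: leq_trans kmn; rewrite addnS ltnS leq_addr.
have mA : measurable (cyl k y `&` avoids x k m.+1).
  by apply: measurableI => //; exact: measurable_avoids.
have split_avoids : avoids x k m.+1 = ~` (Y k.+1 @^-1` [set x]) `&` avoids x k.+1 m.
  apply/seteqP; split=> w.
    move=> H; split; first by apply: H; rewrite ltnSn /= addnS ltnS leq_addr.
    move=> i; rewrite addSnnS => /andP[/ltnW ki ikm]; by apply: H; rewrite ki.
  move=> [H1 H2] i /andP[]; rewrite leq_eqVlt => /orP[/eqP <- _ //|ki ikm].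
  by apply: H2; rewrite ki addSnnS.
rewrite (pr_partition P (nb_uniq (y k)) mA (mY k.+1)).
(* The extensions to points of [nb (y k)] already exhaust the mass of the cylinder, because the row
   of [p] sums to 1. *)
have rest0 : pr P (cyl k y `&` [set w | Y k.+1 w \notin nb (y k)]) = 0.
  have := pr_partition P (nb_uniq (y k)) (mcyl k y) (mY k.+1).
  under eq_bigr do rewrite -cyl_ext law_ext //.
  by rewrite -mulr_sumr p_sum mulr1 => /eqP; rewrite addrC -subr_eq subrr eq_sym => /eqP.
rewrite [X in _ + X](_ : _ = 0) ?addr0; last first.
  apply/eqP; rewrite eq_le pr_ge0 andbT -rest0; apply: pr_le.
  - by apply: measurableI => //; exact: measurable_notin.
  - by apply: measurableI => //; exact: measurable_notin.
  - by move=> w [[]].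
rewrite avoidS mulr_sumr [RHS]big_mkcond; apply: eq_bigr => z _; case: ifPn => zx.
  rewrite mulrA -law_ext // -[X in avoid _ _ _ _ X](_ : ext y k z k.+1 = z); last first.
    by rewrite /ext eqxx.
  rewrite -IHm ?addSnnS // cyl_ext; congr pr; rewrite split_avoids.
  apply/seteqP; split=> w.
    by move=> [[? [? ?]] ?]; split.
  move=> [[? /= Yz] ?]; split=> //; split=> //; split=> //=.
  by rewrite Yz; exact/eqP.
rewrite (_ : _ `&` _ = set0) ?pr0 //; apply/seteqP; split=> w //.
rewrite split_avoids; move/negPn/eqP : zx => ->.
by move=> [[_ [/= H _]]] /H.
Qed.

Lemma pr_avoids : pr P (avoids x 0 n) = avoid nb p x n x.
Proof.
have c0 : pr P (cyl 0 (fun=> x)) = 1 by rewrite law' // big_ord0 eqxx mulr1.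
have := @avoid_cyl n 0 (fun=> x) (leqnn n); rewrite c0 mul1r => <-.
rewrite (pr_split P (measurable_avoids x 0 n) (mcyl 0 (fun=> x))).
rewrite setIC [X in _ + X](_ : _ = 0) ?addr0 //.
apply/eqP; rewrite eq_le pr_ge0 andbT.
apply: (@le_trans _ _ (pr P (~` cyl 0 (fun=> x)))).
  apply: pr_le; [apply: measurableI|exact: measurableC|by move=> w []].
    exact: measurable_avoids.
  exact: measurableC.
by rewrite prC // c0 subrr.
Qed.

End markov_avoid.

(** * Existence of uniform chains *)

Section digit_chain.
Context (R : realType) (Y : choiceType) (nb : Y -> seq Y).
Hypotheses (nb_uniq : forall y, uniq (nb y)) (nb_gt0 : forall y, (0 < size (nb y))%N).

(* The successive digits of u in the variable base [size (nb y)] choose the steps. *)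
Fixpoint digit_state (y : Y) (u : R) (n : nat) : Y :=
  if n is m.+1 then
    let c := (size (nb y))%:R * u in
    digit_state (nth y (nb y) (Num.truncn c)) (c - (Num.truncn c)%:R) m
  else y.

(** Prescribing the first n steps confines [u] to a half-open interval whose length is the
    probability of the trajectory: each step picks one of [size (nb (y i))] equal subintervals and
    rescales it to the unit interval. *)
Lemma digit_state_itv n (y : nat -> Y) :
  (forall i, (i < n)%N -> y i.+1 \in nb (y i)) ->
  exists a : R, [/\ 0 <= a, a + \prod_(i < n) (size (nb (y i)))%:R^-1 <= 1 &
    forall u, 0 <= u < 1 ->
      (forall i, (i <= n)%N -> digit_state (y 0%N) u i = y i) <->
      a <= u < a + \prod_(i < n) (size (nb (y i)))%:R^-1].
Proof.
elim: n y => [|n IHn] y ynb.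
  exists 0; rewrite big_ord0 add0r; split=> // u u01; split=> // _ i.
  by rewrite leqn0 => /eqP ->.
have [|a [a0 a1 aP]] := IHn (fun i => y i.+1).
  by move=> i ni; exact: (ynb i.+1).
set W := \prod_(i < n) _ in a1 aP.
have W0 : 0 <= W by apply: prodr_ge0 => i _; rewrite invr_ge0 ler0n.
set N := size (nb (y 0%N)).
have N0 : 0 < N%:R :> R by rewrite ltr0n nb_gt0.
set j := index (y 1%N) (nb (y 0%N)).
have jN : (j < N)%N by rewrite index_mem; exact: (ynb 0%N).
have jN1 : (j%:R + 1 <= N%:R :> R) by rewrite natr1 ler_nat.
(* Left end of the interval for the shifted trajectory, carried back into the subinterval number
   [j]. *)
exists ((j%:R + a) / N%:R); rewrite big_ord_recl /= -/N.
under eq_bigr do rewrite /bump /= add1n.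
rewrite -/W [N%:R^-1 * W]mulrC -mulrDl; split.
- by rewrite divr_ge0 // addr_ge0.
- by rewrite ler_pdivrMr // mul1r; apply: le_trans jN1; lra.
move=> u /andP[u0 u1].
have c0 : 0 <= N%:R * u by rewrite mulr_ge0 // ltW.
have cN : N%:R * u < N%:R by rewrite gtr_pMr.
have /andP[t0 t1] := truncn_itv c0.
set t := Num.truncn (N%:R * u) in t0 t1.
have tN : (t < N)%N by rewrite -(@ltr_nat R); exact: le_lt_trans cN.
have v01 : 0 <= N%:R * u - t%:R < 1.
  by rewrite subr_ge0 t0 /= ltrBlDl natr1.
rewrite ler_pdivrMr // ltr_pdivlMr // [u * _]mulrC.
split=> [H|/andP[l1 l2]].
  have tj : t = j.
    rewrite /j -(H 1%N) //= -/N -/t index_uniq //.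
  have /(aP _ v01) : forall i, (i <= n)%N -> digit_state (y 1%N) (N%:R * u - t%:R) i = y i.+1.
    by move=> i ni; rewrite -(H i.+1) //= -/N -/t tj nth_index //; exact: (ynb 0%N).
  by rewrite -tj; move=> /andP[]; lra.
have tj : t = j.
  by apply: truncn_def; rewrite -natr1; apply/andP; split; lra.
have /(aP _ v01) H : a <= N%:R * u - t%:R < a + W by rewrite tj; apply/andP; split; lra.
move=> [|i] //; rewrite ltnS => ni /=; rewrite -/N -/t -(H i) //.
by rewrite {1}tj nth_index //; exact: (ynb 0%N).
Qed.

Let P : probability (measurableTypeR R) R := uniform_prob (@ltr01 R).

Let P_itv (a b : R) : 0 <= a -> a <= b -> b <= 1 -> P `[a, b[%classic = (b - a)%:E.
Proof.
move=> a0 ab b1; rewrite /P /= /uniform_prob.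
rewrite (eq_integral (fun=> 1%E)) => [|u].
  rewrite integral_cst //= mul1e lebesgue_measure_itv /= lte_fin.
  case: ltgtP ab => // -> _; first by rewrite subrr.
rewrite inE /= in_itv /= => /andP[au ub].
by rewrite /uniform_pdf (le_trans a0 au) (le_trans (ltW ub) b1) subr0 invr1.
Qed.

Let unit_itv : set (measurableTypeR R) := `[0, 1[%classic.

Let munit : measurable unit_itv.
Proof. exact: measurable_itv. Qed.

Let P_unitC : P (~` unit_itv) = 0%E.
Proof. by rewrite probability_setC // P_itv // subr0 subee. Qed.

Let P_unit A : measurable A -> P A = P (A `&` unit_itv).
Proof.
move=> mA; rewrite -[A in LHS](setIT) -(setUv unit_itv) setIUr measureU.
- rewrite [X in (_ + X)%E](_ : _ = 0%E) ?adde0 //.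
  apply/eqP; rewrite eq_le measure_ge0 andbT -P_unitC le_measure // inE.
  + by apply: measurableI => //; exact: measurableC.
  + exact: measurableC.
- exact: measurableI.
- by apply: measurableI => //; exact: measurableC.
- by rewrite setIACA setICr setI0.
Qed.

(** The sample space is the whole real line; the constant value off the unit interval concerns a
    null set. *)
Let chain (y0 : Y) (n : nat) (u : measurableTypeR R) : Y :=
  if 0 <= u < 1 then digit_state y0 u n else y0.

Let measurable_digit_state n y0 y :
  measurable [set u : measurableTypeR R | unit_itv u /\ digit_state y0 u n = y].
Proof.
elim: n y0 => [|n IHn] y0.
  have [->|yy] := eqVneq y0 y.
    by rewrite (_ : [set u | _] = unit_itv) //; apply/seteqP; split=> [u []|].
  rewrite (_ : [set u | _] = set0) //; apply/seteqP; split=> u // [_ /=].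
  by move=> /eqP; rewrite (negbTE yy).
pose N := size (nb y0).
rewrite (_ : [set u | _] = unit_itv `&` \bigcup_(j in [set: nat])
   ((fun u : measurableTypeR R => N%:R * u - j%:R) @^-1`
     [set u | unit_itv u /\ digit_state (nth y0 (nb y0) j) u n = y])).
  apply: measurableI => //; apply: bigcup_measurable => j _.
  rewrite -[X in measurable X]setTI.
  have : measurable_fun setT (fun u : measurableTypeR R => N%:R * u - j%:R).
    by apply: measurable_funB => //; exact: measurable_funM.
  by apply => //; exact: IHn.
have c0 u : unit_itv u -> 0 <= N%:R * u.
  by rewrite /unit_itv /= in_itv /= => /andP[u0 _]; rewrite mulr_ge0.
apply/seteqP; split=> u /=.
  move=> [uI du]; split=> //; exists (Num.truncn (N%:R * u)) => //; split=> //.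
  have /andP[t0 t1] := truncn_itv (c0 u uI).
  by rewrite /unit_itv /= in_itv /= subr_ge0 t0 /= ltrBlDl natr1.
move=> [uI [j _ [jI jd]]]; split=> //; rewrite -/N.
suff -> : Num.truncn (N%:R * u) = j by [].
move: jI; rewrite /unit_itv /= in_itv /= => /andP[j0 j1].
by apply: truncn_def; rewrite -natr1; apply/andP; split; lra.
Qed.

Let measurable_chain y0 n y : measurable (chain y0 n @^-1` [set y]).
Proof.
rewrite (_ : _ @^-1` _ = [set u | unit_itv u /\ digit_state y0 u n = y] `|`
   (if y0 == y then ~` unit_itv else set0)).
  apply: measurableU; first exact: (measurable_digit_state n y0 y).
  by case: ifP => // _; exact: measurableC.
have uE u : unit_itv u = (0 <= u < 1) by rewrite /unit_itv /= in_itv.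
apply/seteqP; split=> u /=; rewrite /chain.
  case: ifPn => uI; first by move=> <-; left; split=> //; rewrite uE.
  by move=> ->; rewrite eqxx; right; rewrite /= uE; exact/negP.
case=> [[]|]; first by rewrite uE => ->.
by case: eqP => // <-; rewrite /= uE => /negP/negbTE ->.
Qed.

Theorem uniform_chain_exists (y0 : Y) :
  exists (d : measure_display) (Omega : measurableType d) (P : probability Omega R)
    (S : nat -> Omega -> Y),
    (forall n y, measurable (S n @^-1` [set y])) /\
    (forall n (y : nat -> Y), P (\bigcap_(i in `I_n.+1) (S i @^-1` [set y i])) =
      ((y 0%N == y0)%:R *
        \prod_(i < n) ((y i.+1 \in nb (y i))%:R / (size (nb (y i)))%:R))%:E).
Proof.
exists _, (measurableTypeR R), P, (chain y0); split; first exact: measurable_chain.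
move=> n y.
have mC : measurable (\bigcap_(i in `I_n.+1) (chain y0 i @^-1` [set y i])).
  by apply: bigcap_measurableType => // i _; exact: measurable_chain.
rewrite P_unit //.
have E : (\bigcap_(i in `I_n.+1) (chain y0 i @^-1` [set y i])) `&` unit_itv =
   [set u | unit_itv u /\ forall i, (i <= n)%N -> digit_state y0 u i = y i].
  apply/seteqP; split=> u.
    move=> [H uI]; split=> // i ni; rewrite -(H i) //= /chain.
    by move: uI; rewrite /unit_itv /= in_itv /= => ->.
  move=> [uI H]; split=> // i /= ni; rewrite /chain.
  by move: (uI); rewrite /unit_itv /= in_itv /= => ->; exact: H.
rewrite E; have [y00|y00] := eqVneq (y 0%N) y0; last first.
  rewrite mul0r (_ : [set _ | _] = set0) ?measure0 //; apply/seteqP; split=> u //.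
  by move=> [_ /(_ 0%N isT) /= yy]; rewrite yy eqxx in y00.
rewrite mul1r.
have [/forallP valid|] := boolP [forall i : 'I_n, y i.+1 \in nb (y i)].
  have [|a [a0 a1 aP]] := @digit_state_itv n y.
    by move=> i ni; exact: (valid (Ordinal ni)).
  rewrite (_ : [set _ | _] = `[a, a + \prod_(i < n) (size (nb (y i)))%:R^-1[%classic).
    rewrite P_itv // ?lerDl ?prodr_ge0 //; first last.
    rewrite addrAC subrr add0r; congr EFin; apply: eq_bigr => i _.
    by rewrite (valid i) mul1r.
  apply/seteqP; split=> u.
    move=> [uI H]; rewrite /= in_itv /=; apply/(aP u).
      by move: uI; rewrite /unit_itv /= in_itv.
    by rewrite y00.
  rewrite /= in_itv /= => au.
  have u01 : 0 <= u < 1 by move/andP: au => [au ua]; rewrite (le_trans a0 au) (lt_le_trans ua a1).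
  by split; [rewrite /unit_itv /= in_itv|rewrite -y00; apply/(aP u)].
move=> /forallPn[i yi].
(* A forbidden step gives the trajectory weight 0, and no [u] of the unit interval realises it,
   since every digit selects an element of [nb]. *)
rewrite (bigD1 i) //= (negbTE yi) !mul0r.
rewrite (_ : [set _ | _] = set0) ?measure0 //; apply/seteqP; split=> u //.
move=> [uI H]; move/negP: yi; apply.
have -> : y i.+1 = digit_state y0 u i.+1 by rewrite H.
have -> : y i = digit_state y0 u i by rewrite H // ltnW.
move: uI; rewrite /unit_itv /= in_itv /=; move: {H y00 E mC} (nat_of_ord i) => k.
elim: k y0 u => [|k IHk] z u u01.
  rewrite [X in X \in _]/= [X in nb X]/=; apply: mem_nth.
  have /andP[u0 u1] := u01.
  rewrite truncn_lt_nat ?mulr_ge0 // gtr_pMr // ltr0n; exact: nb_gt0.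
rewrite [X in X \in _]/= [X in nb X]/=; apply: IHk.
have /andP[u0 u1] := u01.
have /andP[t0 t1] : (Num.truncn ((size (nb z))%:R * u))%:R <= (size (nb z))%:R * u <
  (Num.truncn ((size (nb z))%:R * u)).+1%:R.
  by apply: truncn_itv; rewrite mulr_ge0.
by rewrite subr_ge0 t0 /= ltrBlDl natr1.
Qed.

End digit_chain.

(** * Recurrence of the simple random walk *)

Section graph_walk.
Context (R : realType) (X : choiceType) (E : rel X).
Hypotheses (E_sym : symmetric E) (E_fin : forall y, finite_set (neighbors E y)).

Definition nbrs (y : X) : seq X := enum_fset (fset_set (neighbors E y)).

Lemma nbrs_uniq y : uniq (nbrs y).
Proof. exact: fset_uniq. Qed.

Lemma mem_nbrs y z : (z \in nbrs y) = E y z.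
Proof.
rewrite /nbrs; have := in_fset_set (E_fin y) z; rewrite /= => ->.
by apply/idP/idP; rewrite inE.
Qed.

Definition adj (y z : X) : R := (E y z)%:R.

(** The loop at an isolated vertex follows [srw_step], and makes the simple random walk uniform on a
    list that is never empty. *)
Definition srw_nbrs (y : X) : seq X := if nbrs y is [::] then [:: y] else nbrs y.

Lemma srw_nbrs_uniq y : uniq (srw_nbrs y).
Proof. by rewrite /srw_nbrs; have := nbrs_uniq y; case: nbrs. Qed.

Lemma srw_nbrs_gt0 y : (0 < size (srw_nbrs y))%N.
Proof. by rewrite /srw_nbrs; case: nbrs. Qed.

Lemma srw_stepE y z :
  srw_step R E y z = (z \in srw_nbrs y)%:R / (size (srw_nbrs y))%:R.
Proof.
rewrite /srw_step /srw_nbrs -mem_nbrs /degree.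
have -> : #|` fset_set (neighbors E y)|%fset = size (nbrs y) by [].
case: (nbrs y) => [|a s] //=.
by rewrite inE eq_sym divr1.
Qed.

Lemma srw_reversible :
  reversible_chain srw_nbrs (srw_step R E) (fun y => (size (srw_nbrs y))%:R).
Proof.
have N0 y : (size (srw_nbrs y))%:R != 0 :> R by rewrite pnatr_eq0 -lt0n srw_nbrs_gt0.
have mulN y z : (size (srw_nbrs y))%:R * srw_step R E y z = (z \in srw_nbrs y)%:R.
  by rewrite srw_stepE mulrC divfK.
split.
- exact: srw_nbrs_uniq.
- by move=> y z; rewrite srw_stepE divr_ge0.
- by move=> y z zy; rewrite srw_stepE (negbTE zy) mul0r.
- move=> y; under eq_big_seq => z zy do rewrite srw_stepE zy.
  rewrite -mulr_suml -natr_sum sum1_size divff //.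
- by move=> y; rewrite ltr0n srw_nbrs_gt0.
- move=> y z; rewrite !mulN; congr (_%:R); congr nat_of_bool.
  have sym0 a b : a \in srw_nbrs b -> b \in srw_nbrs a.
    rewrite /srw_nbrs; case Eb: (nbrs b) => [|c s].
      by rewrite inE => /eqP ->; rewrite Eb mem_head.
    rewrite -Eb mem_nbrs E_sym -mem_nbrs; by case: (nbrs a).
  by apply/idP/idP; exact: sym0.
Qed.

(** The degree weight cancels the normalisation of the step; the loop at an isolated vertex lies on
    the diagonal, which energies ignore. *)
Let srw_weight y z : y != z ->
  (size (srw_nbrs y))%:R * srw_step R E y z = adj y z.
Proof.
move=> yz; rewrite srw_stepE mulrC divfK ?pnatr_eq0 -?lt0n ?srw_nbrs_gt0 //.
rewrite /adj -mem_nbrs /srw_nbrs; case: (nbrs y) => //.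
by rewrite inE eq_sym (negbTE yz).
Qed.

Lemma srw_avoids d (Omega : measurableType d) (P : probability Omega R) x
    (S : nat -> Omega -> X) n : simple_random_walk E P x S ->
  pr P (avoids S x 0 n) = avoid srw_nbrs (srw_step R E) x n x.
Proof.
move=> [mS law]; apply: pr_avoids => //.
- exact: srw_nbrs_uniq.
- exact: (step_sum srw_reversible).
Qed.

Lemma returnE d (Omega : measurableType d) (S : nat -> Omega -> X) x :
  [set w | exists2 n : nat, (1 <= n)%N & S n w = x] = ~` \bigcap_n avoids S x 0 n.
Proof.
apply/seteqP; split=> w.
  by move=> [n n1 Sn] /(_ n I n); rewrite add0n leqnn n1 => /(_ isT).
move=> H; apply: contrapT => /forall2NP H'; apply: H => n _ i /andP[i0 _] Si.
by case: (H' i).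
Qed.

Theorem recurrent_zero_capacity : recurrent R E -> forall x, zero_capacity adj x.
Proof.
move=> rec x.
apply: (@zero_capacity_le _ _ _ (fun y z => (size (srw_nbrs y))%:R * srw_step R E y z) 1) => //.
  by move=> y z yz; rewrite srw_weight // mul1r.
apply: (escape_null_capacity srw_reversible).
(* Recurrence is a statement about all realisations of the walk, so one must be supplied. Continuity
   from above along the decreasing no-return events then gives [escape_null]. *)
have [dd [Om [P [S [mS law]]]]] := uniform_chain_exists R srw_nbrs_uniq srw_nbrs_gt0 x.
have srwS : simple_random_walk E P x S.
  split=> // n y; rewrite law; congr (_ * _)%:E.
  by apply: eq_bigr => i _; rewrite srw_stepE.
have mA n : measurable (avoids S x 0 n) by exact: measurable_avoids.
have P0 : P (\bigcap_n avoids S x 0 n) = 0%E.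
  have := rec x _ _ _ _ srwS; rewrite returnE => P1.
  rewrite -(setCK (\bigcap_n _)) probability_setC ?P1 ?subee //.
  by apply: measurableC; exact: bigcap_measurableType.
have cv0 : (P \o avoids S x 0) n @[n --> \oo] --> P (\bigcap_n avoids S x 0 n).
  apply: nonincreasing_cvg_mu => //.
  - by rewrite (le_lt_trans (probability_le1 _ (mA 0%N))) // ltry.
  - exact: bigcap_measurableType.
  - move=> n m nm; apply/subsetPset => w H i /andP[i0 im]; apply: H.
    by rewrite i0 (leq_trans im) // leq_add2l.
rewrite P0 in cv0 => eps eps0.
apply: contrapT => /forallNP uge.
suff : (eps%:E <= 0)%E by rewrite lee_fin leNgt eps0.
apply: (cvge_to_ge cv0); near=> n.
have /negP := uge n; rewrite -ltNge -(srw_avoids n srwS) => /ltW.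
by rewrite -lee_fin prE.
Unshelve. all: by end_near.
Qed.

Theorem zero_capacity_recurrent : (forall x, zero_capacity adj x) -> recurrent R E.
Proof.
move=> zc x d Omega P S srwS.
have mA n : measurable (avoids S x 0 n) by apply: measurable_avoids; case: srwS.
have mB : measurable (\bigcap_n avoids S x 0 n) by exact: bigcap_measurableType.
rewrite returnE probability_setC // (_ : P _ = 0%E) ?sube0 //.
rewrite -prE //; congr EFin; apply/eqP; rewrite eq_le pr_ge0 andbT.
apply/ler_addgt0Pr => eps eps0; rewrite add0r.
have [|n un] := capacity_escape_null srw_reversible (x := x) _ eps0.
  apply: (@zero_capacity_le _ _ _ adj 1) => //.
  by move=> y z yz; rewrite srw_weight // mul1r.
apply: le_trans un; rewrite -(srw_avoids n srwS); apply: pr_le => //.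
by move=> w; apply.
Qed.

End graph_walk.

(** * The Borel sets of the permutation group *)

Section permutations.
Variable X : choiceType.
Implicit Types (s t : symgroup X) (l : seq (X * X)).

Definition moves (z y : X) : set (borel_symgroup X) := [set s | perm_fun s z = y].

Definition agrees l (f : X -> X) : bool := all (fun zy => f zy.1 == zy.2) l.

Definition cylinder l : set (borel_symgroup X) := [set s | agrees l (perm_fun s)].

Lemma perm_bij s : bijective (perm_fun s).
Proof. by case: s => f fP; rewrite /perm_fun /=; exact: set_mem fP. Qed.

Lemma perm_fun_inj s : injective (perm_fun s).
Proof. exact: bij_inj (perm_bij s). Qed.

Lemma perm_ext s t : perm_fun s =1 perm_fun t -> s = t.
Proof. by move=> /funext st; apply: val_inj. Qed.

Definition mk_perm (f : X -> X) (bf : bijective f) : symgroup X :=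
  SigSub (mem_set bf : f \in @bijections X).

Lemma mk_permE f bf : perm_fun (@mk_perm f bf) = f.
Proof. by []. Qed.

Definition preperm (s : symgroup X) (y : X) : X := xget y [set z | perm_fun s z = y].

Lemma prepermK s : cancel (preperm s) (perm_fun s).
Proof.
move=> y; rewrite /preperm; case: xgetP => // H.
have [g fg gf] := perm_bij s.
by case: (H (g y)); exact: gf.
Qed.

Lemma permK s : cancel (perm_fun s) (preperm s).
Proof. by move=> y; apply: (@perm_fun_inj s); rewrite prepermK. Qed.

Lemma preperm_eq s y z : (preperm s y = z) <-> (perm_fun s z = y).
Proof. by split=> <-; rewrite ?prepermK ?permK. Qed.

Definition perm_inv s : symgroup X := mk_perm (Bijective (prepermK s) (permK s)).

Lemma set_invE (A : set (symgroup X)) s : set_inv A s <-> A (perm_inv s).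
Proof.
split=> [[t At [st ts]]|As].
  suff -> : perm_inv s = t by [].
  by apply: perm_ext => y; apply/preperm_eq.
exists (perm_inv s) => //; split; [exact: permK|exact: prepermK].
Qed.

Lemma set_inv_moves z y : set_inv (moves z y) = moves y z.
Proof.
by apply/seteqP; split=> s; rewrite set_invE /moves /= preperm_eq.
Qed.

Lemma open_moves z y : open (moves z y : set (symgroup X)).
Proof.
pose K (_ : X) : topologicalType := discrete_topology X.
have oE : open [set f : prod_topology K | f z = y].
  apply: (iffLR (continuousP (proj z : prod_topology K -> K z)) _ [set y]).
    exact: proj_continuous.
  exact: discrete_open.
by exists [set f : prod_topology K | f z = y].
Qed.

Lemma measurable_moves z y : measurable (moves z y).
Proof. by apply: sub_sigma_algebra; exact: open_moves. Qed.

Lemma cylinder_cons z y l : cylinder ((z, y) :: l) = moves z y `&` cylinder l.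
Proof.
apply/seteqP; split=> s; rewrite /cylinder /moves /=.
  by move=> /andP[/eqP ? ?]; split.
by move=> [-> ?]; rewrite eqxx.
Qed.

Lemma cylinder_nil : cylinder [::] = setT.
Proof. by apply/seteqP; split. Qed.

Lemma measurable_cylinder l : measurable (cylinder l).
Proof.
elim: l => [|[z y] l IHl]; first by rewrite cylinder_nil; exact: measurableT.
by rewrite cylinder_cons; apply: measurableI; [exact: measurable_moves|].
Qed.

Lemma cylinderI l l' : cylinder l `&` cylinder l' = cylinder (l ++ l').
Proof.
by apply/seteqP; split=> s; rewrite /cylinder /agrees /= all_cat => /andP.
Qed.

(** The cylinders around [s] generate a filter that converges to [s] at each point, hence in the
    product topology, so it contains every open set around [s]. *)
Lemma open_cylinder (U : set (symgroup X)) s : open U -> U s ->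
  exists l, cylinder l s /\ cylinder l `<=` U.
Proof.
move=> [V openV <-] Vs.
pose F : set_system {ptws X -> discrete_topology X} :=
  [set A | exists l, agrees l (perm_fun s) /\ [set f : X -> X | agrees l f] `<=` A].
have FF : Filter F.
  split.
  - by exists [::].
  - move=> A B [l [ls lA]] [l' [ls' lB]]; exists (l ++ l').
    rewrite /agrees all_cat; split; first exact/andP.
    by move=> f /=; rewrite /agrees all_cat => /andP[/lA ? /lB ?].
  - by move=> A B AB [l [ls lA]]; exists l; split=> // f /lA/AB.
have cv : F --> (perm_fun s : {ptws X -> discrete_topology X}).
  apply/cvg_sup => z A [B [[C Cop <-] Cs] BA].
  exists [:: (z, perm_fun s z)]; split; first by rewrite /agrees /= eqxx.
  move=> f; rewrite /agrees /= andbT => /eqP fz; apply: BA.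
  by rewrite /preimage /= fz.
have [l [ls lO]] : F V by apply: cv; apply: open_nbhs_nbhs.
by exists l; split=> // t; exact: lO.
Qed.

Hypothesis X_countable : countable [set: X].

(** An open set is the union of the cylinders it contains, and over a countable [X] there are only
    countably many cylinders. *)
Lemma measurable_symgroupE :
  @measurable _ (borel_symgroup X) = <<s range cylinder >>.
Proof.
apply/seteqP; split; last first.
  apply: smallest_sub; first exact: sigma_algebra_measurable.
  by move=> _ [l _ <-]; exact: measurable_cylinder.
apply: smallest_sub; first exact: smallest_sigma_algebra.
move=> U oU.
have -> : U = \bigcup_(l in [set: seq (X * X)])
    (if asbool (cylinder l `<=` U) then cylinder l else set0).
  apply/seteqP; split=> s.
    move=> Us; have [l [ls lU]] := open_cylinder oU Us.
    by exists l => //; rewrite asboolT.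
  by move=> [l _]; case: asboolP => // lU; exact: lU.
have cX : countable [set: seq (X * X)].
  have /countable_injP[e eI] := X_countable.
  apply/countable_injP; exists (fun l => @choice.pickle (seq (nat * nat)) [seq (e p.1,
    e p.2) | p <- l]).
  move=> l l' _ _ /(pcan_inj (@choice.pickleK (seq (nat * nat))))/inj_map; apply => -[a b] [c d] [].
  by move=> /(eI _ _ (mem_set I) (mem_set I)) -> /(eI _ _ (mem_set I) (mem_set I)) ->.
pose T := g_sigma_algebraType (range cylinder).
apply: (@countable_bigcupT_measurable _ T _ _ cX) => l.
case: asboolP => _; last exact: measurable0.
by apply: sub_sigma_algebra; exists l.
Qed.

Lemma cylinder_induction (Q : set (set (borel_symgroup X))) :
  (forall l, Q (cylinder l)) ->
  (forall A, measurable A -> Q A -> Q (~` A)) ->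
  (forall F : (set (borel_symgroup X))^nat, (forall n, measurable (F n)) ->
    trivIset setT F -> (forall n, Q (F n)) -> Q (\bigcup_k F k)) ->
  forall A, measurable A -> Q A.
Proof.
move=> Ql QC QU A; rewrite measurable_symgroupE.
apply: (dynkin_induction measurable_symgroupE) => //.
- by move=> _ _ [l _ <-] [l' _ <-]; rewrite cylinderI; exists (l ++ l').
- by rewrite -cylinder_nil.
- by move=> _ [l _ <-].
Qed.

Lemma measurable_moves_inv d (T : measurableType d) (f : T -> borel_symgroup X) :
  (forall z y, measurable (f @^-1` moves z y)) -> measurable_fun setT f.
Proof.
move=> mf _ A mA; rewrite setTI.
apply: (cylinder_induction (Q := [set A | measurable (f @^-1` A)])) mA.
- elim=> [|[z y] l IHl] /=; first by rewrite cylinder_nil preimage_setT; exact: measurableT.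
  rewrite cylinder_cons preimage_setI; apply: measurableI; [exact: mf|exact: IHl].
- by move=> B mB fB /=; rewrite preimage_setC; exact: measurableC.
- by move=> F mF tF fF /=; rewrite preimage_bigcup; apply: bigcupT_measurable => k; exact: fF.
Qed.

End permutations.

(** * Inverted orbits *)

Section inverted_orbits.
Variables (X : choiceType) (Omega : Type) (s : nat -> Omega -> symgroup X).

Lemma walk_bij n w : bijective (walk s n w).
Proof.
elim: n => [|n IHn] /=; first by exists id.
exact: bij_comp (perm_bij _) IHn.
Qed.

Definition prewalk n w (y : X) : X := xget y [set v | walk s n w v = y].

Lemma prewalkK n w y : walk s n w (prewalk n w y) = y.
Proof.
rewrite /prewalk; case: xgetP => // H.
have [g fg gf] := walk_bij n w.
by case: (H (g y)); exact: gf.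
Qed.

Lemma prewalk_eq n w y v : prewalk n w y = v <-> walk s n w v = y.
Proof.
split=> [<-|<-]; first exact: prewalkK.
by apply: (bij_inj (walk_bij n w)); rewrite prewalkK.
Qed.

(* [back_chain n x i] is the point s_(n-i+1)^-1 ... s_n^-1 x reached after i
   of the n steps of the inverted walk. *)
Definition back_chain n x (i : nat) (w : Omega) : X :=
  walk s (n - i) w (prewalk n w x).

Lemma back_chain0 n x w : back_chain n x 0 w = x.
Proof. by rewrite /back_chain subn0 prewalkK. Qed.

Lemma back_chainS n x i w : (i < n)%N ->
  perm_fun (s (n - i.+1)%N w) (back_chain n x i.+1 w) = back_chain n x i w.
Proof. by move=> ni; rewrite /back_chain -[(n - i)%N](subnSK ni). Qed.

Lemma inverted_orbitE n x w :
  inverted_orbit s n x w = [set` [seq prewalk j w x | j <- iota 0 n.+1]].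
Proof.
apply/seteqP; split=> v.
  move=> [j jn /= jv]; suff : v \in [seq prewalk j w x | j <- iota 0 n.+1] by [].
  apply/mapP; exists j; first by rewrite mem_iota add0n.
  by apply/esym/prewalk_eq.
move=> vs; have /mapP[j] : v \in [seq prewalk j w x | j <- iota 0 n.+1] by exact: vs.
rewrite mem_iota add0n => /andP[_ jn] ->.
by exists j => //=; exact: prewalkK.
Qed.

Lemma inverted_orbit_sizeE n x w :
  inverted_orbit_size s n x w = size (undup [seq prewalk j w x | j <- iota 0 n.+1]).
Proof.
rewrite /inverted_orbit_size inverted_orbitE.
set sq := [seq _ | j <- _]; apply: perm_size; apply: uniq_perm.
- exact: fset_uniq.
- exact: undup_uniq.
move=> v; rewrite mem_undup.
have := in_fset_set (finite_seq sq) v; rewrite /= => ->.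
by rewrite mem_setE.
Qed.

Definition fresh n x : set Omega :=
  [set w | forall i, (0 < i <= n)%N -> back_chain n x i w <> x].

(** Having [back_chain] at [x] after [i] steps means that the preimages of [x] at the times n and n
    - i coincide; so [fresh n] says that time n adds a new point to the orbit. *)
Lemma freshE n x w :
  fresh n x w <-> prewalk n w x \notin [seq prewalk j w x | j <- iota 0 n].
Proof.
split=> [H|/negP H i /andP[i0 ni] Hi].
  apply/negP => /mapP[j]; rewrite mem_iota add0n => /andP[_ jn] njx.
  have := H (n - j)%N; rewrite subn_gt0 jn leq_subr => /(_ isT); apply.
  by rewrite /back_chain subKn ?(ltnW jn) // njx prewalkK.
apply: H; apply/mapP; exists (n - i)%N.
  by rewrite mem_iota add0n /= ltn_subrL i0 (leq_trans i0 ni).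
apply/esym/prewalk_eq; exact: Hi.
Qed.

Lemma inverted_orbit_size_fresh n x w : inverted_orbit_size s n x w =
  (\sum_(j < n.+1) (asbool (fresh j x w) : nat))%N.
Proof.
rewrite inverted_orbit_sizeE; elim: n => [|n IHn].
  rewrite big_ord_recr big_ord0 /= asboolT //.
  by move=> i /andP[i0]; rewrite leqn0 => /eqP i00; rewrite i00 in i0.
rewrite big_ord_recr -IHn -[in LHS](addn1 n.+1) iotaD map_cat add0n.
set sq := [seq _ | j <- iota 0 n.+1].
have -> : asbool (fresh n.+1 x w) = (prewalk n.+1 w x \notin sq).
  by apply/asboolP/idP => /freshE.
rewrite cats1 undup_rcons size_rcons.
have [xs|xs] := boolP (prewalk n.+1 w x \in sq).
  rewrite [RHS]addn0 -rem_filter ?undup_uniq // size_rem ?mem_undup // prednK //.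
  by have := xs; rewrite -mem_undup; case: undup.
rewrite [RHS]addn1 (_ : [seq y <- undup sq | _] = undup sq) //.
apply/all_filterP/allP => v; rewrite mem_undup; apply: contraTneq => ->.
exact: xs.
Qed.
End inverted_orbits.

(** * Markov's inequality for the number of occurring events *)

Section count_markov.
Context d (Omega : measurableType d) (R : realType) (P : probability Omega R).
Variables (A : nat -> set Omega) (m : nat).
Hypothesis mA : forall j, measurable (A j).

Definition occurrences (w : Omega) : nat := (\sum_(j < m) (asbool (A j w) : nat))%N.

Lemma occurrencesE w : (occurrences w)%:R = \sum_(j < m) \1_(A j) w :> R.
Proof.
rewrite /occurrences natr_sum; apply: eq_bigr => j _; rewrite indicE.
by congr (nat_of_bool _)%:R; apply/asboolP/idP; rewrite inE.
Qed.

Lemma measurable_occurrences : measurable_fun setT (fun w => (occurrences w)%:R : R).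
Proof.
under eq_fun do rewrite occurrencesE.
by apply: measurable_sum => j; exact: measurable_indic.
Qed.

Lemma measurable_occurrences_le (a : R) :
  measurable [set w | (occurrences w)%:R <= a].
Proof.
have := measurable_occurrences measurableT (measurable_itv `]-oo, a]).
by rewrite setTI set_itvE.
Qed.

Lemma occurrences_markov (a : R) : 0 <= a ->
  a * pr P [set w | a < (occurrences w)%:R] <= \sum_(j < m) pr P (A j).
Proof.
move=> a0; set B := [set w | _].
have mB : measurable B.
  rewrite (_ : B = ~` [set w | (occurrences w)%:R <= a]).
    by apply: measurableC; exact: measurable_occurrences_le.
  by apply/seteqP; split=> w; rewrite /B /= ltNge => /negP.
rewrite -lee_fin EFinM prE // -sumEFin.
under eq_bigr do rewrite prE //.
have PI D : measurable D -> P D = (\int[P]_w (\1_D w)%:E)%E.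
  by move=> mD; rewrite integral_indic // setIT.
rewrite (PI B mB); under [leRHS]eq_bigr do rewrite PI //.
rewrite -ge0_integralZl //; last exact/measurable_EFinP/measurable_indic.
rewrite -ge0_integral_sum //; last first.
  by move=> j; exact/measurable_EFinP/measurable_indic.
apply: ge0_le_integral => //.
- by move=> w _; rewrite mule_ge0.
- by apply: measurable_funeM; exact/measurable_EFinP/measurable_indic.
- by apply: emeasurable_sum => j; exact/measurable_EFinP/measurable_indic.
move=> w _; rewrite sumEFin -occurrencesE -EFinM lee_fin indicE.
have [|] := boolP (w \in B); last by rewrite mulr0.
by rewrite inE mulr1 => /ltW.
Qed.

End count_markov.

(** * The inverted walk with independent increments *)

Section iid_orbit.
Context (R : realType) (X : choiceType) (X_countable : countable [set: X]).
Context d (Omega : measurableType d) (P : probability Omega R).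
Context (mu : probability (borel_symgroup X) R) (s : nat -> {RV P >-> borel_symgroup X}).
Hypothesis iid_s : iid mu s.

(* The law of s^-1 y under mu. *)
Definition step (y z : X) : R := pr mu (moves z y).

Let mmoves i z y : measurable (s i @^-1` moves z y).
Proof. by rewrite -[_ @^-1` _]setTI; apply: measurable_funPT => //; exact: measurable_moves. Qed.

Lemma measurable_back_chain n x i y :
  measurable (back_chain s n x i @^-1` [set y]).
Proof.
suff H j : (j <= n)%N -> measurable (back_chain s n x j @^-1` [set y]).
  have [|ni] := leqP i n; first exact: H.
  (* Beyond the horizon the truncated difference [n - i] stays 0, so the chain is frozen at its
     value for [i = n]. *)
  have := H n (leqnn n); congr measurable; rewrite /back_chain.
  have -> : (n - i = n - n)%N by rewrite subnn; apply/eqP; rewrite subn_eq0 ltnW.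
  by [].
elim: j y => [|j IHj] y jn.
  have [->|xy] := eqVneq x y.
    rewrite (_ : _ @^-1` _ = setT) //; apply/seteqP; split=> w // _.
    exact: back_chain0.
  rewrite (_ : _ @^-1` _ = set0) //; apply/seteqP; split=> w //=.
  by rewrite back_chain0; apply/eqP.
rewrite (_ : _ @^-1` _ = \bigcup_y' ((back_chain s n x j @^-1` [set y']) `&`
   (s (n - j.+1)%N @^-1` moves y y'))).
  apply: countable_bigcupT_measurable => // y'.
  by apply: measurableI => //; apply: IHj; exact: ltnW.
apply/seteqP; split=> w.
  move=> <-; exists (back_chain s n x j w) => //; split=> //.
  exact: back_chainS.
move=> [y' _ [<-]]; rewrite /preimage /moves /= -(back_chainS s x w jn).
by move=> /perm_fun_inj.
Qed.

(** Each step backwards consumes one further increment, so a prescribed trajectory is an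
    intersection of conditions on the k distinct increments of index n - k, .., n - 1. *)
Lemma back_chain_law n x k (y : nat -> X) : (k <= n)%N ->
  P (\bigcap_(i in `I_k.+1) (back_chain s n x i @^-1` [set y i])) =
  ((y 0%N == x)%:R * \prod_(i < k) step (y i) (y i.+1))%:E.
Proof.
move=> kn; have [y0|y0] := eqVneq (y 0%N) x; last first.
  rewrite mul0r (_ : \bigcap_(i in _) _ = set0) ?measure0 //.
  apply/seteqP; split=> w // /(_ 0%N isT) /=.
  by rewrite back_chain0 => xy; rewrite xy eqxx in y0.
rewrite mul1r.
pose J := [fset i in [seq (n - i.+1)%N | i <- iota 0 k]]%fset.
pose B i := moves (y (n - i)%N) (y (n - i.+1)%N).
have JP i : (i \in J) = (n - k <= i < n)%N.
  rewrite !inE; apply/mapP/idP => [[j]|/andP[i1 i2]].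
    by rewrite mem_iota => /andP[_ jk] ->; lia.
  by exists (n - i.+1)%N; [rewrite mem_iota; lia|lia].
have -> : \bigcap_(i in `I_k.+1) (back_chain s n x i @^-1` [set y i]) =
    \bigcap_(i in [set` J]) (s i @^-1` B i).
  apply/seteqP; split=> w.
    move=> H i /=; rewrite JP => /andP[i1 i2].
    rewrite /B /moves /=.
    have <- : back_chain s n x (n - i) w = y (n - i)%N by apply: H => /=; lia.
    have <- : back_chain s n x (n - i.+1) w = y (n - i.+1)%N by apply: H => /=; lia.
    have jn : (n - i.+1 < n)%N by lia.
    have := back_chainS s x w jn.
    have -> : (n - (n - i.+1).+1 = i)%N by lia.
    by have -> : ((n - i.+1).+1 = n - i)%N by lia.
  move=> H; elim=> [|i IHi] /= ik; first by rewrite back_chain0.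
  have ni : (i < n)%N by lia.
  have /H : [set` J] (n - i.+1)%N by rewrite /= JP; lia.
  rewrite /B /moves /preimage /=.
  have -> : (n - (n - i.+1) = i.+1)%N by lia.
  have -> : (n - (n - i.+1).+1 = i)%N by lia.
  rewrite -IHi; last by rewrite /=; lia.
  by rewrite -(back_chainS s x w ni) => /perm_fun_inj.
have mB i : measurable (B i) by exact: measurable_moves.
rewrite iid_s.1 // (perm_big [seq (n - i.+1)%N | i <- iota 0 k]) /=; last first.
  apply: uniq_perm; rewrite ?fset_uniq //.
    rewrite map_inj_in_uniq ?iota_uniq // => i j; rewrite !mem_iota; lia.
  by move=> i; rewrite !inE.
rewrite big_map -[k in iota 0 k]subn0 big_mkord -prodEFin; apply: eq_bigr => i _.
rewrite -[LHS]/(distribution P (s (n - i.+1)%N) (B (n - i.+1)%N)) iid_s.2 //.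
rewrite /step prE; last exact: measurable_moves.
have ik := ltn_ord i.
rewrite /B; have -> : (n - (n - i.+1) = i.+1)%N by lia.
by have -> : (n - (n - i.+1).+1 = i)%N by lia.
Qed.

Lemma measurable_fresh n x : measurable (fresh s n x).
Proof.
rewrite (_ : fresh s n x = avoids (back_chain s n x) x 0 n) //.
by apply: measurable_avoids => i y; exact: measurable_back_chain.
Qed.

Lemma pr_fresh (nb : X -> seq X) n x : (forall y, uniq (nb y)) ->
  (forall y, \sum_(z <- nb y) step y z = 1) ->
  pr P (fresh s n x) = avoid nb step x n x.
Proof.
move=> nb_uniq step_sum1.
rewrite -[fresh s n x]/(avoids (back_chain s n x) x 0 n); apply: pr_avoids => //.
- by move=> i y; exact: measurable_back_chain.
- by move=> k y kn; exact: back_chain_law.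
Qed.

Lemma orbit_size_occurrences n x w :
  inverted_orbit_size s n x w = occurrences (fun j => fresh s j x) n.+1 w.
Proof. exact: inverted_orbit_size_fresh. Qed.

Lemma measurable_orbit_size_le n x (a : R) :
  measurable [set w | (inverted_orbit_size s n x w)%:R <= a].
Proof.
under eq_set do rewrite orbit_size_occurrences.
by apply: measurable_occurrences_le => j; exact: measurable_fresh.
Qed.

(** A Cesaro argument makes the expected size at most eps n / 2; Markov's inequality then leaves
    probability at least 1/2, far more than the required exponential bound. *)
Lemma fresh_null_small_orbit x :
  (forall eps : R, 0 < eps -> exists n, pr P (fresh s n x) <= eps) ->
  (forall n m, (n <= m)%N -> pr P (fresh s m x) <= pr P (fresh s n x)) ->
  small_orbit_likely P s x.
Proof.
move=> null anti eps eps0.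
have [|m um] := null (eps / 8); first by rewrite divr_gt0.
(* From here on [m + 2 <= eps * n / 4]: this absorbs the first m terms of the sum and also gives
   [eps * n >= 1], hence [expR (eps * n) >= 2]. *)
have [N1 /= N1P] : exists N1 : nat, 4 * (m.+2)%:R / eps <= N1%:R.
  by exists (Num.truncn (4 * (m.+2)%:R / eps)).+1; rewrite ltW // truncnS_gt.
exists N1.+1 => // n /= nN.
have Nn : 4 * (m.+2)%:R <= eps * n%:R.
  have N1P' : 4 * (m.+2)%:R <= eps * N1%:R by rewrite [leRHS]mulrC -ler_pdivrMr.
  by apply: le_trans N1P' _; rewrite ler_pM2l // ler_nat ltnW.
have m2 : 2 <= (m.+2)%:R :> R by rewrite ler_nat.
have a0 : 0 < eps * n%:R by lra.
set B := [set w | _].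
have mB : measurable B by exact: measurable_orbit_size_le.
have mf j : measurable (fresh s j x) by exact: measurable_fresh.
have sumle : \sum_(j < n.+1) pr P (fresh s j x) <= m%:R + (n.+1)%:R * (eps / 8).
  rewrite -(big_mkord xpredT (fun j => pr P (fresh s j x))).
  apply: (@le_trans _ _ (\sum_(0 <= j < n.+1) ((j < m)%:R + eps / 8))).
    apply: ler_sum => j _; case: ltnP => jm.
      have := pr_le1 P (mf j); have : 0 <= eps / 8 by rewrite divr_ge0 // ltW.
      rewrite /=; lra.
    by rewrite add0r; apply: le_trans um; exact: anti.
  rewrite big_split /= sumr_const_nat subn0 -[X in _ + X]mulr_natl lerD2r -natr_sum ler_nat.
  suff -> : (\sum_(0 <= j < n.+1) (j < m) = minn n.+1 m)%N by rewrite geq_minr.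
  elim: (n.+1) => [|k IHk]; first by rewrite big_geq // min0n.
  by rewrite big_nat_recr //= IHk; lia.
have mkv : (eps * n%:R) * pr P (~` B) <= m%:R + (n.+1)%:R * (eps / 8).
  apply: le_trans sumle.
  have -> : ~` B = [set w | eps * n%:R < (occurrences (fun j => fresh s j x) n.+1 w)%:R].
    apply/seteqP; split=> w; rewrite /B /= -orbit_size_occurrences.
      by move=> /negP; rewrite -ltNge.
    by rewrite ltNge => /negP.
  by apply: occurrences_markov => //; exact: ltW.
rewrite prC // in mkv.
have PB : 1 / 2 <= pr P B.
  rewrite -(ler_pM2l a0).
  have e1 : eps <= eps * n%:R.
    by apply: ler_peMr; [exact: ltW|rewrite ler1n (leq_trans _ nN)].
  have E1 : (n.+1)%:R = n%:R + 1 :> R by rewrite natr1.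
  have E2 : (m.+2)%:R = m%:R + 2 :> R by rewrite -addn2 natrD.
  by rewrite E1 in mkv; rewrite E2 in Nn; lra.
rewrite -prE // lee_fin; apply: le_trans PB.
rewrite expRN -[leRHS]mul1r -[X in _ <= 1 * X]invrK mul1r lef_pV2 ?posrE ?invr_gt0 ?expR_gt0 //.
rewrite div1r invrK; apply: le_trans (expR_ge1Dx _); lra.
Qed.

End iid_orbit.

(** * Recurrence implies amenability *)

Section wobbling_walk.
Context (R : realType) (X : choiceType) (E : rel X) (D : nat).
Hypotheses (X_countable : countable [set: X]) (E_sym : symmetric E).
Hypotheses (E_fin : forall y, finite_set (neighbors E y)).
Hypotheses (E_deg : forall y, (degree E y <= D)%N).
Variables (r : nat) (mu : probability (borel_symgroup X) R).
Hypotheses (mu_sym : symmetric_measure mu) (mu_supp : supported_on mu (wobbling_le R E r)).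

Lemma gdist_path (y z : X) : (gdist R E y z <= r%:R%:E)%E ->
  exists2 p, path E y p /\ last y p = z & (size p <= r)%N.
Proof.
move=> yz; apply: contrapT => /forall2NP H.
suff : ((r.+1)%:R%:E <= gdist R E y z)%E.
  by move=> /le_trans /(_ yz); rewrite lee_fin ler_nat ltnn.
apply: le_ereal_inf_tmp => _ [p pyz <-]; rewrite lee_fin ler_nat ltnNge.
by case: (H p) => // /negP.
Qed.

(** The second membership reverses a path. It is the one needed for [preperm s y], where the
    displacement bound is given at the source and the list is centred at the target. *)
Lemma walk_ends_gdist (y z : X) : (gdist R E y z <= r%:R%:E)%E ->
  z \in walk_ends (nbrs E) r y /\ y \in walk_ends (nbrs E) r z.
Proof.
have nE a b : (b \in nbrs E a) = E a b by exact: mem_nbrs.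
move=> /gdist_path [p [yp <-] pr].
split; first exact: path_walk_ends.
have yl : last (last y p) (rev (belast y p)) = y.
  by case: p {yp pr} => [|a p] //=; rewrite rev_cons last_rcons.
rewrite -[X in X \in _]yl; apply: path_walk_ends => //.
  by rewrite rev_path; under eq_path => a b do rewrite E_sym.
by rewrite size_rev size_belast.
Qed.

Lemma wobbling_leE : wobbling_le R E r =
  [set s | forall y, (gdist R E y (perm_fun s y) <= r%:R%:E)%E].
Proof.
apply/seteqP; split=> s.
  move=> [_ sr] y; apply: le_trans sr; apply: ereal_sup_ubound.
  by exists y.
move=> sr; suff le : (perm_range R E s <= r%:R%:E)%E.
  by split=> //; rewrite /wobbling /= (le_lt_trans le) // ltry.
by apply: ge_ereal_sup => _ [y _ <-]; exact: sr.
Qed.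

Lemma measurable_wobbling_le : measurable (wobbling_le R E r : set (borel_symgroup X)).
Proof.
rewrite wobbling_leE.
rewrite (_ : [set s | _] = ~` \bigcup_y \bigcup_z
  (if (gdist R E y z <= r%:R%:E)%E then set0 else moves y z)).
  apply: measurableC; apply: countable_bigcupT_measurable => // y.
  apply: countable_bigcupT_measurable => // z.
  by case: ifP => // _; exact: measurable_moves.
apply/seteqP; split=> s.
  by move=> sr [y _ [z _]]; case: ifPn => // yz sy; rewrite -sy sr in yz.
move=> sr y; apply: contrapT => /negP yr; apply: sr.
by exists y => //; exists (perm_fun s y) => //; rewrite (negbTE yr).
Qed.

Definition range_nbrs (y : X) : seq X := undup (walk_ends (nbrs E) r y).

Lemma pr_range_nbrs y :
  pr mu [set s : borel_symgroup X | preperm s y \notin range_nbrs y] = 0.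
Proof.
have mB : measurable [set s : borel_symgroup X | preperm s y \notin range_nbrs y].
  apply: measurable_notin => z.
  rewrite (_ : _ @^-1` _ = moves z y); first exact: measurable_moves.
  by apply/seteqP; split=> s /preperm_eq.
apply/eqP; rewrite eq_le pr_ge0 andbT.
have -> : 0 = pr mu (~` wobbling_le R E r).
  by rewrite prC ?/pr ?mu_supp ?subrr //; exact: measurable_wobbling_le.
apply: pr_le => //; first by apply: measurableC; exact: measurable_wobbling_le.
move=> s /= + sr; rewrite wobbling_leE in sr.
rewrite mem_undup => /negP; apply.
have := sr (preperm s y); rewrite prepermK => /walk_ends_gdist [].
by [].
Qed.

Lemma step_range_sum y : \sum_(z <- range_nbrs y) step mu y z = 1.
Proof.
have mY z : measurable ((fun s : borel_symgroup X => preperm s y) @^-1` [set z]).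
  rewrite (_ : _ @^-1` _ = moves z y); first exact: measurable_moves.
  by apply/seteqP; split=> s /preperm_eq.
have := pr_partition mu (undup_uniq (walk_ends (nbrs E) r y)) measurableT mY.
rewrite prT setTI pr_range_nbrs addr0 => ->; apply: eq_bigr => z _.
rewrite setTI; congr pr; apply/seteqP; by split=> s /preperm_eq.
Qed.

(** Inversion exchanges [moves z y] and [moves y z]; symmetry of [mu] thus gives a chain reversible
    for the constant weight 1. *)
Lemma step_sym y z : step mu y z = step mu z y.
Proof. by rewrite /step /pr mu_sym ?set_inv_moves //; exact: measurable_moves. Qed.

Lemma step_reversible : reversible_chain range_nbrs (step mu) (fun=> 1).
Proof.
split.
- by move=> y; exact: undup_uniq.
- by move=> y z; exact: pr_ge0.
- move=> y z zy; apply/eqP; rewrite eq_le pr_ge0 andbT -(pr_range_nbrs y).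
  have mm := measurable_moves z y.
  apply: pr_le => //.
    apply: measurable_notin => v.
    rewrite (_ : _ @^-1` _ = moves v y); first exact: measurable_moves.
    by apply/seteqP; split=> s /preperm_eq.
  by move=> s /preperm_eq /= ->.
- exact: step_range_sum.
- by [].
- by move=> y z; rewrite !mul1r step_sym.
Qed.

Lemma pr_fresh_range d (Omega : measurableType d) (P : probability Omega R)
    (s : nat -> {RV P >-> borel_symgroup X}) n x : iid mu s ->
  pr P (fresh s n x) = avoid range_nbrs (step mu) x n x.
Proof.
move=> iids; apply: pr_fresh => //.
- by move=> y; exact: undup_uniq.
- exact: step_range_sum.
Qed.

Lemma zero_capacity_small_orbit x : zero_capacity (adj R E) x ->
  forall d (Omega : measurableType d) (P : probability Omega R)
    (s : nat -> {RV P >-> borel_symgroup X}), iid mu s -> small_orbit_likely P s x.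
Proof.
move=> zc d Omega P s iids.
have zcp : zero_capacity (fun y z => 1 * step mu y z) x.
  apply: (@zero_capacity_range _ _ E (nbrs E) D _ _ E_sym _ r) zc.
  - exact: nbrs_uniq.
  - exact: mem_nbrs.
  - exact: E_deg.
  - by move=> y z; rewrite mul1r pr_ge0 pr_le1 //; exact: measurable_moves.
  - move=> y z zy; rewrite mul1r (step_supp step_reversible) //.
    by rewrite mem_undup.
apply: (fresh_null_small_orbit X_countable).
  move=> eps eps0; have [n un] := capacity_escape_null step_reversible zcp eps0.
  by exists n; rewrite pr_fresh_range.
by move=> n m nm; rewrite !pr_fresh_range //; exact: (avoid_le step_reversible).
Qed.

End wobbling_walk.

Theorem zero_capacity_amenable (R : realType) (X : choiceType) (E : rel X) :
  countable [set: X] -> symmetric E -> bounded_degree E ->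
  (forall x, zero_capacity (adj R E) x) -> diffuse_extensively_amenable R E.
Proof.
move=> cX E_sym [D ED] zc r x mu r1 mu_sym mu_supp d Omega P s iids; left.
apply: (@zero_capacity_small_orbit _ _ E D _ _ _ _ r mu) => //.
- by move=> y; case: (ED y).
- by move=> y; case: (ED y).
Qed.

(** * Decomposition of the edges into matchings *)

Section greedy_colouring.
Variables (conf : rel nat) (K : nat).

Definition mex (s : seq nat) : nat := find (fun k => k \notin s) (iota 0 (size s).+1).

Let has_mex (s : seq nat) : has (fun k => k \notin s) (iota 0 (size s).+1).
Proof.
apply/negPn/negP => /hasPn H.
have /(uniq_leq_size (iota_uniq 0 (size s).+1)) : {subset iota 0 (size s).+1 <= s}.
  by move=> k /H /negPn.
by rewrite size_iota ltnn.
Qed.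

Lemma mex_notin s : mex s \notin s.
Proof.
have := nth_find 0%N (has_mex s); rewrite nth_iota ?add0n //.
by have := has_mex s; rewrite has_find size_iota.
Qed.

Lemma mex_le s : (mex s <= size s)%N.
Proof. by have := has_mex s; rewrite has_find size_iota. Qed.

Fixpoint greedy (n : nat) : seq nat :=
  if n is m.+1 then
    rcons (greedy m) (mex [seq nth 0%N (greedy m) i | i <- iota 0 m & conf i m])
  else [::].

Lemma size_greedy n : size (greedy n) = n.
Proof. by elim: n => //= n IHn; rewrite size_rcons IHn. Qed.

Lemma nth_greedy n m : (m < n)%N -> nth 0%N (greedy n) m = nth 0%N (greedy m.+1) m.
Proof.
elim: n => // n IHn; rewrite ltnS leq_eqVlt => /orP[/eqP -> //|mn].
by rewrite /= nth_rcons size_greedy mn IHn.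
Qed.

Definition colour (n : nat) : nat := nth 0%N (greedy n.+1) n.

Lemma colourE n : colour n = mex [seq colour i | i <- iota 0 n & conf i n].
Proof.
rewrite /colour /= nth_rcons size_greedy ltnn eqxx; congr mex.
apply/eq_in_map => i; rewrite mem_filter mem_iota add0n => /andP[_ /andP[_ i_n]].
exact: nth_greedy.
Qed.

Lemma colour_proper m n : (m < n)%N -> conf m n -> colour m != colour n.
Proof.
move=> mn cmn; rewrite [colour n]colourE.
apply: contraNneq (mex_notin [seq colour i | i <- iota 0 n & conf i n]) => <-.
by apply/mapP; exists m => //; rewrite mem_filter cmn mem_iota.
Qed.

Lemma colour_le n : (size [seq i <- iota 0 n | conf i n] <= K)%N -> (colour n <= K)%N.
Proof.
move=> nK; rewrite colourE; apply: leq_trans (mex_le _) _.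
by rewrite size_map.
Qed.

End greedy_colouring.

(** * Matchings from a colouring that separates vertices with a common neighbour *)

Section matchings.
Variables (X : choiceType) (E : rel X) (nb : X -> seq X) (D : nat) (e : X -> nat).
Hypotheses (E_sym : symmetric E) (e_inj : injective e).
Hypotheses (nbE : forall y z, (z \in nb y) = E y z).
Hypotheses (nb_size : forall y, (size (nb y) <= D)%N).

Let siblings (y : X) : seq X := flatten [seq nb v | v <- nb y].

Let size_siblings y : (size (siblings y) <= D * D)%N.
Proof.
rewrite size_flatten /shape -map_comp.
apply: (@leq_trans (size (nb y) * D)); last by rewrite leq_mul2r nb_size orbT.
by elim: (nb y) => [|z s IHs] //=; rewrite mulSn leq_add.
Qed.

Let conf : rel nat := fun m n =>
  `[< exists y z, [/\ e y = m, e z = n, y != z & y \in siblings z] >].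

Let col (y : X) : nat := colour conf (e y).

Let col_le y : (col y <= D * D)%N.
Proof.
apply: colour_le; apply: leq_trans (size_siblings y).
rewrite -(size_map e); apply: uniq_leq_size; first by rewrite filter_uniq ?iota_uniq.
move=> m; rewrite mem_filter => /andP[/asboolP[u [v [<- /e_inj -> _ uy]]] _].
by apply/mapP; exists u.
Qed.

Let col_inj w y z : E w y -> E w z -> col y = col z -> y = z.
Proof.
move=> wy wz cyz; apply/eqP; apply: contraT => yz.
have sib a b : E w a -> E w b -> a \in siblings b.
  move=> wa wb; apply/flattenP; exists (nb w); last by rewrite nbE.
  by apply/mapP; exists w => //; rewrite nbE E_sym.
have [eyz|ezy|/e_inj eyz] := ltngtP (e y) (e z); last by rewrite eyz eqxx in yz.
  have : conf (e y) (e z) by apply/asboolP; exists y, z; split=> //; exact: sib.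
  by move=> /(colour_proper eyz); rewrite -/(col y) -/(col z) cyz eqxx.
have : conf (e z) (e y).
  by apply/asboolP; exists z, y; split=> //; [rewrite eq_sym|exact: sib].
by move=> /(colour_proper ezy); rewrite -/(col y) -/(col z) cyz eqxx.
Qed.

(* Distinct neighbours of a vertex have distinct colours, so that the edges joining
   colours i and j form a matching. *)
Let mate (i j : nat) (y : X) : X :=
  let k := if col y == i then j else i in
  if (col y == i) || (col y == j) then head y [seq z <- nb y | col z == k] else y.

Let mateP k y : let z := head y [seq z <- nb y | col z == k] in
  z = y /\ ~~ has (fun z => col z == k) (nb y) \/ E y z /\ col z = k.
Proof.
move=> z; rewrite /z has_filter; case F: [seq _ <- _ | _] => [|a s]; first by left.
right; have : a \in [seq z0 <- nb y | col z0 == k] by rewrite F mem_head.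
by rewrite mem_filter nbE => /andP[/eqP].
Qed.

Let mate_eq y z i j : (col y == i) || (col y == j) -> E y z ->
  col z = (if col y == i then j else i) -> mate i j y = z.
Proof.
move=> yij yz cz; rewrite /mate yij.
have := @mateP (if col y == i then j else i) y; set k := if _ then _ else _ in cz *.
set v := head _ _ => -[[_ /hasPn /(_ z)]|[yv cv]].
  by rewrite nbE cz eqxx => /(_ yz).
by apply: (col_inj yv yz); rewrite cv cz.
Qed.

(** If [y] has a mate [z], then [y] is a neighbour of [z] with the colour that [mate] looks for at
    [z], and such a neighbour is unique by [col_inj]. The case [i = j] fits the same pattern. *)
Let mateK i j : involutive (mate i j).
Proof.
move=> y; have [yij|yij] := boolP ((col y == i) || (col y == j)); last first.
  by rewrite /mate (negbTE yij) (negbTE yij).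
have -> : mate i j y = head y [seq z <- nb y | col z == if col y == i then j else i].
  by rewrite /mate yij.
have := @mateP (if col y == i then j else i) y.
set z := head _ _ => -[[zy noz]|[yz cz]].
  rewrite /mate zy yij; have := @mateP (if col y == i then j else i) y.
  case=> [[-> //]|[yv cv]]; move/hasPn : noz => /(_ (head y [seq z0 <- nb y | col z0 ==
    if col y == i then j else i])).
  by rewrite nbE => /(_ yv); rewrite cv eqxx.
apply: mate_eq; rewrite ?cz 1?E_sym //.
  by case: ifP => // _; rewrite eqxx ?orbT.
case: (eqVneq (col y) i) yij => [yi _|_ /= /eqP ->]; last by rewrite eqxx.
by rewrite yi; case: eqVneq.
Qed.

Let mate_adj i j y : mate i j y = y \/ E y (mate i j y).
Proof.
rewrite /mate; case: ifP => yij; last by left.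
have := @mateP (if col y == i then j else i) y.
by case=> [[-> _]|[? _]]; [left|right].
Qed.

(** At most [D * D + 1] colours occur, since a vertex has at most [D * D] siblings. An edge from
    colour i to colour j lies in the matching numbered [i * q + j]. *)
Lemma matching_cover : exists L (m : nat -> X -> X),
  [/\ forall l, involutive (m l), forall l y, m l y = y \/ E y (m l y) &
      forall y z, E y z -> exists2 l, (l < L)%N & m l y = z].
Proof.
pose q := (D * D).+1.
exists (q * q)%N, (fun l => mate (l %/ q) (l %% q)); split.
- by move=> l; exact: mateK.
- by move=> l y; exact: mate_adj.
move=> y z yz; exists (col y * q + col z)%N.
  have : ((col y).+1 * q <= q * q)%N by rewrite leq_mul2r ltnS col_le orbT.
  by apply: leq_trans; rewrite mulSn addnC ltn_add2r ltnS.
have zq : (col z < q)%N by rewrite ltnS.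
rewrite divnMDl // divn_small // addn0 modnMDl modn_small //.
by apply: mate_eq; rewrite ?eqxx.
Qed.

End matchings.

(** * Fair coins *)

Section coordinate_average.
Context (R : realType).
Implicit Types (b : nat -> bool) (S : seq nat).

Definition upd b (k : nat) (v : bool) : nat -> bool := fun i => if i == k then v else b i.

Definition depends_on T S (f : (nat -> bool) -> T) : Prop :=
  forall b b', {in S, b =1 b'} -> f b = f b'.

(** Expectation over fair values of the coordinates in [S], the other coordinates being frozen at
    [b]. *)
Fixpoint avg S (f : (nat -> bool) -> R) b : R :=
  if S is k :: S' then (avg S' f (upd b k false) + avg S' f (upd b k true)) / 2
  else f b.

Lemma avg_ext S (f g : (nat -> bool) -> R) b :
  (forall b', (forall i, i \notin S -> b' i = b i) -> f b' = g b') -> avg S f b = avg S g b.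
Proof.
elim: S b => [|k S IHS] b fg /=; first exact: fg.
by congr ((_ + _) / _); apply: IHS => b' b'b; apply: fg => i;
  rewrite inE negb_or => /andP[ik iS]; rewrite b'b // /upd (negbTE ik).
Qed.

Lemma avg_le S (f g : (nat -> bool) -> R) b :
  (forall b', f b' <= g b') -> avg S f b <= avg S g b.
Proof.
move=> fg; elim: S b => [|k S IHS] b //=.
by rewrite ler_pM2r // lerD.
Qed.

Lemma avgZ S (c : R) (f : (nat -> bool) -> R) b :
  avg S (fun b => c * f b) b = c * avg S f b.
Proof. by elim: S b => [|k S IHS] b //=; rewrite !IHS mulrA mulrDr. Qed.

Lemma avg_sum S I (r : seq I) (f : I -> (nat -> bool) -> R) b :
  avg S (fun b => \sum_(i <- r) f i b) b = \sum_(i <- r) avg S (f i) b.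
Proof.
elim: S b => [|k S IHS] b //=; rewrite !IHS -big_split /= mulr_suml.
by [].
Qed.

Lemma avg_cst S (c : R) b : avg S (fun=> c) b = c.
Proof. by elim: S b => [|k S IHS] b //=; rewrite !IHS; lra. Qed.

Lemma avg_cat S S' (f : (nat -> bool) -> R) b : avg (S ++ S') f b = avg S (avg S' f) b.
Proof. by elim: S b => [|k S IHS] b //=; rewrite !IHS. Qed.

Lemma depends_on_sub T S S' (f : (nat -> bool) -> T) : {subset S <= S'} ->
  depends_on S f -> depends_on S' f.
Proof. by move=> SS' df b b' bb'; apply: df => i /SS'/bb'. Qed.

Lemma avg_depends S S' (f : (nat -> bool) -> R) b b' : depends_on (S ++ S') f ->
  {in S', b =1 b'} -> avg S f b = avg S f b'.
Proof.
elim: S b b' S' => [|k S IHS] b b' S' df bb' /=; first exact: df.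
have H v : avg S f (upd b k v) = avg S f (upd b' k v).
  apply: (IHS _ _ (k :: S')).
    by apply: depends_on_sub df => i; rewrite !(inE, mem_cat) orbCA orbA.
  by move=> i; rewrite inE /upd; case: eqP => //= _ /bb'.
by rewrite !H.
Qed.

Lemma avg_const S (f : (nat -> bool) -> R) b b' : depends_on S f ->
  avg S f b = avg S f b'.
Proof. by move=> df; apply: (@avg_depends S [::]); rewrite ?cats0. Qed.

Lemma avg_prod S S' (f g : (nat -> bool) -> R) b : uniq (S ++ S') ->
  depends_on S f -> depends_on S' g ->
  avg (S ++ S') (fun b => f b * g b) b = avg S f b * avg S' g b.
Proof.
move=> uSS' df dg; rewrite avg_cat.
rewrite [RHS]mulrC -avgZ; apply: avg_ext => b' _.
rewrite -(avg_const b' b dg) mulrC -avgZ; apply: avg_ext => b'' bb''.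
congr (_ * _); apply: df => i iS; apply: bb''; apply: contraL iS => iS'.
by move: uSS'; rewrite cat_uniq => /and3P[_ /hasPn /(_ i iS')].
Qed.

End coordinate_average.

(** * Integrals over fair coins as finite averages *)

Section coins.
Context d (Omega : measurableType d) (R : realType) (P : probability Omega R).
Implicit Types (B : Omega -> nat -> bool) (S : seq nat) (v : nat -> bool).

Definition coin_cyl (B : Omega -> nat -> bool) (S : seq nat) (v : nat -> bool) : set Omega :=
  [set w | all (fun k => B w k == v k) S].

Definition fair_coins (B : Omega -> nat -> bool) : Prop :=
  (forall k, measurable [set w | B w k]) /\
  forall S v, uniq S -> pr P (coin_cyl B S v) = 2^-1 ^+ size S.

Lemma coin_cyl_cons B S v k :
  coin_cyl B (k :: S) v = [set w | B w k = v k] `&` coin_cyl B S v.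
Proof.
apply/seteqP; split=> w; rewrite /coin_cyl /setI /=.
  by move=> /andP[/eqP ? ?].
by move=> [-> ?]; rewrite eqxx.
Qed.

Lemma measurable_coin B k c : (forall k, measurable [set w | B w k]) ->
  measurable [set w | B w k = c].
Proof.
move=> mB; case: c; first exact: mB.
rewrite (_ : [set w | _] = ~` [set w | B w k]); first exact: measurableC.
apply/seteqP; split=> w; rewrite /setC /=; first by move=> ->.
by move=> /negP/negbTE.
Qed.

Lemma measurable_coin_cyl B S v : (forall k, measurable [set w | B w k]) ->
  measurable (coin_cyl B S v).
Proof.
move=> mB; elim: S => [|k S IHS]; last first.
  by rewrite coin_cyl_cons; apply: measurableI => //; exact: measurable_coin.
by rewrite (_ : coin_cyl _ _ _ = setT) //; apply/seteqP.
Qed.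

Lemma coin_cyl_split B S v k : (forall k, measurable [set w | B w k]) -> k \notin S ->
  pr P (coin_cyl B S v) =
  pr P (coin_cyl B (k :: S) (upd v k false)) + pr P (coin_cyl B (k :: S) (upd v k true)).
Proof.
move=> mB kS.
have E c : coin_cyl B (k :: S) (upd v k c) = coin_cyl B S v `&` [set w | B w k = c].
  rewrite coin_cyl_cons setIC /upd eqxx; congr (_ `&` _).
  have ik i : i \in S -> (i == k) = false by move=> iS; apply: contraNF kS => /eqP <-.
  by apply/seteqP; split=> w; rewrite /coin_cyl /= => /allP H; apply/allP => i iS;
    have := H i iS; rewrite /upd ik.
rewrite !E (pr_split P (measurable_coin_cyl S v mB) (measurable_coin k true mB)) addrC.
congr (pr P (_ `&` _) + _).
apply/seteqP; split=> w; rewrite /setC /=; first by move=> /negP/negbTE.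
by move=> ->.
Qed.

(** A general finite set of coins is completed to an initial segment; the induction adds the missing
    coins one at a time, summing over both values. *)
Lemma fair_coins_prefix B : (forall k, measurable [set w | B w k]) ->
  (forall n v, pr P (coin_cyl B (iota 0 n) v) = 2^-1 ^+ n) -> fair_coins B.
Proof.
move=> mB pB; split=> // S v uS.
pose N := (\max_(k <- S) k).+1.
have SN k : k \in S -> (k < N)%N by move=> kS; rewrite ltnS leq_bigmax_seq.
have main M : forall S v, perm_eq (M ++ S) (iota 0 N) ->
    pr P (coin_cyl B S v) = 2^-1 ^+ (size S).
  elim: M => [|k M IHM] S' v' pS'.
    rewrite (perm_size pS') size_iota -(pB N v'); congr pr.
    by apply/seteqP; split=> w; rewrite /coin_cyl /= (perm_all _ pS').
  have kS' : k \notin S'.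
    have := perm_uniq pS'; rewrite iota_uniq /= mem_cat negb_or.
    by case: (k \in S'); rewrite ?andbF.
  have pk : perm_eq (M ++ k :: S') (iota 0 N).
    by apply: perm_trans pS'; rewrite -[k :: S']cat1s perm_catCA.
  rewrite (coin_cyl_split _ mB kS') !IHM //.
  by rewrite /= exprS; lra.
apply: (main [seq k <- iota 0 N | k \notin S]).
apply: uniq_perm; rewrite ?iota_uniq //.
  rewrite cat_uniq filter_uniq ?iota_uniq //= uS andbT.
  apply/hasPn => k kS.
  suff -> : (k \in [seq i <- iota 0 N | i \notin S]) = false by [].
  by rewrite mem_filter kS.
move=> k; rewrite mem_cat mem_filter mem_iota /= add0n.
by case: (boolP (k \in S)) => [/SN ->|_]; rewrite ?orbT ?orbF.
Qed.

Lemma fair_coins_reindex B (g : nat -> nat) : injective g -> fair_coins B ->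
  fair_coins (fun w i => B w (g i)).
Proof.
move=> gI [mB pB]; split=> [k|S v uS]; first exact: mB.
(* The pattern [v] pushed forward along [g]; injectivity makes it unambiguous on the image of
   [S]. *)
pose v' k := if asbool (exists i, i \in S /\ g i = k /\ v i) then true else false.
rewrite -[size S](size_map g) -(pB _ v') ?map_inj_uniq //; congr pr.
apply/seteqP; split=> w; rewrite /coin_cyl /= all_map => /allP H; apply/allP => i iS /=;
  move/eqP: (H i iS) => /= ->; apply/eqP; rewrite /v'.
  case: asboolP => [[j [jS [/gI -> //]]]|ni].
  by apply/negbTE/negP => vi; apply: ni; exists i.
case: asboolP => [[j [jS [/gI -> //]]]|ni].
by apply/esym/negbTE/negP => vi; apply: ni; exists i.
Qed.

Lemma measurable_depends B S (Q : (nat -> bool) -> Prop) :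
  (forall k, measurable [set w | B w k]) -> depends_on S Q -> measurable [set w | Q (B w)].
Proof.
move=> mB; elim: S Q => [|k S IHS] Q dQ.
  have [Q0|Q0] := pselect (Q (fun=> false)).
    rewrite (_ : [set w | _] = setT) //; apply/seteqP; split=> w //= _.
    by rewrite (dQ _ (fun=> false)).
  rewrite (_ : [set w | _] = set0) //; apply/seteqP; split=> w //=.
  by rewrite (dQ _ (fun=> false)).
have dv (c : bool) : depends_on S (fun b => Q (upd b k c)).
  move=> b b' bb'; apply: dQ => i; rewrite inE /upd.
  by case: eqP => //= _ /bb'.
have E (b : nat -> bool) : upd b k (b k) = b.
  by apply/funext => i; rewrite /upd; case: eqP => [->|].
rewrite (_ : [set w | _] =
  ([set w | B w k = true] `&` [set w | Q (upd (B w) k true)]) `|`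
  ([set w | B w k = false] `&` [set w | Q (upd (B w) k false)])).
  by apply: measurableU; apply: measurableI; [exact: measurable_coin|exact: (IHS _ (dv true))|
    exact: measurable_coin|exact: (IHS _ (dv false))].
apply/seteqP; split=> w /=.
  by rewrite -{1}[B w]E; case: (B w k); [left|right].
by rewrite -[X in _ -> Q X]E; case=> -[->].
Qed.

Lemma measurable_fun_depends B S (f : (nat -> bool) -> R) :
  (forall k, measurable [set w | B w k]) -> depends_on S f ->
  measurable_fun setT (fun w => f (B w)).
Proof.
move=> mB df _ A _; rewrite setTI.
apply: (@measurable_depends B S (fun b => A (f b)) mB) => b b' bb'.
by rewrite (df b b').
Qed.

(** Generalised to cylinders: [T] lists the coins already fixed, and each step moves a coin from
    [S'] to [T] by splitting the cylinder in two. *)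
Lemma integral_coins B S (f : (nat -> bool) -> R) b : fair_coins B -> uniq S ->
  depends_on S f -> (forall b, 0 <= f b) ->
  (\int[P]_w (f (B w))%:E = (avg S f b)%:E)%E.
Proof.
move=> [mB pB] uS df f0.
suff main S' T v : uniq (S' ++ T) -> depends_on (S' ++ T) f ->
    (\int[P]_(w in coin_cyl B T v) (f (B w))%:E = (2^-1 ^+ size T * avg S' f v)%:E)%E.
  have := @main S [::] b; rewrite cats0 expr0 mul1r => <- //.
  by congr integral; apply/seteqP.
elim: S' T v => [|k S' IHS'] T v uST dST.
  rewrite (eq_integral (fun=> (f v)%:E)); last first.
    by move=> w; rewrite inE => /allP wT; congr EFin; apply: dST => i /= /wT /eqP.
  rewrite integral_cst; last exact: measurable_coin_cyl.
  rewrite [X in (_ * X)%E](_ : _ = (pr P (coin_cyl B T v))%:E); last first.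
    by rewrite prE //; exact: measurable_coin_cyl.
  by rewrite pB // -EFinM mulrC.
have kT : k \notin T.
  by move: uST; rewrite /= mem_cat negb_or => /andP[/andP[]].
have uST' : uniq (S' ++ k :: T).
  by rewrite -[k :: T]cat1s (perm_uniq (permEl (perm_catCA S' [:: k] T))).
have dST' : depends_on (S' ++ k :: T) f.
  by apply: depends_on_sub dST => i; rewrite !(inE, mem_cat) orbCA.
have mf := measurable_fun_depends mB df.
have mc c : measurable (coin_cyl B (k :: T) c) by exact: measurable_coin_cyl.
have -> : coin_cyl B T v = coin_cyl B (k :: T) (upd v k false) `|` coin_cyl B (k :: T)
  (upd v k true).
  have E c w : coin_cyl B (k :: T) (upd v k c) w <-> B w k = c /\ coin_cyl B T v w.
    have ik i : i \in T -> (i == k) = false by move=> iT; apply: contraNF kT => /eqP <-.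
    by rewrite coin_cyl_cons /setI /= /upd eqxx; split=> -[-> H]; split=> //;
      rewrite /coin_cyl /=; apply/allP => i iT; move/allP: H => /(_ i iT); rewrite /upd ik.
  apply/seteqP; split=> w.
    by move=> wT; case Bk: (B w k); [right|left]; apply/E.
  by case=> /E[].
rewrite ge0_integral_setU //=; first last.
- apply/disj_setPS => w; rewrite !coin_cyl_cons /setI /= /upd eqxx.
  by move=> [[-> _] []].
- by move=> w _; rewrite lee_fin.
- by apply/measurable_EFinP; apply: measurable_funTS.
rewrite !IHS' // -EFinD /= exprS; congr EFin; lra.
Qed.

Lemma pr_coins B S (Q : (nat -> bool) -> Prop) b : fair_coins B -> uniq S ->
  depends_on S Q -> pr P [set w | Q (B w)] = avg S (fun b => (asbool (Q b))%:R) b.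
Proof.
move=> fB uS dQ; apply: EFin_inj.
have mQ : measurable [set w | Q (B w)] by apply: measurable_depends dQ; case: fB.
rewrite -(integral_coins _ fB uS) //; last by move=> b1 b2 bb; rewrite (dQ _ _ bb).
rewrite prE // -[X in P X]setIT -integral_indic //; exact: eq_integral.
Qed.

End coins.

Section coin_laws.
Context (R : realType).

Lemma fair_coins_exist : exists (d : measure_display) (Omega : measurableType d)
  (P : probability Omega R) (B : Omega -> nat -> bool), fair_coins P B.
Proof.
have [d [W [P [S [mS law]]]]] := @uniform_chain_exists R bool (fun=> [:: false; true])
  (fun=> isT) (fun=> isT) false.
(* The uniform chain on two states starts deterministically, so state 0 is dropped and coin k is
   state k + 1. *)
exists d, W, P, (fun w k => S k.+1 w); apply: fair_coins_prefix.
  by move=> k; exact: (mS k.+1 true).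
move=> n v.
pose y (i : nat) := if i is j.+1 then v j else false.
have := law n y; rewrite /y eqxx mul1r => lawn.
rewrite /pr -[RHS]/(fine (2^-1 ^+ n)%:E); congr fine.
have -> : ((2^-1 : R) ^+ n)%:E = (\prod_(i < n)
   ((v i \in [:: false; true])%:R / (size [:: false; true])%:R))%:E :> \bar R.
  rewrite (eq_bigr (fun=> 2^-1)); first by rewrite prodr_const card_ord.
  by move=> i _; rewrite !inE; case: (v i); rewrite /= mul1r.
rewrite -lawn.
have S0 : P (S 0%N @^-1` [set false]) = 1%E.
  have := law 0%N (fun=> false); rewrite eqxx big_ord0 mulr1 => <-.
  congr (P _); apply/seteqP; split=> w /=; first by move=> H [|i].
  by move=> /(_ 0%N isT).
have mc : measurable (coin_cyl (fun w k => S k.+1 w) (iota 0 n) v).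
  by apply: measurable_coin_cyl => k; exact: (mS k.+1 true).
have mS0 := mS 0%N false.
rewrite -prE // -[RHS]prE; last first.
  by apply: bigcap_measurableType => // i _; exact: mS.
congr EFin; rewrite (pr_split P mc mS0) [X in _ + X](_ : _ = 0) ?addr0; last first.
  apply/eqP; rewrite eq_le pr_ge0 andbT.
  apply: (@le_trans _ _ (pr P (~` (S 0%N @^-1` [set false])))).
    apply: pr_le; [|exact: measurableC|by move=> w []].
    by apply: measurableI => //; exact: measurableC.
  by rewrite prC // /pr S0 subrr.
congr pr; apply/seteqP; split=> w.
  move=> [/allP H S0w] [|i] //= ni; apply/eqP; apply: H.
  by rewrite mem_iota.
move=> H; split; last exact: (H 0%N).
by apply/allP => i; rewrite mem_iota /= add0n => ni; apply/eqP; exact: (H i.+1).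
Qed.

Context d1 (W1 : measurableType d1) (P1 : probability W1 R).
Context d2 (W2 : measurableType d2) (P2 : probability W2 R).

Lemma fair_coins_same_law B1 B2 S (Q : (nat -> bool) -> Prop) :
  fair_coins P1 B1 -> fair_coins P2 B2 -> uniq S -> depends_on S Q ->
  pr P1 [set w | Q (B1 w)] = pr P2 [set w | Q (B2 w)].
Proof.
by move=> f1 f2 uS dQ; rewrite (pr_coins (fun=> false) f1 uS dQ) (pr_coins (fun=> false) f2 uS dQ).
Qed.

End coin_laws.

(** * Random swaps and insertions *)

Section swap_fill_process.
Context (R : realType) (X : choiceType) (x : X).

Definition swap (u v : X) : X -> X :=
  fun y => if y == u then v else if y == v then u else y.

Lemma swapK u v : involutive (swap u v).
Proof.
move=> y; rewrite /swap; have [->|yu] := eqVneq y u.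
  by rewrite eqxx; case: eqVneq.
have [->|yv] := eqVneq y v; first by rewrite eqxx.
by rewrite (negbTE yu) (negbTE yv).
Qed.

Inductive op := Fill | Swap of X & X & nat.

Definition apply_op (o : op) (b : nat -> bool) (A : seq X) : seq X :=
  match o with
  | Fill => if x \in A then A else x :: A
  | Swap u v k => if b k then map (swap u v) A else A
  end.

(** The head of the list is executed last, so that inductions on the list peel off the most recent
    operation. *)
Definition exec (l : seq op) (b : nat -> bool) : seq X :=
  foldr (fun o A => apply_op o b A) [::] l.

Definition op_coins (o : op) : seq nat := if o is Swap _ _ k then [:: k] else [::].
Definition op_points (o : op) : seq X := if o is Swap u v _ then [:: u; v] else [:: x].
Definition coins_of (l : seq op) : seq nat := flatten (map op_coins l).

Lemma exec_uniq l b : uniq (exec l b).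
Proof.
elim: l => [|o l IHl] //=; case: o => [|u v k] /=.
  by case: ifPn => //= ->.
by case: ifP => // _; rewrite map_inj_uniq //; exact: inv_inj (swapK u v).
Qed.

Lemma exec_depends l : depends_on (coins_of l) (exec l).
Proof.
elim: l => [|o l IHl] b b' bb' //=.
have -> : exec l b = exec l b'.
  by apply: IHl => i il; apply: bb'; rewrite /coins_of /= mem_cat il orbT.
case: o bb' => [|u v k] bb' //=.
by rewrite bb' // /coins_of /= mem_head.
Qed.

Definition occupation (l : seq op) (y : X) : R :=
  avg (coins_of l) (fun b => (y \in exec l b)%:R) (fun=> false).

Definition weight (l : seq op) (h : X -> R) : R :=
  avg (coins_of l) (fun b => \prod_(y <- exec l b) h y) (fun=> false).

Lemma avg_coins_cons o l (f : (nat -> bool) -> R) :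
  uniq (coins_of (o :: l)) -> depends_on (coins_of (o :: l)) f ->
  avg (coins_of (o :: l)) f (fun=> false) =
  if o is Swap u v k then
    (avg (coins_of l) (fun b => f (upd b k false)) (fun=> false) +
     avg (coins_of l) (fun b => f (upd b k true)) (fun=> false)) / 2
  else avg (coins_of l) f (fun=> false).
Proof.
case: o => [|u v k] //= /andP[kl ul] df.
have H c : avg (coins_of l) f (upd (fun=> false) k c) =
    avg (coins_of l) (fun b => f (upd b k c)) (fun=> false).
  rewrite -(@avg_depends _ (coins_of l) [::] _ (upd (fun=> false) k c)) //.
    apply: avg_ext => b bE; congr f; apply/funext => i; rewrite /upd.
    by case: eqP => // ->; rewrite bE // /upd eqxx.
  rewrite cats0 => b b' bb'; apply: df => i.
  rewrite /coins_of /= inE /upd; case: eqP => //= _; exact: bb'.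
by rewrite !H.
Qed.

(** After an insertion [x] is present exactly once; setting [h] to 1 at [x] erases the factor of a
    possible earlier presence. *)
Lemma weight_cons o l h : uniq (coins_of (o :: l)) ->
  weight (o :: l) h =
  if o is Swap u v k then (weight l h + weight l (h \o swap u v)) / 2
  else h x * weight l (fun y => if y == x then 1 else h y).
Proof.
move=> ul; rewrite /weight avg_coins_cons //; last first.
  by move=> b b' bb'; rewrite (exec_depends bb').
case: o ul => [|u v k] ul.
  rewrite -avgZ; apply: avg_ext => b _ /=.
  have -> : \prod_(y <- if x \in exec l b then exec l b else x :: exec l b) h y =
      h x * \prod_(y <- exec l b | y != x) h y.
    case: ifPn => xl; first by rewrite (bigD1_seq x) //=; exact: exec_uniq.
    rewrite big_cons; congr (_ * _); rewrite big_seq [RHS]big_seq_cond.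
    by apply: eq_bigl => y; case: eqVneq => [->|]; rewrite ?(negbTE xl) ?andbT.
  congr (_ * _); rewrite big_mkcond; apply: eq_bigr => y _.
  by case: eqP.
have kl : k \notin coins_of l by move: ul => /= /andP[].
have updE b c : exec l (upd b k c) = exec l b.
  apply: exec_depends => i il; rewrite /upd; case: eqP => // ik.
  by rewrite ik (negbTE kl) in il.
congr ((_ + _) / _); apply: avg_ext => b _ /=; rewrite updE /upd eqxx //.
by rewrite big_map.
Qed.

Lemma occupation_cons o l y : uniq (coins_of (o :: l)) ->
  occupation (o :: l) y =
  if o is Swap u v k then (occupation l y + occupation l (swap u v y)) / 2
  else if y == x then 1 else occupation l y.
Proof.
move=> ul; rewrite /occupation avg_coins_cons //; last first.
  by move=> b b' bb'; rewrite (exec_depends bb').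
case: o ul => [|u v k] ul.
  have [->|yx] := eqVneq y x.
    rewrite -[RHS](avg_cst (coins_of l) 1 (fun=> false)); apply: avg_ext => b _ /=.
    by case: ifP => [->|]; rewrite ?mem_head.
  apply: avg_ext => b _ /=; case: ifP => // _.
  by rewrite inE (negbTE yx).
have kl : k \notin coins_of l by move: ul => /= /andP[].
have updE b c : exec l (upd b k c) = exec l b.
  apply: exec_depends => i il; rewrite /upd; case: eqP => // ik.
  by rewrite ik (negbTE kl) in il.
congr ((_ + _) / _); apply: avg_ext => b _ /=; rewrite updE /upd eqxx //.
by rewrite -{1}(swapK u v y) mem_map //; exact: inv_inj (swapK u v).
Qed.

Lemma occupation01 l y : 0 <= occupation l y <= 1.
Proof.
apply/andP; split.
  by rewrite -(avg_cst (coins_of l) 0 (fun=> false)); apply: avg_le => b; rewrite ler0n.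
rewrite -[leRHS](avg_cst (coins_of l) 1 (fun=> false)); apply: avg_le => b.
by rewrite lern1 leq_b1.
Qed.

(** The two sides are in fact equal: [p * q] differs from the square of the mean by
    [(p - q)^2 / 4]. *)
Lemma product_two_swap (p q a c : R) :
  ((1 - p * a) * (1 - q * c) + (1 - q * a) * (1 - p * c)) / 2 <=
    (1 - (p + q) / 2 * a) * (1 - (p + q) / 2 * c) + (p - q) ^+ 2 / 4 * - (a * c).
Proof. lra. Qed.

(* Averaging the two configurations of a swap replaces the densities p, q at its
   endpoints by their mean, which increases their product. *)
Theorem weight_le l (V : seq X) (h : X -> R) : uniq (coins_of l) -> uniq V ->
  {subset flatten (map op_points l) <= V} -> (forall y, 0 <= h y <= 1) ->
  weight l h <= \prod_(y <- V) (1 - occupation l y * (1 - h y)).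
Proof.
move=> + uV; elim: l h => [|o l IHl] h ul lV h01.
  rewrite /weight /= big_nil big1 // => y _.
  by rewrite /occupation /= mul0r subr0.
have ul' : uniq (coins_of l) by move: ul; rewrite /coins_of /= cat_uniq => /and3P[].
have lV' : {subset flatten (map op_points l) <= V}.
  by move=> y yl; apply: lV; rewrite /= mem_cat yl orbT.
rewrite weight_cons //.
have oV : {subset op_points o <= V} by move=> y yo; apply: lV; rewrite /= mem_cat yo.
have occE y := occupation_cons y ul.
have occ01 y := occupation01 l y.
case: o ul lV oV occE => [|u v k] ul lV oV occE.
  have xV : x \in V by apply: oV; rewrite mem_head.
  have hh y : 0 <= (if y == x then 1 else h y) <= 1.
    by case: ifP => // _; rewrite ler01 lexx.
  apply: (@le_trans _ _ (h x * \prod_(y <- V) (1 - occupation l y * (1 - (if y == x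
    then 1 else h y))))).
    by apply: ler_wpM2l; [case/andP: (h01 x)|exact: IHl].
  rewrite (bigD1_seq x) //= eqxx subrr mulr0 subr0 mul1r.
  rewrite [leRHS](bigD1_seq x) //= occE eqxx mul1r subKr.
  rewrite le_eqVlt; apply/orP; left; apply/eqP; congr (_ * _).
  by apply: eq_bigr => y /negbTE yx; rewrite occE yx.
pose sw := swap u v.
have uV' : u \in V by apply: oV; rewrite mem_head.
have vV' : v \in V by apply: oV; rewrite !inE eqxx orbT.
(* Condition on the coin of the swap and apply the induction hypothesis to [h] and to
   [h \o swap u v]; as [V] is stable under the swap, reindexing moves the swap from [h] to the
   densities. *)
apply: (@le_trans _ _ ((\prod_(y <- V) (1 - occupation l y * (1 - h y)) +
   \prod_(y <- V) (1 - occupation l (sw y) * (1 - h y))) / 2)).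
  rewrite ler_pM2r //; apply: lerD; first exact: IHl.
  apply: le_trans (IHl (h \o sw) ul' lV' (fun y => h01 (sw y))) _.
  rewrite le_eqVlt; apply/orP; left; apply/eqP.
  rewrite (perm_big (map sw V)) /=.
    by rewrite big_map; apply: eq_bigr => y _; rewrite /sw swapK.
  apply: uniq_perm => //; first by rewrite map_inj_uniq //; exact: inv_inj (swapK u v).
  have swV y : y \in V -> sw y \in V.
    by rewrite /sw /swap; case: eqP => // _; case: eqP.
  move=> y; apply/idP/mapP => [yV|[z zV ->]]; last exact: swV.
  by exists (sw y); rewrite ?swV // /sw swapK.
(* A degenerate swap does nothing; it is set apart because the factors at [u] and [v] are extracted
   separately below. *)
have [uv|uv] := eqVneq u v.
  have swE y : sw y = y by rewrite /sw /swap uv; case: eqP => [->|_] //; case: eqP.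
  rewrite le_eqVlt; apply/orP; left; apply/eqP.
  rewrite -[RHS](mulfK (x := 2)) // mulr_natr mulr2n; congr ((_ + _) / _);
    apply: eq_bigr => y _; rewrite occE -/sw ?swE; congr (1 - _ * _); lra.
have vu : v != u by rewrite eq_sym.
have vV'' : v \in rem u V by rewrite mem_rem_uniq // !inE vu.
have decomp F : \prod_(y <- V) F y = F u * F v * \prod_(y <- V | (y != u) && (y != v)) F y :> R.
  rewrite (bigD1_seq u) //= -big_filter (bigD1_seq v) ?filter_uniq ?mem_filter ?vu //=.
  rewrite big_filter_cond mulrA; congr (_ * _).
rewrite !decomp.
have swu : sw u = v by rewrite /sw /swap eqxx.
have swv : sw v = u by rewrite /sw /swap (negbTE vu) eqxx.
have swE y : (y != u) && (y != v) -> sw y = y.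
  by move=> /andP[/negbTE yu /negbTE yv]; rewrite /sw /swap yu yv.
rewrite [X in _ + _ * _ * X](eq_bigr (fun y => 1 - occupation l y * (1 - h y))); last first.
  by move=> y /swE ->.
rewrite [X in _ <= _ * _ * X](eq_bigr (fun y => 1 - occupation l y * (1 - h y))); last first.
  move=> y /swE yE; rewrite occE -/sw yE.
  by have -> : (occupation l y + occupation l y) / 2 = occupation l y by lra.
rewrite -mulrDl -mulrAC; apply: ler_wpM2r.
  apply: prodr_ge0 => y _; have := occ01 y; have := h01 y.
  by move=> /andP[h0 h1] /andP[p0 p1]; rewrite subr_ge0 mulr_ile1 // ?subr_ge0 // lerBlDr lerDl.
rewrite !occE -/sw swu swv [occupation l v + _]addrC.
apply: le_trans (product_two_swap _ _ _ _) _.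
rewrite gerDl mulr_ge0_le0 //; first by rewrite divr_ge0 // sqr_ge0.
have /andP[_ hu] := h01 u; have /andP[_ hv] := h01 v.
by rewrite oppr_le0 mulr_ge0 // subr_ge0.
Qed.

(** Take [h = 1/2], bound each factor by [1 - rho / 2 <= expR (- (rho / 2))], and note that the
    densities sum to the expected size. *)
Corollary half_weight_le l (V : seq X) : uniq (coins_of l) -> uniq V ->
  {subset flatten (map op_points l) <= V} ->
  (forall b, {subset exec l b <= V}) ->
  avg (coins_of l) (fun b => (2^-1 : R) ^+ size (exec l b)) (fun=> false) <=
  expR (- (avg (coins_of l) (fun b => (size (exec l b))%:R) (fun=> false) / 2)).
Proof.
move=> ul uV lV eV.
have -> : avg (coins_of l) (fun b => (2^-1 : R) ^+ size (exec l b)) (fun=> false) =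
    weight l (fun=> 2^-1).
  apply: avg_ext => b _; rewrite big_const_seq count_predT.
  by rewrite -Monoid.iteropE.
apply: (le_trans (weight_le ul uV lV _)).
  by move=> y; apply/andP; split; lra.
have -> : avg (coins_of l) (fun b => (size (exec l b))%:R) (fun=> false) =
    \sum_(y <- V) occupation l y.
  rewrite -avg_sum; apply: avg_ext => b _.
  rewrite -natr_sum -sum1_size; congr _%:R.
  rewrite (_ : (\sum_(i <- V) (i \in exec l b) = \sum_(i <- V | i \in exec l b) 1)%N); last first.
    by rewrite [RHS]big_mkcond; apply: eq_bigr => y _; case: (y \in _).
  rewrite -[RHS]big_filter; apply: perm_big; apply: uniq_perm.
  - exact: exec_uniq.
  - exact: filter_uniq.
  - move=> y; rewrite mem_filter; apply/idP/andP => [ye|[]//].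
    by split=> //; exact: (eV b).
rewrite mulr_suml -sumrN expR_sum; apply: ler_prod => y _.
have /andP[p0 p1] := occupation01 l y; apply/andP; split; first by lra.
by apply: le_trans (expR_ge1Dx _); lra.
Qed.

End swap_fill_process.

(** * Random products of swaps *)

Definition code (i j : nat) : nat := @choice.pickle (nat * nat)%type (i, j).

Lemma code_inj i j i' j' : code i j = code i' j' -> i = i' /\ j = j'.
Proof. by move=> /(pcan_inj (@choice.pickleK (nat * nat)%type)) []. Qed.

Lemma code_inj2 i : injective (code i).
Proof. by move=> j j' /code_inj []. Qed.

Section layered_swaps.
Variables (X : choiceType) (e : X -> nat) (L : nat) (m : nat -> X -> X).
Hypotheses (e_inj : injective e) (mK : forall l, involutive (m l)).

(* The matchings are used in the order 0, .., L - 1, L - 1, .., 0: reversing the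
   order of the layers then amounts to a permutation of the coins. *)
Definition partner (l : nat) : X -> X := m (minn l (L.*2.-1 - l)).

Lemma partnerK l : involutive (partner l).
Proof. exact: mK. Qed.

(** An edge is named by the smaller code of its endpoints, so both endpoints consult the same coin;
    the index [l] keeps the coins of mirrored layers distinct. *)
Definition coin_at (l : nat) (y : X) : nat := code l (minn (e y) (e (partner l y))).

Lemma coin_at_partner l y : coin_at l (partner l y) = coin_at l y.
Proof. by rewrite /coin_at partnerK minnC. Qed.

Definition layer (l : nat) (b : nat -> bool) (y : X) : X :=
  if b (coin_at l y) then partner l y else y.

Lemma layerK l b : involutive (layer l b).
Proof.
move=> y; rewrite /layer; case bl: (b (coin_at l y)); last by rewrite bl.
by rewrite coin_at_partner bl partnerK.
Qed.

Definition layers (ls : seq nat) (b : nat -> bool) : X -> X :=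
  foldr (fun l f => layer l b \o f) id ls.

Lemma layers_cat ls ls' b y : layers (ls ++ ls') b y = layers ls b (layers ls' b y).
Proof. by elim: ls => //= l ls ->. Qed.

Lemma layers_revK ls b : cancel (layers ls b) (layers (rev ls) b).
Proof.
elim: ls => [|l ls IHls] y //=.
by rewrite rev_cons -cats1 layers_cat /= layerK IHls.
Qed.

Lemma layers_bij ls b : bijective (layers ls b).
Proof.
exists (layers (rev ls) b); first exact: layers_revK.
by rewrite -{2}[ls]revK; exact: layers_revK.
Qed.

Definition random_perm (b : nat -> bool) : symgroup X :=
  mk_perm (layers_bij (iota 0 L.*2) b).

Lemma random_permE b : perm_fun (random_perm b) = layers (iota 0 L.*2) b.
Proof. by []. Qed.

Lemma preperm_random_perm b y :
  preperm (random_perm b) y = layers (rev (iota 0 L.*2)) b y.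
Proof.
by apply/preperm_eq; rewrite random_permE -{1}[iota _ _]revK layers_revK.
Qed.

(** Relabelling of the coins that exchanges the layers l and 2L - 1 - l. Those layers have the same
    partners, so inverting the permutation amounts to this relabelling. *)
Definition mirror (i : nat) : nat :=
  if @choice.pickle_inv (nat * nat)%type i is Some (l, k) then
    if (l < L.*2)%N then code (L.*2.-1 - l) k else i
  else i.

Lemma mirrorE l k : (l < L.*2)%N -> mirror (code l k) = code (L.*2.-1 - l) k.
Proof. by move=> lL; rewrite /mirror /code choice.pickleK_inv lL. Qed.

Lemma mirror_inj : injective mirror.
Proof.
have mi : involutive mirror.
  move=> i; rewrite {2}/mirror; case F: (choice.pickle_inv i) => [[l k]|]; last first.
    by rewrite /mirror F.
  case: ifPn => lL; last by rewrite /mirror F (negbTE lL).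
  rewrite mirrorE; last by lia.
  have -> : (L.*2.-1 - (L.*2.-1 - l) = l)%N by lia.
  by have := @choice.pickle_invK (nat * nat)%type i; rewrite F.
exact: inv_inj mi.
Qed.

Lemma layer_mirror l b y : (l < L.*2)%N ->
  layer (L.*2.-1 - l) b y = layer l (fun i => b (mirror i)) y.
Proof.
move=> lL; have pE : partner (L.*2.-1 - l) = partner l.
  by rewrite /partner; congr m; lia.
by rewrite /layer /coin_at mirrorE // pE.
Qed.

Lemma rev_iotaE n : rev (iota 0 n) = [seq (n.-1 - l)%N | l <- iota 0 n].
Proof.
apply: (@eq_from_nth _ 0%N); first by rewrite size_rev size_map.
move=> i; rewrite size_rev size_iota => i_n.
rewrite nth_rev ?size_iota // (nth_map 0%N) ?size_iota // !nth_iota //; lia.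
Qed.

Lemma perm_inv_random_perm b :
  perm_inv (random_perm b) = random_perm (fun i => b (mirror i)).
Proof.
apply: perm_ext => y; rewrite random_permE /perm_inv mk_permE preperm_random_perm.
rewrite rev_iotaE.
have : {in iota 0 L.*2, forall l, (l < L.*2)%N} by move=> l; rewrite mem_iota.
elim: (iota 0 L.*2) => [|l ls IHls] lsL //=.
rewrite IHls; last by move=> k kl; apply: lsL; rewrite inE kl orbT.
by rewrite layer_mirror // lsL // mem_head.
Qed.

Fixpoint visits (ls : seq nat) (z : X) : seq X :=
  if ls is l :: ls' then visits ls' z ++ map (partner l) (visits ls' z) else [:: z].

Fixpoint visit_coins (ls : seq nat) (z : X) : seq nat :=
  if ls is l :: ls' then visit_coins ls' z ++ map (coin_at l) (visits ls' z) else [::].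

Lemma layers_visits ls b z : layers ls b z \in visits ls z.
Proof.
elim: ls => [|l ls IHls] /=; first by rewrite mem_head.
by rewrite mem_cat /layer; case: ifP => _; rewrite ?IHls ?map_f ?orbT.
Qed.

Lemma layers_depends ls z : depends_on (visit_coins ls z) (fun b => layers ls b z).
Proof.
elim: ls => [|l ls IHls] b b' bb' //=.
rewrite (IHls _ b'); last by move=> i il; apply: bb'; rewrite /= mem_cat il.
rewrite /layer bb' //= mem_cat; apply/orP; right; apply: map_f.
exact: layers_visits.
Qed.

Lemma layers_off ls b z : all (fun l => ~~ b (coin_at l z)) ls -> layers ls b z = z.
Proof.
elim: ls => [|l ls IHls] //= /andP[bl /IHls ->].
by rewrite /layer (negbTE bl).
Qed.

(** Layers act from the highest index down: [y] waits until layer [l], crosses the edge there, and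
    the layers below [l] must leave the new position alone. *)
Lemma random_perm_edge (l : nat) (y : X) (b : nat -> bool) : (l < L)%N ->
  {in iota 0 l, forall k, ~~ b (coin_at k (m l y))} -> b (coin_at l y) ->
  {in iota l.+1 (L.*2 - l.+1), forall k, ~~ b (coin_at k y)} ->
  perm_fun (random_perm b) y = m l y.
Proof.
move=> lL b1 b2 b3.
have iE : iota 0 L.*2 = iota 0 l ++ l :: iota l.+1 (L.*2 - l.+1).
  rewrite -[l :: _]/(iota l (L.*2 - l.+1).+1).
  by rewrite -{2}[l]add0n -iotaD; congr iota; lia.
rewrite random_permE iE layers_cat /=.
rewrite [layers (iota l.+1 _) b y]layers_off; last by apply/allP.
have pE : partner l y = m l y by rewrite /partner; congr m; lia.
rewrite {1}/layer b2 pE.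
by rewrite layers_off //; apply/allP.
Qed.

Variable (x : X).

Fixpoint ball (i : nat) : seq X :=
  if i is j.+1 then
    ball j ++ flatten [seq map (partner l) (ball j) | l <- iota 0 L.*2]
  else [:: x].

Lemma ball_le i j : (i <= j)%N -> {subset ball i <= ball j}.
Proof.
move=> /subnKC <-; elim: (j - i)%N => [|k IHk] y yi; first by rewrite addn0.
by rewrite addnS /= mem_cat IHk.
Qed.

Lemma ball_partner i l y : (l < L.*2)%N -> y \in ball i -> partner l y \in ball i.+1.
Proof.
move=> lL yi; rewrite /= mem_cat; apply/orP; right; apply/flattenP.
exists (map (partner l) (ball i)); last exact: map_f.
by apply/mapP; exists l => //; rewrite mem_iota.
Qed.

(** The strict inequality keeps one swap per edge and drops the fixed points of the matching. *)
Definition layer_ops (V : seq X) (j l : nat) : seq (op X) :=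
  [seq Swap y (partner l y) (code j (coin_at l y)) | y <- V & (e y < e (partner l y))%N].

Let rep l z := if (e z < e (partner l z))%N then z else partner l z.

(** The swaps of a layer have disjoint supports, so a point [z] is affected only by the swap listed
    under [rep l z], the endpoint with the smaller code. *)
Lemma exec_layer_ops V j l b (A : seq X) : uniq V ->
  foldr (fun o A => apply_op x o b A) A (layer_ops V j l) =
  [seq if (rep l z \in V) && b (code j (coin_at l z)) then partner l z else z | z <- A].
Proof.
elim: V => [|y V IHV] /=; first by rewrite map_id.
move=> /andP[yV uV]; rewrite /layer_ops /=.
have repE z : z != partner l z -> (rep l z == y) = (e y < e (partner l y))%N && ((z ==
  y) || (z == partner l y)).
  move=> zp; rewrite /rep; case: ltngtP => [ez|ez|/e_inj ez]; last by rewrite -ez eqxx in zp.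
    case: (eqVneq z y) => [<-|_] /=; first by rewrite ez.
    case: (eqVneq z (partner l y)) => [zpy|_]; rewrite ?andbF //.
    by rewrite zpy partnerK in ez; rewrite ltnNge (ltnW ez).
  have -> : (partner l z == y) = (z == partner l y).
    by apply/eqP/eqP => [<-|->]; rewrite partnerK.
  case: (eqVneq z (partner l y)) => [zpy|_] /=.
    by rewrite zpy partnerK in ez; rewrite ez orbT.
  by case: (eqVneq z y) => [zy|_]; rewrite ?andbF // -zy ltnNge (ltnW ez).
case: ifPn => ey /=; last first.
  rewrite -/(layer_ops V j l) IHV //; apply: eq_map => z.
  have [<-|zp] := eqVneq z (partner l z); first by rewrite !if_same.
  by rewrite inE repE // (negbTE ey).
rewrite -/(layer_ops V j l) IHV //.
set f := fun z => if (rep l z \in V) && _ then _ else _.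
have main z : (if b (code j (coin_at l y)) then swap y (partner l y) (f z) else f z) =
    if (rep l z \in y :: V) && b (code j (coin_at l z)) then partner l z else z.
  have [zp|zp] := eqVneq z (partner l z).
    rewrite /f -zp !if_same /swap; case: ifP => // _; case: eqP => zy.
      by rewrite -zy -zp.
    by case: eqP => // zy'; rewrite [RHS]zp zy' partnerK.
  rewrite inE repE // ey /=.
  have [zy|zy] /= := boolP ((z == y) || (z == partner l y)).
    have rz : rep l z = y by apply/eqP; rewrite repE // ey.
    rewrite /f rz (negbTE yV) /=.
    have cz : coin_at l z = coin_at l y.
      by case/orP: (zy) => /eqP ->; rewrite ?coin_at_partner.
    rewrite cz; case: ifP => // _; rewrite /swap.
    case/orP: (zy) => /eqP zE; rewrite zE ?eqxx ?partnerK //.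
    case: eqP => [->|_] //; by rewrite zE partnerK eq_sym in zp => //; case: eqP.
  move: zy; rewrite negb_or => /andP[zy zpy].
  have pz1 : partner l z != y by apply: contraNneq zpy => <-; rewrite partnerK.
  have pz2 : partner l z != partner l y by rewrite (inj_eq (inv_inj (partnerK l))).
  rewrite /f; case: ifP => _; case: ifP => // _; rewrite /swap.
    by rewrite (negbTE pz1) (negbTE pz2).
  by rewrite (negbTE zy) (negbTE zpy).
rewrite -(eq_map main); case: ifP => // _.
by rewrite -map_comp.
Qed.

Lemma exec_layer V j l b i M (A : seq X) : (i < M)%N -> V = undup (ball M) ->
  (l < L.*2)%N -> {subset A <= ball i} ->
  foldr (fun o A => apply_op x o b A) A (layer_ops V j l) =
    map (layer l (fun k => b (code j k))) A /\
  {subset map (layer l (fun k => b (code j k))) A <= ball i.+1}.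
Proof.
move=> iM -> lL Ai; split.
  rewrite exec_layer_ops ?undup_uniq //; apply/eq_in_map => z /Ai zi.
  rewrite mem_undup /layer.
  suff -> : rep l z \in ball M by [].
  rewrite /rep; case: ifP => _; first exact: ball_le (ltnW iM) _ zi.
  by apply: (ball_le iM); exact: ball_partner.
move=> _ /mapP[z /Ai zi ->]; rewrite /layer; case: ifP => _.
  exact: ball_partner.
by apply: ball_le zi.
Qed.

(** With the head executed last, the reversed list runs layer 0 first: this is the inverse
    permutation, as an inverted orbit requires. *)
Definition step_ops (V : seq X) (j : nat) : seq (op X) :=
  flatten [seq layer_ops V j l | l <- rev (iota 0 L.*2)].

Lemma exec_step V j b i M (A : seq X) : (i + L.*2 <= M)%N -> V = undup (ball M) ->
  {subset A <= ball i} ->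
  foldr (fun o A => apply_op x o b A) A (step_ops V j) =
    map (preperm (random_perm (fun k => b (code j k)))) A /\
  {subset map (preperm (random_perm (fun k => b (code j k)))) A <= ball (i + L.*2)}.
Proof.
move=> iM VE Ai; rewrite /step_ops.
rewrite (eq_map (preperm_random_perm _)).
have lsL : {in rev (iota 0 L.*2), forall l, (l < L.*2)%N} by move=> l; rewrite mem_rev mem_iota.
have -> : (i + L.*2 = i + size (rev (iota 0 L.*2)))%N by rewrite size_rev size_iota.
have {iM} : (i + size (rev (iota 0 L.*2)) <= M)%N by rewrite size_rev size_iota.
elim: (rev (iota 0 L.*2)) lsL => [|l ls IHls] lsL iM /=.
  by rewrite map_id addn0.
have [||IH1 IH2] := IHls.
- by move=> k kl; apply: lsL; rewrite inE kl orbT.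
- by apply: leq_trans iM; rewrite leq_add2l /=.
rewrite foldr_cat IH1.
have [||H1 H2] := @exec_layer V j l b (i + size ls) M _ _ VE _ IH2.
- by apply: leq_trans iM; rewrite /= addnS.
- by apply: lsL; rewrite mem_head.
rewrite -map_comp in H1 H2.
by split; [exact: H1|rewrite addnS; exact: H2].
Qed.

Fixpoint orbit_ops (V : seq X) (j n : nat) : seq (op X) :=
  if n is n'.+1 then Fill X :: step_ops V j ++ orbit_ops V j.+1 n' else [:: Fill X].

Fixpoint walk_from (j n : nat) (b : nat -> bool) (v : X) : X :=
  if n is n'.+1 then
    walk_from j.+1 n' b (perm_fun (random_perm (fun k => b (code j k))) v)
  else v.

(** Splitting off the first step of the walk, the points that reach [x] from time j on are [x] and
    the preimages of those that do so from time j + 1. Each step widens the set by at most 2L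
    layers, so a finite ball suffices. *)
Lemma exec_orbit V M j n b : (n * L.*2 <= M)%N -> V = undup (ball M) ->
  {subset exec x (orbit_ops V j n) b <= ball (n * L.*2)} /\
  forall v, (v \in exec x (orbit_ops V j n) b) <->
    exists2 i, (i <= n)%N & walk_from j i b v = x.
Proof.
move=> nM VE; elim: n j nM => [|n IHn] j nM.
  split=> v; rewrite /= inE => //.
  split=> [/eqP ->|[i]]; first by exists 0%N.
  by rewrite leqn0 => /eqP -> /= ->.
have nM' : (n * L.*2 <= M)%N by apply: leq_trans nM; rewrite mulSn leq_addl.
have [IH1 IH2] := IHn j.+1 nM'.
have [|H1 H2] := @exec_step V j b (n * L.*2) M _ _ VE IH1.
  by rewrite addnC -mulSn.
have E : exec x (orbit_ops V j n.+1) b =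
    apply_op x (Fill X) b [seq preperm (random_perm (fun k => b (code j k))) i | i <-
      exec x (orbit_ops V j.+1 n) b].
  by rewrite /exec /= foldr_cat -H1.
have memE v : (v \in exec x (orbit_ops V j n.+1) b) =
    (v == x) || (perm_fun (random_perm (fun k => b (code j k))) v \in exec x (orbit_ops
      V j.+1 n) b).
  set sg := random_perm _ in E H1 H2 *.
  have mE : (v \in [seq preperm sg i | i <- exec x (orbit_ops V j.+1 n) b]) =
      (perm_fun sg v \in exec x (orbit_ops V j.+1 n) b).
    by rewrite -{1}(permK sg v) mem_map //; exact: (can_inj (prepermK sg)).
  rewrite E /= -mE; case: ifPn => xA; last by rewrite inE.
  by case: eqVneq => [->|//]; rewrite xA.
split=> v.
  rewrite memE => /orP[/eqP ->|vA].
    by apply: (@ball_le 0); rewrite //= mem_head.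
  rewrite mulSn addnC; apply: H2; apply/mapP; eexists; first exact: vA.
  by rewrite permK.
rewrite memE; split=> [/orP[/eqP ->|/IH2[i i_n vi]]|[[|i] i_n vi]].
- by exists 0%N.
- by exists i.+1.
- by rewrite -vi eqxx.
- by apply/orP; right; apply/IH2; exists i.
Qed.

Lemma walk_fromS j n b v : walk_from j n.+1 b v =
  perm_fun (random_perm (fun k => b (code (j + n) k))) (walk_from j n b v).
Proof.
elim: n j v => [|n IHn] j v; first by rewrite addn0.
by rewrite -[LHS]/(walk_from j.+1 n.+1 b _) IHn addSnnS.
Qed.

Lemma mem_layer_coins V j l k : k \in coins_of (layer_ops V j l) ->
  exists i, k = code j (code l i).
Proof.
rewrite /coins_of /layer_ops -map_comp => /flattenP[s /mapP[y _ ->]].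
by rewrite inE => /eqP ->; eexists.
Qed.

Lemma mem_step_coins V j k : k \in coins_of (step_ops V j) -> exists i, k = code j i.
Proof.
rewrite /step_ops /coins_of map_flatten -map_comp.
elim: (rev _) => [|l ls IHls] //=; rewrite flatten_cat mem_cat => /orP[/mem_layer_coins
  [i ->]|/IHls //].
by eexists.
Qed.

Lemma mem_orbit_coins V j n k : k \in coins_of (orbit_ops V j n) ->
  exists i i', [/\ (j <= i)%N & k = code i i'].
Proof.
elim: n j => [|n IHn] j //; rewrite /coins_of /= map_cat flatten_cat mem_cat => /orP[].
  by move=> /mem_step_coins [i ->]; exists j, i.
by move=> /IHn [i [i' [ji ->]]]; exists i, i'; split=> //; exact: ltnW.
Qed.

Lemma uniq_layer_coins V j l : uniq V -> uniq (coins_of (layer_ops V j l)).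
Proof.
move=> uV; rewrite /coins_of /layer_ops -map_comp.
have -> : flatten [seq (@op_coins X \o (fun y => Swap y (partner l y) (code j (coin_at l y)))) y
     | y <- V & (e y < e (partner l y))%N] =
   [seq code j (coin_at l y) | y <- V & (e y < e (partner l y))%N].
  by elim: [seq y <- V | (e y < e (partner l y))%N] => //= y s ->.
rewrite map_inj_in_uniq ?filter_uniq // => y z; rewrite !mem_filter.
move=> /andP[ey _] /andP[ez _] /code_inj [_] /code_inj [_].
by rewrite !(minn_idPl _) ?(ltnW ey) ?(ltnW ez) // => /e_inj.
Qed.

Lemma uniq_step_coins V j : uniq V -> uniq (coins_of (step_ops V j)).
Proof.
move=> uV; rewrite /step_ops /coins_of map_flatten -map_comp.
have : uniq (rev (iota 0 L.*2)) by rewrite rev_uniq iota_uniq.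
elim: (rev _) => [|l ls IHls] //= /andP[lls uls]; rewrite flatten_cat cat_uniq.
rewrite (uniq_layer_coins j l uV) IHls // andbT /=; apply/hasPn => k kls.
apply/negP => /mem_layer_coins [i ki].
move: kls; rewrite ki => {IHls uls}; elim: ls lls => [|l' ls IHls] //=.
rewrite inE negb_or => /andP[ll' lls]; rewrite flatten_cat mem_cat => /orP[|/IHls]; last exact.
by move=> /mem_layer_coins [i' /code_inj [_ /code_inj [ll _]]]; rewrite ll eqxx in ll'.
Qed.

Lemma uniq_orbit_coins V j n : uniq V -> uniq (coins_of (orbit_ops V j n)).
Proof.
move=> uV; elim: n j => [|n IHn] j //.
rewrite /coins_of /= map_cat flatten_cat cat_uniq (uniq_step_coins j uV) IHn andbT /=.
apply/hasPn => k /mem_orbit_coins [i [i' [ji ->]]]; apply/negP.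
by move=> /mem_step_coins [i'' /code_inj [ij _]]; rewrite ij ltnn in ji.
Qed.

End layered_swaps.

(** * Independence *)

Section independence_extension.
Context (R : realType) (X : choiceType) (X_countable : countable [set: X]).
Context d (Omega : measurableType d) (P : probability Omega R).
Variable s : nat -> {RV P >-> borel_symgroup X}.

Lemma bigcap_seq_cons T (I : eqType) (i : I) (J : seq I) (F : I -> set T) :
  \bigcap_(k in [set` i :: J]) F k = F i `&` \bigcap_(k in [set` J]) F k.
Proof.
apply/seteqP; split=> w.
  move=> H; split; first by apply: H; rewrite /= mem_head.
  by move=> k kJ; apply: H; rewrite /= inE kJ orbT.
by move=> [H1 H2] k; rewrite /= inE => /orP[/eqP -> //|]; exact: H2.
Qed.

Lemma measurable_RV_preimage j (A : set (borel_symgroup X)) : measurable A ->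
  measurable (s j @^-1` A).
Proof. by move=> mA; rewrite -[_ @^-1` _]setTI; exact: measurable_funPT. Qed.

Let joint (J : seq nat) (A : nat -> set (borel_symgroup X)) := \bigcap_(j in [set` J])
  (s j @^-1` A j).

Let mjoint J A : (forall j, measurable (A j)) -> measurable (joint J A).
Proof.
move=> mA; rewrite /joint; elim: J => [|j J IHJ].
  by rewrite (_ : [set` [::]] = set0) ?bigcap_set0 //; apply/seteqP; split.
by rewrite bigcap_seq_cons; apply: measurableI => //; exact: measurable_RV_preimage.
Qed.

(** A pi-lambda argument in one coordinate; the empty cylinder identifies [c] as the probability of
    [C]. *)
Lemma extend_product (C : set Omega) (c : R) j : measurable C ->
  (forall l, pr P (s j @^-1` cylinder l `&` C) = pr P (s j @^-1` cylinder l) * c) ->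
  forall A, measurable A -> pr P (s j @^-1` A `&` C) = pr P (s j @^-1` A) * c.
Proof.
move=> mC Hl.
have cC : pr P C = c.
  have := Hl [::]; rewrite (cylinder_nil X) preimage_setT setTI prT mul1r.
  by [].
apply: (cylinder_induction X_countable) => //.
- move=> A mA HA; have mjA := measurable_RV_preimage j mA.
  have := pr_split P mC mjA; rewrite setIC HA cC => cE.
  by rewrite preimage_setC prC // mulrBl mul1r setIC; lra.
move=> F mF tF HF.
have mjF n : measurable (s j @^-1` F n) by exact: measurable_RV_preimage.
rewrite preimage_bigcup setI_bigcupl.
have c0 : 0 <= c by rewrite -cC pr_ge0.
apply: EFin_inj; rewrite EFinM !prE; last 2 first.
- by apply: bigcupT_measurable.
- by apply: bigcupT_measurable => k; exact: measurableI.
have tjF : trivIset setT (fun n => s j @^-1` F n).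
  by move=> a b _ _ [w [wa wb]]; apply: (tF a b I I); exists (s j w).
rewrite !measure_bigcup //; first last.
- move=> a b _ _ [w [[wa _] [wb _]]]; apply: (tjF a b I I); by exists w.
- by move=> k _; exact: measurableI.
rewrite muleC -nneseriesZl //.
apply: eq_eseriesr => k _.
have E1 : (pr P (s j @^-1` F k `&` C))%:E = P (s j @^-1` F k `&` C).
  by rewrite prE //; exact: measurableI.
have E2 : (pr P (s j @^-1` F k))%:E = P (s j @^-1` F k) by rewrite prE.
by rewrite -[LHS]E1 -[X in (_ * X)%E]E2 HF EFinM muleC.
Qed.

Lemma mutually_independent_cylinders :
  (forall (J : seq nat) (l : nat -> seq (X * X)), uniq J ->
    pr P (joint J (fun j => cylinder (l j))) =
    \prod_(j <- J) pr P (s j @^-1` cylinder (l j))) ->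
  mutually_independent s.
Proof.
move=> Hcyl.
(* The indices in [J] carry arbitrary measurable sets and those in [K] still cylinders; the
   induction passes them from one to the other singly. *)
suff main (J K : seq nat) A l : uniq (J ++ K) -> (forall j, measurable (A j)) ->
    pr P (joint J A `&` joint K (fun j => cylinder (l j))) =
    \prod_(j <- J) pr P (s j @^-1` A j) * \prod_(j <- K) pr P (s j @^-1` cylinder (l j)).
  move=> J A mA; rewrite -prE; last exact: mjoint.
  rewrite (_ : (\prod_(i <- J) _)%E = (\prod_(i <- J) pr P (s i @^-1` A i))%:E).
    congr EFin; have := main (enum_fset J) [::] A (fun=> [::]).
    rewrite cats0 big_nil mulr1 => <- //; last exact: fset_uniq.
    congr pr; rewrite /joint (_ : [set` [::]] = set0) ?bigcap_set0 ?setIT //.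
    by apply/seteqP; split.
  rewrite -prodEFin; apply: eq_bigr => j _.
  by rewrite prE //; exact: measurable_RV_preimage.
elim: J K l => [|j J IHJ] K l uJK mA.
  rewrite big_nil mul1r -Hcyl //; congr pr.
  by rewrite /joint (_ : [set` [::]] = set0) ?bigcap_set0 ?setTI //; apply/seteqP; split.
have jK : j \notin K by move: uJK; rewrite /= mem_cat negb_or => /andP[/andP[]].
have uJjK : uniq (J ++ j :: K).
  by rewrite -[j :: K]cat1s (perm_uniq (permEl (perm_catCA J [:: j] K))).
have mcyl (l' : nat -> seq (X * X)) : forall k, measurable (cylinder (l' k)).
  by move=> k; exact: measurable_cylinder.
have uJK' : uniq (J ++ K) by move: uJK => /= /andP[].
rewrite {1}/joint bigcap_seq_cons -setIA big_cons -mulrA.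
apply: extend_product (mA j).
  by apply: measurableI; exact: mjoint.
move=> l1; pose l' k := if k == j then l1 else l k.
have l'E k : k \in K -> l' k = l k.
  by rewrite /l'; case: eqP => // ->; rewrite (negbTE jK).
have := IHJ (j :: K) l' uJjK mA.
rewrite {2}/joint bigcap_seq_cons big_cons {2 3}/l' !eqxx.
have -> : \bigcap_(k in [set` K]) (s k @^-1` cylinder (l' k)) =
    \bigcap_(k in [set` K]) (s k @^-1` cylinder (l k)).
  by apply: eq_bigcapr => k kK; have kl := l'E k kK; rewrite -/(l' k) kl.
rewrite [X in _ = _ * (_ * X)](eq_big_seq (fun k => pr P (s k @^-1` cylinder (l k)))); last first.
  by move=> k kK; have kl := l'E k kK; rewrite -/(l' k) kl.
have -> : l' j = l1 by rewrite /l' eqxx.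
by rewrite setICA mulrCA => H; exact: H.
Qed.

End independence_extension.

(** * Independence over disjoint blocks of coins *)

Section coin_independence.
Context (R : realType) d (Omega : measurableType d) (P : probability Omega R).
Variable (B : Omega -> nat -> bool).
Hypothesis fB : fair_coins P B.

Lemma pr_coins_indep S1 S2 (Q1 Q2 : (nat -> bool) -> Prop) : uniq (S1 ++ S2) ->
  depends_on S1 Q1 -> depends_on S2 Q2 ->
  pr P ([set w | Q1 (B w)] `&` [set w | Q2 (B w)]) =
  pr P [set w | Q1 (B w)] * pr P [set w | Q2 (B w)].
Proof.
move=> uS d1 d2; have := uS; rewrite cat_uniq => /and3P[u1 _ u2].
rewrite (pr_coins (fun=> false) fB u1 d1) (pr_coins (fun=> false) fB u2 d2).
rewrite -avg_prod //; last 2 first.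
- by move=> b b' bb'; rewrite (d1 _ _ bb').
- by move=> b b' bb'; rewrite (d2 _ _ bb').
rewrite -[_ `&` _]/[set w | (fun b => Q1 b /\ Q2 b) (B w)].
rewrite (pr_coins (fun=> false) fB uS); last first.
  move=> b b' bb'; rewrite (d1 b b') 1?(d2 b b') //.
    by move=> i iS; apply: bb'; rewrite mem_cat iS orbT.
  by move=> i iS; apply: bb'; rewrite mem_cat iS.
apply: avg_ext => b _; rewrite -natrM mulnb; congr (nat_of_bool _)%:R.
by rewrite asbool_and.
Qed.

Lemma pr_coins_mutual (J : seq nat) (S : nat -> seq nat) (Q : nat -> (nat -> bool) -> Prop) :
  uniq J -> (forall j, uniq (S j)) -> (forall j, depends_on (S j) (Q j)) ->
  pr P (\bigcap_(j in [set` J]) [set w | Q j (fun k => B w (code j k))]) =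
  \prod_(j <- J) pr P [set w | Q j (fun k => B w (code j k))].
Proof.
move=> + uS dQ; pose S' J := flatten [seq map (code j) (S j) | j <- J].
have mapS j k : k \in map (code j) (S j) -> exists i, k = code j i.
  by move=> /mapP[i _ ->]; exists i.
have memS' J' k : k \in S' J' -> exists j i, j \in J' /\ k = code j i.
  by move=> /flattenP[_ /mapP[j jJ ->] /mapS[i ->]]; exists j, i.
have dep j : depends_on (map (code j) (S j)) (fun b => Q j (fun k => b (code j k))).
  by move=> b b' bb'; apply: dQ => i iS; apply: bb'; exact: map_f.
have dep' J' : depends_on (S' J') (fun b => forall j, j \in J' -> Q j (fun k => b (code j k))).
  move=> b b' bb'; apply/propext; split=> H j jJ; have := H j jJ.
    rewrite (dep j b b') // => i iS; apply: bb'.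
    by apply/flattenP; exists (map (code j) (S j)) => //; apply/mapP; exists j.
  rewrite (dep j b b') // => i iS; apply: bb'.
  by apply/flattenP; exists (map (code j) (S j)) => //; apply/mapP; exists j.
have uS' J' : uniq J' -> uniq (S' J').
  elim: J' => [|j J' IHJ] //= /andP[jJ uJ]; rewrite /S' /= cat_uniq.
  rewrite map_inj_uniq ?uS ?IHJ ?andbT //=; last exact: code_inj2.
  apply/hasPn => k /memS' [j' [i' [j'J ->]]]; apply/negP => /mapS[i /code_inj[jj _]].
  by rewrite -jj j'J in jJ.
elim: J => [|j J IHJ] uJ.
  by rewrite big_nil (_ : [set` [::]] = set0) ?bigcap_set0 ?prT //; apply/seteqP; split.
rewrite bigcap_seq_cons big_cons -IHJ; last by case/andP: uJ.
have -> : \bigcap_(k in [set` J]) [set w | Q k (fun k0 => B w (code k k0))] =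
   [set w | (fun b => forall j, j \in J -> Q j (fun k => b (code j k))) (B w)] by [].
apply: (@pr_coins_indep (map (code j) (S j)) (S' J) (fun b => Q j (fun k => b (code j k)))
  (fun b => forall i, i \in J -> Q i (fun k => b (code i k)))) => //.
exact: uS' (j :: J) uJ.
Qed.

End coin_independence.

(** * Amenability implies zero capacity *)

Definition mkRV d d' (T : measurableType d) (T' : measurableType d') (R : realType)
    (P : probability T R) (f : T -> T') (mf : measurable_fun setT f) : {RV P >-> T'} :=
  HB.pack f (isMeasurableFun.Build _ _ _ _ f mf).

Section swap_walk.
Context (R : realType) (X : choiceType) (E : rel X) (X_countable : countable [set: X]).
Variables (e : X -> nat) (L : nat) (m : nat -> X -> X).
Hypotheses (e_inj : injective e) (mK : forall l, involutive (m l)).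
Hypothesis m_adj : forall l y, m l y = y \/ E y (m l y).
Context d (Omega : measurableType d) (P : probability Omega R).
Variable (B : Omega -> nat -> bool).
Hypothesis fB : fair_coins P B.

Let T := random_perm e L mK.

Let moves_coins (z : X) : seq nat := visit_coins e L m (iota 0 L.*2) z.

Let cyl_coins (l : seq (X * X)) : seq nat := undup (flatten [seq moves_coins zy.1 | zy <- l]).

Let cyl_depends l : depends_on (cyl_coins l) (fun b => cylinder l (T b)).
Proof.
move=> b b' bb'; rewrite /cylinder /agrees /=.
suff -> : all (fun zy => perm_fun (T b) zy.1 == zy.2) l =
    all (fun zy => perm_fun (T b') zy.1 == zy.2) l by [].
apply: eq_in_all => zy zyl; congr (_ == _); rewrite !random_permE.
apply: layers_depends => i ic; apply: bb'; rewrite mem_undup.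
by apply/flattenP; exists (moves_coins zy.1) => //; apply/mapP; exists zy.
Qed.

Lemma measurable_random_perm (B' : Omega -> nat -> bool) :
  (forall k, measurable [set w | B' w k]) ->
  measurable_fun setT (fun w => T (B' w) : borel_symgroup X).
Proof.
move=> mB; apply: measurable_moves_inv => // z y.
rewrite -[moves z y]setIT -(cylinder_nil X) -cylinder_cons.
have H := measurable_depends mB (@cyl_depends [:: (z, y)]).
exact: H.
Qed.

Let beta j w k := B w (code j k).

Let fbeta j : fair_coins P (beta j).
Proof. exact: fair_coins_reindex (@code_inj2 j) fB. Qed.

Definition swap_step j : {RV P >-> borel_symgroup X} :=
  mkRV P (measurable_random_perm (fbeta j).1).

Definition swap_law : probability (borel_symgroup X) R := distribution P (swap_step 0).

Let same_law (B1 B2 : Omega -> nat -> bool) : fair_coins P B1 -> fair_coins P B2 ->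
  forall A : set (borel_symgroup X), measurable A ->
  P [set w | A (T (B1 w))] = P [set w | A (T (B2 w))].
Proof.
move=> f1 f2; apply: (cylinder_induction X_countable).
- move=> l; rewrite -!prE; last 2 first.
  + exact: (measurable_depends f2.1 (@cyl_depends l)).
  + exact: (measurable_depends f1.1 (@cyl_depends l)).
  congr EFin; apply: (fair_coins_same_law f1 f2 _ (@cyl_depends l)).
  exact: undup_uniq.
- move=> A mA HA.
  have m1 := measurable_random_perm f1.1 measurableT mA.
  have m2 := measurable_random_perm f2.1 measurableT mA.
  rewrite setTI in m1; rewrite setTI in m2.
  rewrite -[X in P X = _]/(~` [set w | A (T (B1 w))]) -[X in _ = P X]/(~` [set w | A (T (B2 w))]).
  by rewrite !probability_setC // HA.
move=> F mF tF HF.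
have mk (B' : Omega -> nat -> bool) n : fair_coins P B' -> measurable [set w | F n (T (B' w))].
  by move=> f'; have := measurable_random_perm f'.1 measurableT (mF n); rewrite setTI.
have tk (B' : Omega -> nat -> bool) : trivIset setT (fun n => [set w | F n (T (B' w))]).
  by move=> a b _ _ [w [wa wb]]; apply: (tF a b I I); exists (T (B' w)).
have bE (B' : Omega -> nat -> bool) : [set w | (\bigcup_k F k) (T (B' w))] =
  \bigcup_k [set w | F k (T (B' w))] by [].
rewrite !bE !measure_bigcup //; last 2 first.
- by move=> k _; exact: mk.
- by move=> k _; exact: mk.
by apply: eq_eseriesr => k _; exact: HF.
Qed.

Lemma swap_step_iid : iid swap_law swap_step.
Proof.
split; last first.
  move=> j A mA; exact: (same_law (fbeta j) (fbeta 0) mA).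
apply: (mutually_independent_cylinders X_countable) => J l uJ.
apply: (@pr_coins_mutual _ _ _ P B fB J (fun j => cyl_coins (l j))
  (fun j b => cylinder (l j) (T b))) => //.
by move=> j; exact: undup_uniq.
Qed.

(** The inverse permutation is built from the coins relabelled by [mirror], which are again fair and
    therefore give the same law. *)
Lemma swap_law_symmetric : symmetric_measure swap_law.
Proof.
move=> A mA.
have fm : fair_coins P (fun w i => beta 0 w (mirror L i)).
  exact: fair_coins_reindex (@mirror_inj L) (fbeta 0).
rewrite -[LHS]/(P [set w | A (T (beta 0 w))]) (same_law (fbeta 0) fm mA).
congr (P _); apply/seteqP; split=> w Aw.
  have : A (perm_inv (T (beta 0 w))) by rewrite /T perm_inv_random_perm; exact: Aw.
  by move=> /set_invE.
have /set_invE : set_inv A (T (beta 0 w)) by exact: Aw.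
by rewrite /T perm_inv_random_perm.
Qed.

Lemma layers_gdist ls b y : (gdist R E y (layers e L m ls b y) <= (size ls)%:R%:E)%E.
Proof.
suff [p [yp lp] sp] : exists2 p, path E y p /\ last y p = layers e L m ls b y &
    (size p <= size ls)%N.
  apply: (@le_trans _ _ (size p)%:R%:E); last by rewrite lee_fin ler_nat.
  by apply: ereal_inf_lbound; exists p.
elim: ls => [|l ls [p [yp lp] sp]]; first by exists [::].
rewrite /= {1}/layer; case: ifP => _; last by exists p => //; exact: leqW.
have [pE|Em] := m_adj (minn l (L.*2.-1 - l)) (layers e L m ls b y).
  by rewrite /partner pE; exists p => //; exact: leqW.
exists (rcons p (partner L m l (layers e L m ls b y))); last by rewrite size_rcons.
by rewrite rcons_path yp lp last_rcons.
Qed.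

(** Each of the 2L layers moves a point along at most one edge; the extra unit ensures [r >= 1] even
    for [L = 0]. *)
Let r := L.*2.+1.

Lemma random_perm_wobbling b : wobbling_le R E r (T b).
Proof.
have le : (perm_range R E (T b) <= r%:R%:E)%E.
  apply: ge_ereal_sup => _ [y _ <-]; apply: le_trans (layers_gdist _ _ _) _.
  by rewrite lee_fin ler_nat size_iota.
by split=> //; rewrite /wobbling /= (le_lt_trans le) // ltry.
Qed.

Lemma swap_law_supported : supported_on swap_law (wobbling_le R E r).
Proof.
rewrite /supported_on -[LHS]/(P [set w | wobbling_le R E r (T (beta 0 w))]).
rewrite (_ : [set w | _] = setT) ?probability_setT //.
by apply/seteqP; split=> // w _; exact: random_perm_wobbling.
Qed.

Lemma swap_step_edge (l : nat) (y z : X) : (l < L)%N -> m l y = z ->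
  2^-1 ^+ L.*2 <= step swap_law z y.
Proof.
move=> lL <-.
(* Position at which layer [k] finds the point. One coin per layer is prescribed, only that of layer
   [l] being on, which gives 2L distinct coins and the stated probability. *)
pose point k := if (k < l)%N then m l y else y.
pose S := [seq coin_at e L m k (point k) | k <- iota 0 L.*2].
pose v (i : nat) := i == coin_at e L m l y.
have uS : uniq S.
  rewrite map_inj_in_uniq ?iota_uniq // => k k' _ _ /code_inj [].
  by [].
have sS : size S = L.*2 by rewrite size_map size_iota.
rewrite -sS -((fbeta 0).2 S v uS).
have mm : measurable [set w | moves y (m l y) (T (beta 0 w))].
  have := measurable_random_perm (fbeta 0).1 measurableT (measurable_moves y (m l y)).
  by rewrite setTI.
rewrite /step -[leRHS]/(pr P [set w | moves y (m l y) (T (beta 0 w))]).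
apply: pr_le => //; first exact: measurable_coin_cyl (fbeta 0).1.
move=> w /allP H; have {}H k : (k < L.*2)%N ->
    beta 0 w (coin_at e L m k (point k)) = (k == l).
  move=> kL; have /H /eqP -> : coin_at e L m k (point k) \in S.
    by apply/mapP; exists k => //; rewrite mem_iota.
  rewrite /v; apply/eqP/eqP => [/code_inj[]//|->].
  by rewrite /point ltnn.
rewrite /moves /=; apply: random_perm_edge => //.
- move=> k; rewrite mem_iota add0n => /andP[_ kl].
  have := H k; rewrite /point kl => -> //; first by rewrite ltn_eqF.
  by rewrite -addnn ltn_addr // (ltn_trans kl).
- have := H l; rewrite /point ltnn eqxx => -> //.
  by rewrite -addnn ltn_addr.
- move=> k; rewrite mem_iota => /andP[lk kL].
  have kl : (k < l)%N = false by rewrite ltnNge ltnW.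
  have := H k; rewrite /point kl => ->; first by rewrite gtn_eqF.
  by move: kL; rewrite subnKC // -addnn ltn_addr.
Qed.

Lemma walk_walk_from n w v : walk swap_step n w v = walk_from e L mK 0 n (B w) v.
Proof.
elim: n => [|n IHn] //.
by rewrite walk_fromS -IHn add0n.
Qed.

Variable x : X.

Let V n := undup (ball L m x (n * L.*2).+1).
Let ops n := orbit_ops e L m (V n) 0 n.

Lemma orbit_size_exec n w : inverted_orbit_size swap_step n x w = size (exec x (ops n) (B w)).
Proof.
have [|_ H] := @exec_orbit X e L m e_inj mK x (V n) (n * L.*2).+1 0 n (B w) _ erefl.
  exact: leqnSn.
rewrite inverted_orbit_sizeE; apply: perm_size; apply: uniq_perm.
- exact: undup_uniq.
- exact: exec_uniq.
move=> v; rewrite mem_undup; apply/mapP/idP => [[i]|/H[i i_n vi]].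
  rewrite mem_iota add0n => /andP[_ i_n] /esym /prewalk_eq vi; apply/H.
  by exists i => //; rewrite -walk_walk_from.
exists i; first by rewrite mem_iota.
by apply/esym/prewalk_eq; rewrite walk_walk_from.
Qed.

Let uops n : uniq (coins_of (ops n)).
Proof. by apply: uniq_orbit_coins => //; exact: undup_uniq. Qed.

Lemma integral_orbit_size n :
  (\int[P]_w (inverted_orbit_size swap_step n x w)%:R%:E =
   (\sum_(j < n.+1) pr P (fresh swap_step j x))%:E)%E.
Proof.
have mf j : measurable (fresh swap_step j x) by exact: measurable_fresh.
under eq_integral do rewrite inverted_orbit_size_fresh
  -[(\sum_(j < n.+1) _)%N]/(occurrences (fun j => fresh swap_step j x) n.+1 _)
  occurrencesE -sumEFin.
rewrite ge0_integral_sum //; last first.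
  by move=> j; exact/measurable_EFinP/measurable_indic.
rewrite -sumEFin; apply: eq_bigr => j _.
by rewrite integral_indic // setIT prE.
Qed.

Lemma expect_half_orbit n :
  (\int[P]_w ((2^-1 : R) ^+ inverted_orbit_size swap_step n x w)%:E <=
   (expR (- (\sum_(j < n.+1) pr P (fresh swap_step j x) / 2)))%:E)%E.
Proof.
under eq_integral do rewrite orbit_size_exec.
rewrite (integral_coins (fun=> false) fB (uops n)
  (f := fun b => (2^-1 : R) ^+ size (exec x (ops n) b))); last 2 first.
- by move=> b b' bb'; rewrite (exec_depends x bb').
- by move=> b; rewrite exprn_ge0.
(* The endpoints of the listed swaps are added because a partner may lie outside the ball. *)
pose W := undup (V n ++ flatten (map (op_points x) (ops n))).
rewrite lee_fin; apply: (le_trans (@half_weight_le R X x (ops n) W (uops n) _ _ _)).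
- exact: undup_uniq.
- by move=> y yo; rewrite mem_undup mem_cat yo orbT.
- move=> b y yb; rewrite mem_undup mem_cat; apply/orP; left.
  have [|H _] := @exec_orbit X e L m e_inj mK x (V n) (n * L.*2).+1 0 n b _ erefl.
    exact: leqnSn.
  by rewrite mem_undup; apply: ball_le (H _ yb); exact: leqnSn.
rewrite -mulr_suml ler_expR lerN2 ler_pM2r //.
rewrite -lee_fin -integral_orbit_size -(integral_coins (fun=> false) fB (uops n)) //.
- by under eq_integral do rewrite orbit_size_exec.
- by move=> b b' bb'; rewrite (exec_depends x bb').
Qed.

Lemma transient_not_amenable (c : R) : 0 < c ->
  (forall n, c <= pr P (fresh swap_step n x)) ->
  ~ (small_orbit_likely P swap_step x \/ no_exponential_decay P swap_step x).
Proof.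
move=> c0 fc.
have bound n : (\int[P]_w ((2^-1 : R) ^+ inverted_orbit_size swap_step n x w)%:E <=
    (expR (- (n%:R * c / 2)))%:E)%E.
  apply: le_trans (expect_half_orbit n) _; rewrite lee_fin ler_expR lerN2.
  rewrite -mulr_suml ler_pM2r //.
  apply: (@le_trans _ _ (\sum_(j < n.+1) c)); last by apply: ler_sum.
  by rewrite sumr_const card_ord -[leRHS]mulr_natl ler_pM2r // ler_nat.
have mI n : measurable_fun setT (fun w => (2^-1 : R) ^+ inverted_orbit_size swap_step n x w).
  under eq_fun do rewrite orbit_size_exec.
  apply: (@measurable_fun_depends _ _ _ B (coins_of (ops n)) (fun b => (2^-1 : R) ^+
    size (exec x (ops n) b)) fB.1).
  by move=> b b' bb'; rewrite (exec_depends x bb').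
case=> [small|nodecay].
  (* On the event of (i), [2^-|O_n|] is at least [expR (- (eps * n))], so (i) makes its expectation
     at least [expR (- (2 * eps * n))], with exponent [c * n / 4]; this contradicts the upper bound
     with exponent [c * n / 2]. *)
  pose eps := c / 8.
  have eps0 : 0 < eps by rewrite divr_gt0.
  have [N /= _ HN] := small eps eps0.
  have := HN N.+1 (leqnSn N); set n := N.+1; set A := [set w | _] => PA.
  have mA : measurable A.
    exact: (@measurable_orbit_size_le R X X_countable d Omega P swap_step n x (eps * n%:R)).
  have : (\int[P]_w ((expR (- (eps * n%:R)) * \1_A w)%:E) <= (expR (- (n%:R * c / 2)))%:E)%E.
    apply: le_trans (bound n); apply: ge0_le_integral => //.
    - by apply/measurable_EFinP; apply: measurable_funM => //; exact: measurable_indic.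
    - by apply/measurable_EFinP; exact: mI.
    move=> w _; rewrite lee_fin indicE; have [|_] := boolP (w \in A); last by rewrite
      mulr0 exprn_ge0.
    rewrite inE /A /= mulr1 => sz.
    set k := inverted_orbit_size _ _ _ _ in sz *.
    apply: (@le_trans _ _ (expR (- k%:R))); first by rewrite ler_expR lerN2.
    rewrite expRN -[k%:R]mulr1 expRM_natl -exprVn; apply: lerXn2r.
    + by rewrite nnegrE invr_ge0 expR_ge0.
    + by rewrite nnegrE invr_ge0.
    by rewrite lef_pV2 ?posrE ?expR_gt0 //; have := expR_ge1Dx (1 : R); lra.
  under eq_integral do rewrite EFinM.
  rewrite ge0_integralZl //; last exact/measurable_EFinP/measurable_indic.
  rewrite integral_indic // setIT => le1.
  have : ((expR (- (eps * n%:R)))%:E * (expR (- (eps * n%:R)))%:E <= (expR (- (n%:R * c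
    / 2)))%:E)%E.
    apply: le_trans le1; apply: lee_wpmul2l => //; by rewrite lee_fin expR_ge0.
  rewrite -EFinM -expRD lee_fin ler_expR.
  have n0 : 0 < n%:R :> R by rewrite ltr0n.
  have := mulr_gt0 n0 c0; rewrite /eps; lra.
have /cvgrPdist_lt /(_ (c / 2)) := nodecay.
rewrite divr_gt0 // => /(_ isT) [N _ HN].
have := HN N.+1 (leqnSn N); set n := N.+1; rewrite /= sub0r normrN ltNge => /negP; apply.
rewrite unlock; set I := (\int[P]_w _)%E.
(* An orbit has at most n + 1 points; this keeps the expectation positive, so that [ln] can be
   applied to the upper bound. *)
have I0 : (((2^-1 : R) ^+ n.+1)%:E <= I)%E.
  rewrite -[leLHS]mule1 -(probability_setT P) -integral_cst //.
  apply: ge0_le_integral => //.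
  - by move=> w _; rewrite /= lee_fin exprn_ge0.
  - by apply/measurable_EFinP; exact: mI.
  move=> w _; rewrite lee_fin; apply: ler_wiXn2l; [by []|lra|].
  rewrite inverted_orbit_size_fresh -[X in (_ <= X)%N]card_ord -sum1_card.
  by apply: leq_sum => j _; exact: leq_b1.
have If : I \is a fin_num.
  rewrite fin_numElt (lt_le_trans _ I0) ?ltNyr //=.
  by apply: le_lt_trans (bound n) _; exact: ltry.
have Ile : fine I <= expR (- (n%:R * c / 2)) by rewrite -lee_fin fineK //; exact: bound.
have Igt : 0 < fine I.
  rewrite -lte_fin fineK //; apply: lt_le_trans I0.
  by rewrite lte_fin exprn_gt0 // invr_gt0.
have n0 : 0 < n%:R :> R by rewrite ltr0n.
have lnI : ln (fine I) <= - (n%:R * c / 2).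
  by rewrite -(expRK (- (n%:R * c / 2))) ler_ln ?posrE ?expR_gt0.
have : n%:R^-1 * ln (fine I) <= - (c / 2).
  by rewrite ler_pdivrMl //; lra.
move=> H; rewrite -normrN; apply: le_trans (ler_norm _); lra.
Qed.

End swap_walk.

Theorem amenable_zero_capacity (R : realType) (X : choiceType) (E : rel X) :
  countable [set: X] -> symmetric E -> bounded_degree E ->
  diffuse_extensively_amenable R E -> forall x, zero_capacity (adj R E) x.
Proof.
move=> cX E_sym [D ED] dea x.
have E_fin y : finite_set (neighbors E y) by case: (ED y).
have E_deg y : (degree E y <= D)%N by case: (ED y).
have [e e_inj'] := countable_injP _ cX.
have e_inj : injective e by move=> y z; apply: e_inj'; rewrite inE.
have nbE y z : (z \in nbrs E y) = E y z by exact: mem_nbrs.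
have [L [m [mK m_adj m_cov]]] := matching_cover E_sym e_inj nbE E_deg.
have [d [W [P [B fB]]]] := fair_coins_exist R.
set s := swap_step cX e L mK fB.
have iid_s := swap_step_iid cX e L mK fB.
set mu := swap_law _ _ _ _ _ in iid_s.
have mu_sym : symmetric_measure mu by exact: swap_law_symmetric.
have mu_supp : supported_on mu (wobbling_le R E L.*2.+1) by exact: swap_law_supported.
have freshE n := pr_fresh_range cX E_sym E_fin mu_supp n x iid_s.
have null : escape_null (range_nbrs E L.*2.+1) (step mu) x.
  move=> c c0; apply: contrapT => /forallNP uge.
  have := dea L.*2.+1 x mu isT mu_sym mu_supp _ _ _ _ iid_s.
  apply: (transient_not_amenable e_inj c0) => n.
  by rewrite freshE; have /negP := uge n; rewrite -ltNge => /ltW.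
have rc := step_reversible cX E_sym E_fin mu_sym mu_supp.
have zc := escape_null_capacity rc null.
(* Inverse of the least probability with which the random permutation carries one endpoint of an
   edge to the other. *)
apply: (zero_capacity_le (C := 2 ^+ L.*2)) zc; first by rewrite exprn_gt0.
move=> y z _; rewrite mul1r /adj; have [yz|_] := boolP (E y z); last first.
  by rewrite mulr_ge0 ?exprn_ge0 // pr_ge0.
have [l lL ml] : exists2 l, (l < L)%N & m l z = y by apply: m_cov; rewrite E_sym.
have := swap_step_edge cX e mK fB lL ml.
by rewrite exprVn -ler_pdivrMl ?exprn_gt0 // mulr1.
Qed.

(** * A flow of finite energy in the octant *)

Section octant_flow.
Variable R : realType.
Implicit Types (i j k n M : nat) (F : nat -> nat -> nat -> R).

Let sq3 n : R := (n%:R + 1) * (n%:R + 2) * (n%:R + 3).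

(* Transition flow of Polya's urn: out of a point of level n the flow is
   2 / ((n + 1) (n + 2)), which makes every level uniform. *)
Let flow i n : R := 2 * (i%:R + 1) / sq3 n.

Definition sum3 M F : R := \sum_(0 <= i < M) \sum_(0 <= j < M) \sum_(0 <= k < M) F i j k.

Lemma sum3D M F G : sum3 M (fun i j k => F i j k + G i j k) = sum3 M F + sum3 M G.
Proof.
rewrite /sum3 -big_split; apply: eq_bigr => i _; rewrite -big_split.
by apply: eq_bigr => j _; rewrite -big_split.
Qed.

Let sum3_le M F G : (forall i j k, F i j k <= G i j k) -> sum3 M F <= sum3 M G.
Proof. by move=> FG; do 3!(apply: ler_sum => ? _). Qed.

Let sum3Z M c F : sum3 M (fun i j k => c * F i j k) = c * sum3 M F.
Proof.
rewrite /sum3 mulr_sumr; apply: eq_bigr => i _; rewrite mulr_sumr.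
by apply: eq_bigr => j _; rewrite mulr_sumr.
Qed.

Let shift_sum M (G : nat -> R) : G 0%N = 0 -> G M = 0 ->
  \sum_(0 <= i < M) G i.+1 = \sum_(0 <= i < M) G i.
Proof.
move=> G0 GM.
have -> : \sum_(0 <= i < M) G i.+1 = \sum_(0 <= i < M.+1) G i.
  by rewrite big_nat_recl //= G0 add0r.
by rewrite big_nat_recr //= GM addr0.
Qed.

(** Flow along the edge that arrives by raising a coordinate to [i]. The factor [i] removes edges
    from outside the octant, and nothing enters the origin. *)
Let inflow i n : R := if n is n'.+1 then 2 * i%:R / sq3 n' else 0.

Let sq3_gt0 n : 0 < sq3 n.
Proof. by rewrite /sq3 !mulr_gt0 // ltr_wpDl // ler0n. Qed.

Let out_flow i j k n : n = (i + j + k)%N ->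
  flow i n + flow j n + flow k n = 2 / ((n%:R + 1) * (n%:R + 2)).
Proof.
move=> ->; rewrite /flow -!mulrDl /sq3 !natrD; set a : R := _%:R; set b : R := _%:R;
  set c : R := _%:R.
have -> : 2 * (a + 1) + 2 * (b + 1) + 2 * (c + 1) = 2 * (a + b + c + 3) by lra.
have c0 : a + b + c + 3 != 0 by rewrite gt_eqF // ltr_wpDl // !addr_ge0 // ler0n.
by rewrite invfM mulrACA divff // mulr1.
Qed.

Let in_flow i j k n : n.+1 = (i + j + k)%N ->
  inflow i n.+1 + inflow j n.+1 + inflow k n.+1 = 2 / ((n%:R + 2) * (n%:R + 3)).
Proof.
move=> nE; have S : i%:R + j%:R + k%:R = n%:R + 1 :> R by rewrite -!natrD -nE natr1.
rewrite /inflow -!mulrDl -!mulrDr S /sq3.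
have c0 : n%:R + 1 != 0 :> R by rewrite gt_eqF // ltr_wpDl // ler0n.
by rewrite -[X in _ / X = _]mulrA [in LHS]invfM mulrA mulfK.
Qed.

Definition vanishing M F := forall i j k, (M <= i)%N || (M <= j)%N || (M <= k)%N -> F i j k = 0.

Definition grad M F : R := sum3 M (fun i j k =>
  (F i j k - F i.+1 j k) ^+ 2 + (F i j k - F i j.+1 k) ^+ 2 + (F i j k - F i j k.+1) ^+ 2).

Let level i j k := (i + j + k)%N.

(** Summation by parts against a flow with a unit source at the origin and no other divergence:
    [in_flow] and [out_flow] agree at every positive level, and [vanishing] removes the boundary
    terms. *)
Let flow_identity M F : (0 < M)%N -> vanishing M F ->
  sum3 M (fun i j k => flow i (level i j k) * (F i j k - F i.+1 j k) +
    flow j (level i j k) * (F i j k - F i j.+1 k) +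
    flow k (level i j k) * (F i j k - F i j k.+1)) = F 0%N 0%N 0%N.
Proof.
move=> M0 vF.
pose O i j k := (flow i (level i j k) + flow j (level i j k) + flow k (level i j k)) * F i j k.
pose I1 i j k := inflow i (level i j k) * F i j k.
pose I2 i j k := inflow j (level i j k) * F i j k.
pose I3 i j k := inflow k (level i j k) * F i j k.
have in0 n : inflow 0 n = 0 by case: n => //= n; rewrite mulr0 mul0r.
have inS i n : inflow i.+1 n.+1 = flow i n by rewrite /inflow /flow natr1.
have s1 : sum3 M (fun i j k => flow i (level i j k) * F i.+1 j k) = sum3 M I1.
  rewrite /sum3 [LHS]exchange_big [RHS]exchange_big /=; apply: eq_bigr => j _.
  rewrite [LHS]exchange_big [RHS]exchange_big /=; apply: eq_bigr => k _.
  rewrite -(@shift_sum M (fun i => I1 i j k)); last 2 first.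
  - by rewrite /I1 in0 mul0r.
  - by rewrite /I1 vF ?leqnn // mulr0.
  by apply: eq_bigr => i _; rewrite /I1 /level !addSn inS.
have s2 : sum3 M (fun i j k => flow j (level i j k) * F i j.+1 k) = sum3 M I2.
  rewrite /sum3; apply: eq_bigr => i _.
  rewrite [LHS]exchange_big [RHS]exchange_big /=; apply: eq_bigr => k _.
  rewrite -(@shift_sum M (fun j => I2 i j k)); last 2 first.
  - by rewrite /I2 in0 mul0r.
  - by rewrite /I2 vF ?leqnn ?orbT // mulr0.
  by apply: eq_bigr => j _; rewrite /I2 /level addnS addSn inS.
have s3 : sum3 M (fun i j k => flow k (level i j k) * F i j k.+1) = sum3 M I3.
  rewrite /sum3; apply: eq_bigr => i _; apply: eq_bigr => j _.
  rewrite -(@shift_sum M (fun k => I3 i j k)); last 2 first.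
  - by rewrite /I3 in0 mul0r.
  - by rewrite /I3 vF ?leqnn ?orbT // mulr0.
  by apply: eq_bigr => k _; rewrite /I3 /level addnS inS.
have -> : sum3 M (fun i j k => flow i (level i j k) * (F i j k - F i.+1 j k) +
    flow j (level i j k) * (F i j k - F i j.+1 k) +
    flow k (level i j k) * (F i j k - F i j k.+1)) =
  sum3 M O - (sum3 M I1 + sum3 M I2 + sum3 M I3).
  rewrite -s1 -s2 -s3 -!sum3D -[- _]mulN1r -sum3Z -sum3D.
  do 3!(apply: eq_bigr => ? _); rewrite /O; lra.
rewrite -!sum3D -[- _]mulN1r -sum3Z -sum3D.
have -> : sum3 M (fun i j k => O i j k + -1 * (I1 i j k + I2 i j k + I3 i j k)) =
    sum3 M (fun i j k => if level i j k == 0%N then F i j k else 0).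
  apply: eq_bigr => i _; apply: eq_bigr => j _; apply: eq_bigr => k _.
  have -> : O i j k + -1 * (I1 i j k + I2 i j k + I3 i j k) =
    (flow i (level i j k) + flow j (level i j k) + flow k (level i j k) -
     (inflow i (level i j k) + inflow j (level i j k) + inflow k (level i j k))) * F i j k.
    by rewrite /O /I1 /I2 /I3; lra.
  case lE: (level i j k) => [|n].
    rewrite /inflow !addr0 (@out_flow i j k 0%N) // !add0r mul1r subr0 divff ?mul1r //.
  rewrite (@in_flow i j k n) // (@out_flow i j k n.+1) // -[n.+1%:R]natr1.
  have -> : n%:R + 1 + 1 = n%:R + 2 :> R by lra.
  have -> : n%:R + 1 + 2 = n%:R + 3 :> R by lra.
  by rewrite subrr mul0r.
rewrite /sum3 big_ltn // [X in _ + X]big1_seq ?addr0; last first.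
  move=> i; rewrite mem_index_iota => /andP[_ /andP[i0 _]].
  rewrite big1 // => j _; rewrite big1 // => k _; rewrite /level.
  by rewrite !addn_eq0 eqn0Ngt i0.
rewrite big_ltn // [X in _ + X]big1_seq ?addr0; last first.
  move=> j; rewrite mem_index_iota => /andP[_ /andP[j0 _]].
  rewrite big1 // => k _; rewrite /level.
  by rewrite !addn_eq0 (eqn0Ngt j) j0 andbF.
rewrite big_ltn // [X in _ + X]big1_seq ?addr0 //.
move=> k; rewrite mem_index_iota => /andP[_ /andP[k0 _]].
by rewrite /level !addn_eq0 (eqn0Ngt k) k0 andbF.
Qed.

Let telescope_le M (u g : nat -> R) : (forall n, 0 <= g n) ->
  (forall n, u n <= g n - g n.+1) -> \sum_(0 <= n < M) u n <= g 0%N.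
Proof.
move=> g0 ug; apply: (@le_trans _ _ (\sum_(0 <= n < M) (g n - g n.+1))).
  exact: ler_sum.
rewrite -(opprK (\sum_(_ <= _ < _) _)) -sumrN.
under eq_bigr do rewrite opprB.
by rewrite telescope_sumr // opprB lerBlDr lerDl.
Qed.

Let inv_diff (a b : R) : a != 0 -> b != 0 -> a^-1 - b^-1 = (b - a) / (a * b).
Proof.
move=> a0 b0; rewrite mulrBl invfM [b * _]mulrCA divff // mulr1 mulrA divff // mul1r.
by [].
Qed.

(** Reciprocals of rising factorials: each is, up to a constant, a difference of the preceding one,
    so the triple sum of [g5] telescopes three times, to at most [1/3 * 1/2 * 1]. *)
Let g2 m : R := (m%:R + 1)^-1.
Let g3 m : R := ((m%:R + 1) * (m%:R + 2))^-1.
Let g4 m : R := ((m%:R + 1) * (m%:R + 2) * (m%:R + 3))^-1.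
Let g5 m : R := ((m%:R + 1) * (m%:R + 2) * (m%:R + 3) * (m%:R + 4))^-1.

Let pos m (c : R) : 0 < c -> 0 < m%:R + c.
Proof. by move=> c0; rewrite ltr_wpDl // ler0n. Qed.

Let g23 m : g3 m = g2 m - g2 m.+1.
Proof.
rewrite /g3 /g2 -[m.+1%:R]natr1.
have -> : m%:R + 1 + 1 = m%:R + 2 :> R by lra.
rewrite inv_diff ?gt_eqF ?pos //.
have -> : m%:R + 2 - (m%:R + 1) = 1 :> R by lra.
by rewrite mul1r.
Qed.

Let g34 m : 2 * g4 m = g3 m - g3 m.+1.
Proof.
have p1 := pos m ltr01; have p2 := pos m (ltr0Sn _ 1); have p3 := pos m (ltr0Sn _ 2).
rewrite /g4 /g3 -[m.+1%:R]natr1.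
have -> : m%:R + 1 + 1 = m%:R + 2 :> R by lra.
have -> : m%:R + 1 + 2 = m%:R + 3 :> R by lra.
rewrite !invfM; set a := (_ + 1)^-1; set b := (_ + 2)^-1; set c := (_ + 3)^-1.
have ea : a * (m%:R + 1) = 1 by rewrite mulVf // gt_eqF.
have ec : c * (m%:R + 3) = 1 by rewrite mulVf // gt_eqF.
have : a - c = 2 * (a * c).
  have -> : a - c = a * (c * (m%:R + 3)) - c * (a * (m%:R + 1)) by rewrite ea ec !mulr1.
  lra.
move=> ac; have -> : a * b - b * c = b * (a - c) by lra.
by rewrite ac; lra.
Qed.

Let g45 m : 3 * g5 m = g4 m - g4 m.+1.
Proof.
have p1 := pos m ltr01; have p2 := pos m (ltr0Sn _ 1).
have p3 := pos m (ltr0Sn _ 2); have p4 := pos m (ltr0Sn _ 3).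
rewrite /g5 /g4 -[m.+1%:R]natr1.
have -> : m%:R + 1 + 1 = m%:R + 2 :> R by lra.
have -> : m%:R + 1 + 2 = m%:R + 3 :> R by lra.
have -> : m%:R + 1 + 3 = m%:R + 4 :> R by lra.
rewrite !invfM; set a := (_ + 1)^-1; set b := (_ + 2)^-1; set c := (_ + 3)^-1.
set t := (_ + 4)^-1.
have ea : a * (m%:R + 1) = 1 by rewrite mulVf // gt_eqF.
have et : t * (m%:R + 4) = 1 by rewrite mulVf // gt_eqF.
have : a - t = 3 * (a * t).
  have -> : a - t = a * (t * (m%:R + 4)) - t * (a * (m%:R + 1)) by rewrite ea et !mulr1.
  lra.
move=> at_; have -> : a * b * c - b * c * t = b * c * (a - t) by lra.
by rewrite at_; lra.
Qed.

Let g_ge0 m : [/\ 0 <= g2 m, 0 <= g3 m, 0 <= g4 m & 0 <= g5 m].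
Proof.
by split; rewrite invr_ge0 ?mulr_ge0 // ltW // pos.
Qed.

Let sum_g5 M : sum3 M (fun i j k => g5 (level i j k)) <= 6^-1.
Proof.
have S5 m : \sum_(0 <= k < M) g5 (m + k) <= 3^-1 * g4 m.
  rewrite -[in leRHS](addn0 m).
  apply: (@telescope_le M _ (fun k => 3^-1 * g4 (m + k))) => n.
    by rewrite mulr_ge0 //; case: (g_ge0 (m + n)).
  by have := g45 (m + n); rewrite addnS; lra.
have S4 m : \sum_(0 <= k < M) g4 (m + k) <= 2^-1 * g3 m.
  rewrite -[in leRHS](addn0 m).
  apply: (@telescope_le M _ (fun k => 2^-1 * g3 (m + k))) => n.
    by rewrite mulr_ge0 //; case: (g_ge0 (m + n)).
  by have := g34 (m + n); rewrite addnS; lra.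
have S3 : \sum_(0 <= k < M) g3 k <= g2 0.
  by apply: telescope_le => n; [case: (g_ge0 n)|rewrite g23].
apply: (@le_trans _ _ (\sum_(0 <= i < M) \sum_(0 <= j < M) 3^-1 * g4 (i + j))).
  by apply: ler_sum => i _; apply: ler_sum => j _; exact: S5.
apply: (@le_trans _ _ (\sum_(0 <= i < M) 3^-1 * (2^-1 * g3 i))).
  by apply: ler_sum => i _; rewrite -mulr_sumr ler_pM2l // S4.
rewrite -!mulr_sumr; move: S3; rewrite /g2 add0r invr1; lra.
Qed.

(** The squares are bounded by the square of the total outflow. The constant comes from
    [(n + 3) (n + 4) <= 6 (n + 1) (n + 2)], an equality at n = 0. *)
Let flow_sq i j k n : n = level i j k ->
  flow i n ^+ 2 + flow j n ^+ 2 + flow k n ^+ 2 <= 24 * g5 n.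
Proof.
move=> nE; have fl0 a b : 0 <= flow a b.
  by rewrite /flow divr_ge0 ?ltW // mulr_ge0 // addr_ge0 // ler0n.
apply: (@le_trans _ _ ((flow i n + flow j n + flow k n) ^+ 2)).
  have := mulr_ge0 (fl0 i n) (fl0 j n); have := mulr_ge0 (fl0 i n) (fl0 k n).
  have := mulr_ge0 (fl0 j n) (fl0 k n); lra.
rewrite (@out_flow i j k n) // /g5.
have p1 := pos n ltr01; have p2 := pos n (ltr0Sn _ 1).
have p3 := pos n (ltr0Sn _ 2); have p4 := pos n (ltr0Sn _ 3).
have n0 : 0 <= n%:R :> R by rewrite ler0n.
rewrite expr_div_n ler_pdivrMr ?exprn_gt0 ?mulr_gt0 //.
rewrite mulrAC ler_pdivlMr ?mulr_gt0 //.
set x : R := n%:R in p1 p2 p3 p4 n0 *.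
have q : 0 <= (x + 1) * (x + 2) by rewrite mulr_ge0 // ltW.
have : 0 <= (x + 1) * (x + 2) * (6 * ((x + 1) * (x + 2)) - (x + 3) * (x + 4)).
  apply: mulr_ge0 => //; have := mulr_ge0 n0 n0; lra.
lra.
Qed.

Lemma octant_energy M F : vanishing M F -> F 0%N 0%N 0%N = 1 -> 4^-1 <= grad M F.
Proof.
move=> vF F1; have M0 : (0 < M)%N.
  by rewrite lt0n; apply: contra_eq_neq F1 => M0; rewrite vF ?M0 // eq_sym oner_eq0.
have := flow_identity M0 vF; rewrite F1 => id1.
(* Young's inequality [a * u <= a^2 / 8 + 2 * u^2]. The flow part is at most [24 / 6 / 8 = 1/2], so
   twice the gradient energy is at least 1/2. *)
have : 1 <= sum3 M (fun i j k => 8^-1 * (24 * g5 (level i j k)) + 2 *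
  ((F i j k - F i.+1 j k) ^+ 2 + (F i j k - F i j.+1 k) ^+ 2 + (F i j k - F i j k.+1) ^+ 2)).
  rewrite -[leLHS]id1; apply: sum3_le => i j k.
  have := @flow_sq i j k _ erefl.
  set a := flow _ _; set b := flow _ _; set c := flow _ _; set g := g5 _.
  set u := F i j k - _; set v := F i j k - F _ _.+1 _; set w := F i j k - F _ _ _.+1.
  have := sqr_ge0 (a - 4 * u); have := sqr_ge0 (b - 4 * v); have := sqr_ge0 (c - 4 * w).
  lra.
rewrite sum3D !sum3Z -/(grad M F); have := sum_g5 M; lra.
Qed.

End octant_flow.

(** * The integer lattice *)

Section integer_lattice.
Context (R : realType) (d : nat).
Local Notation E := (@Zd_graph d).
Implicit Types u v : 'rV[int]_d.

Lemma Zd_graph_sym : symmetric E.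
Proof.
by move=> u v; congr (_ == _); apply: eq_bigr => i _; rewrite distrC.
Qed.

Lemma Zd_countable : countable [set: 'rV[int]_d].
Proof. exact: countableP. Qed.

Let shifts u : seq 'rV[int]_d :=
  [seq u + (\row_i (nat_of_ord (a i))%:Z - const_mx 1) | a : {ffun 'I_d -> 'I_3}].

Let Zd_neighbors u v : E u v -> v \in shifts u.
Proof.
move=> /eqP uv.
have le1 i : `|u 0 i - v 0 i| <= 1.
  rewrite -uv (bigD1 i) //= lerDl; apply: sumr_ge0 => j _; exact: normr_ge0.
have ab i : (absz (v 0 i - u 0 i + 1)%R < 3)%N.
  by have := le1 i; lia.
apply/mapP; exists [ffun i => Ordinal (ab i)]; first by rewrite mem_enum.
apply/rowP => i; rewrite !mxE ffunE /=.
by have := le1 i; lia.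
Qed.

Lemma Zd_bounded_degree : bounded_degree E.
Proof.
exists #|{ffun 'I_d -> 'I_3}| => u.
have fin : finite_set (neighbors E u).
  apply: (@sub_finite_set _ _ [set` shifts u]); last exact: finite_seq.
  by move=> v /Zd_neighbors.
split=> //; rewrite /degree cardT -(size_map (fun a : {ffun 'I_d -> 'I_3} =>
  u + (\row_i (nat_of_ord (a i))%:Z - const_mx 1))).
apply: uniq_leq_size; first exact: fset_uniq.
move=> v; have := in_fset_set fin v; rewrite /= => ->.
by rewrite inE => /Zd_neighbors.
Qed.

Hypothesis d3 : (3 <= d)%N.

Let pt (i j k : nat) : 'rV[int]_d :=
  \row_(l < d) (if l == 0%N :> nat then i%:Z else if l == 1%N :> nat then j%:Z
     else if l == 2%N :> nat then k%:Z else 0).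

Let o0 : 'I_d := Ordinal (leq_trans (isT : (1 <= 3)%N) d3).
Let o1 : 'I_d := Ordinal (leq_trans (isT : (2 <= 3)%N) d3).
Let o2 : 'I_d := Ordinal d3.

Let pt0 i j k : pt i j k 0 o0 = i. Proof. by rewrite mxE. Qed.
Let pt1 i j k : pt i j k 0 o1 = j. Proof. by rewrite mxE. Qed.
Let pt2 i j k : pt i j k 0 o2 = k. Proof. by rewrite mxE. Qed.

Let pt_inj i j k i' j' k' : pt i j k = pt i' j' k' -> [/\ i = i', j = j' & k = k'].
Proof.
move=> H; split; apply/eqP; rewrite -eqz_nat; apply/eqP.
- by rewrite -(pt0 i j k) H pt0.
- by rewrite -(pt1 i j k) H pt1.
- by rewrite -(pt2 i j k) H pt2.
Qed.

Let edge (o : 'I_d) u v : `|u 0 o - v 0 o| = 1 -> (forall l, l != o -> u 0 l = v 0 l) -> E u v.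
Proof.
move=> uo ul; rewrite /Zd_graph (bigD1 o) //= uo big1 ?addr0 // => l lo.
by rewrite ul // subrr normr0.
Qed.

Let ord_neq (l o : 'I_d) : l != o -> ((l : nat) == o) = false.
Proof. by move=> lo; apply/negbTE. Qed.

Let edge0 i j k : E (pt i j k) (pt i.+1 j k).
Proof.
apply: (@edge o0); first by rewrite !pt0; lia.
by move=> l /ord_neq lo; rewrite !mxE lo.
Qed.

Let edge1 i j k : E (pt i j k) (pt i j.+1 k).
Proof.
apply: (@edge o1); first by rewrite !pt1; lia.
by move=> l /ord_neq lo; rewrite !mxE lo.
Qed.

Let edge2 i j k : E (pt i j k) (pt i j k.+1).
Proof.
apply: (@edge o2); first by rewrite !pt2; lia.
by move=> l /ord_neq lo; rewrite !mxE lo.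
Qed.

Lemma Zd_transient : ~ zero_capacity (adj R E) 0.
Proof.
(* Each of the three coordinate directions is bounded by the whole energy, so the octant would have
   energy at most 3/24, below the lower bound 1/4. *)
move=> /(_ 24^-1) [|f [V [fV f0 fW]]]; first by rewrite invr_gt0.
pose M := (\max_(v <- V) \max_(l < d) absz (v 0%R l))%N.+1.
have VM v l : v \in V -> (absz (v 0%R l) < M)%N.
  move=> vV; rewrite ltnS; apply: (@leq_trans (\max_(l < d) absz (v 0%R l))%N).
    exact: leq_bigmax.
  by rewrite (big_rem v) //= leq_maxl.
pose F i j k := f (pt i j k).
have vF i j k : (M <= i)%N || (M <= j)%N || (M <= k)%N -> F i j k = 0.
  move=> big; apply: fV; apply: contraL big => ptV.
  rewrite !negb_or -!ltnNge.
  have := VM _ o0 ptV; have := VM _ o1 ptV; have := VM _ o2 ptV.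
  by rewrite pt0 pt1 pt2 !absz_nat => -> -> ->.
have F0 : F 0%N 0%N 0%N = 1.
  rewrite /F (_ : pt 0 0 0 = 0) //; apply/rowP => l; rewrite !mxE.
  by do 3!case: ifP => //.
pose W := [seq pt t.1.1 t.1.2 t.2 |
   t <- [seq (ij, k) | ij <- [seq (i, j) | i <- iota 0 M.+1, j <- iota 0 M.+1], k <- iota 0 M.+1]].
have uW : uniq W.
  rewrite map_inj_in_uniq.
    by apply: allpairs_uniq; [apply: allpairs_uniq; rewrite ?iota_uniq // => -[? ?] [?
      ?]|exact: iota_uniq|case=> ? ? [? ?]].
  by move=> [[i j] k] [[i' j'] k'] _ _ /pt_inj /= [-> -> ->].
have memW i j k : (i <= M)%N -> (j <= M)%N -> (k <= M)%N -> pt i j k \in W.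
  move=> iM jM kM; apply/mapP; exists (i, j, k) => //.
  apply/allpairsP; exists ((i, j), k); split; [|by rewrite mem_iota|by []].
  by apply/allpairsP; exists (i, j); split; rewrite ?mem_iota.
have sumW (g : 'rV[int]_d -> R) : (forall v, 0 <= g v) ->
    \sum_(0 <= i < M) \sum_(0 <= j < M) \sum_(0 <= k < M) g (pt i j k) <= \sum_(v <- W) g v.
  move=> g0.
  have -> : \sum_(v <- W) g v = \sum_(0 <= i < M.+1) \sum_(0 <= j < M.+1) \sum_(0 <= k
    < M.+1) g (pt i j k).
    by rewrite big_map !big_allpairs /index_iota subn0.
  rewrite [leRHS]big_nat_recr //= -[leLHS]addr0; apply: lerD; last first.
    by do 2!(apply: sumr_ge0 => ? _).
  apply: ler_sum => i _; rewrite [leRHS]big_nat_recr //= -[leLHS]addr0; apply: lerD; last first.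
    by apply: sumr_ge0.
  by apply: ler_sum => j _; rewrite [leRHS]big_nat_recr //= lerDl.
have dir (s : nat -> nat -> nat -> 'rV[int]_d) :
    (forall i j k, E (pt i j k) (s i j k)) ->
    (forall i j k, (i < M)%N -> (j < M)%N -> (k < M)%N -> s i j k \in W) ->
    \sum_(0 <= i < M) \sum_(0 <= j < M) \sum_(0 <= k < M) (F i j k - f (s i j k)) ^+ 2
    <= energy (adj R E) W f.
  move=> Es sW.
  apply: le_trans (sumW (fun v => \sum_(z <- W) adj R E v z * (f v - f z) ^+ 2) _); last first.
    by move=> v; apply: sumr_ge0 => z _; rewrite mulr_ge0 ?sqr_ge0 // ler0n.
  apply: ler_sum_nat => i /andP[_ iM]; apply: ler_sum_nat => j /andP[_ jM].
  apply: ler_sum_nat => k /andP[_ kM].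
  rewrite -/(F i j k) (bigD1_seq (s i j k)) ?sW //= {1}/adj Es mul1r lerDl.
  by apply: sumr_ge0 => z _; rewrite mulr_ge0 ?sqr_ge0 // ler0n.
have := octant_energy vF F0.
have := dir (fun i j k => pt i.+1 j k) edge0; have := dir (fun i j k => pt i j.+1 k) edge1.
have := dir (fun i j k => pt i j k.+1) edge2.
move=> d1 d2 d3'.
have {}d1 := d1 (fun i j k iM jM kM => memW _ _ _ (ltnW iM) (ltnW jM) kM).
have {}d2 := d2 (fun i j k iM jM kM => memW _ _ _ (ltnW iM) jM (ltnW kM)).
have {}d3' := d3' (fun i j k iM jM kM => memW _ _ _ iM (ltnW jM) (ltnW kM)).
have eW := fW W uW.
rewrite /grad !sum3D => gr.
move: gr d1 d2 d3' eW; rewrite /sum3 /F; lra.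
Qed.

End integer_lattice.

(** By connectedness the vertex set is a countable union of finite balls around any vertex. *)
Lemma connected_countable (X : choiceType) (E : rel X) :
  connected_graph E -> (forall y, finite_set (neighbors E y)) -> countable [set: X].
Proof.
move=> conn E_fin.
have [X0|/set0P[x _]] := eqVneq [set: X] set0; first by rewrite X0.
have -> : [set: X] = \bigcup_n [set` walk_ends (nbrs E) n x].
  apply/seteqP; split=> // y _; have [p xp <-] := conn x y.
  exists (size p) => //; apply: path_walk_ends xp _ => //.
  by move=> a b; exact: mem_nbrs.
apply: bigcup_countable => // n _; apply: finite_set_countable; exact: finite_seq.
Qed.

Theorem theorem1p16 (R : realType) :
  (forall (X : choiceType) (E : rel X),
     simple_graph E -> connected_graph E -> bounded_degree E ->
     (diffuse_extensively_amenable R E <-> recurrent R E)) /\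
  (forall d : nat, (3 <= d)%N ->
     ~ diffuse_extensively_amenable R (@Zd_graph d)).
Proof.
split=> [X E [E_sym _] conn bd|d d3 dea]; last first.
  apply: (@Zd_transient R d d3).
  exact: (amenable_zero_capacity (Zd_countable d) (@Zd_graph_sym d) (Zd_bounded_degree d) dea).
have E_fin y : finite_set (neighbors E y) by have [D /(_ y) []] := bd.
have cX := connected_countable conn E_fin.
split=> H.
  apply: zero_capacity_recurrent => //.
  exact: (amenable_zero_capacity cX E_sym bd H).
apply: zero_capacity_amenable => //.
exact: recurrent_zero_capacity.
Qed.
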